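(* Let $\beta\ge1$ be an integer, $L>0$, and let $f\in\mathcal S^p_L(\beta)$ be a probability density on $[0,1]^d$ with $X_1,\dots,X_n$ i.i.d. of density $f$, and $\rho>0$. There exist $C_1>0$ depending on $\beta$ and $L$, and $C_2>0$ depending on $\beta$, $d$ and $\|f\|_\infty$, such that if $\min\{n,n\sqrt{\rho/\log_2 n}\}\ge C_2$, then the estimator $\hat f_{\hat M}$ of the selection procedure (context) run with $\mathcal M=\{1,2,4,\dots,2^{\lfloor\log_2((n^{1/d}-1)/2)\rfloor}\}$ is $\rho$-zCDP and $$\mathbb E\left(\|f-\hat f_{\hat M}\|^2\right)\le C_1\max\left\{n^{-\frac{2\beta}{2\beta+d}},\left(\frac{n\sqrt\rho}{\sqrt{\log_2 n}}\right)^{-\frac{2\beta}{\beta+d}}\right\}.$$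
   Context: Selection procedure: $\phi_k(x)=e^{i2\pi\langle k,x\rangle}$; $S_M=\mathrm{span}(\phi_k)_{k\in\{-M,\dots,M\}^d}$ with orthogonal projection $\Pi_{S_M}$. For each $M\in\mathcal M$, $\hat f_M=\sum_{k\in\{-M,\dots,M\}^d}(\tilde\theta_k+\sigma_M\xi_k)\phi_k$, $\tilde\theta_k=\frac1n\sum_j\overline{\phi_k(X_j)}$, $\sigma_M=\frac{2\sqrt{(2M+1)^d}}{n\sqrt{\rho/|\mathcal M|}}$, $\xi_k$ i.i.d. $\mathcal N(0,1)+i\mathcal N(0,1)$ (independent across $k$, $M$, data). $\Lambda^{(1)}(M)=\frac{96(2M+1)^d}{n}+\frac{96(2M+1)^{2d}}{n^2\rho/|\mathcal M|}$, $\Lambda^{(2)}(M)=\Lambda^{(1)}(M)+\frac{16(2M+1)^{2d}}{n^2\rho/|\mathcal M|}$, $B^2(M)=\max_{M'\in\mathcal M}\{\|\Pi_{S_{M'}}\hat f_M-\hat f_{M'}\|^2-\Lambda^{(1)}(M')\}$, $\hat M\in\arg\min_{M\in\mathcal M}\{B^2(M)+\Lambda^{(2)}(M)\}$. $\|\cdot\|$ is the $L^2([0,1]^d)$ norm. $\mathcal S^p_L(\beta)$: $f\in\mathcal C^\beta([0,1]^d)$ with $\sum_{|\alpha|=\beta}\int|\partial^\alpha f|^2\le L^2$ and $\partial^\alpha f(x)=\partial^\alpha f(x_1,\dots,1-x_i,\dots,x_d)$ whenever $|\alpha|<\beta$ and $x_i\in\{0,1\}$. $\rho$-zCDP: for datasets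 differing in at most one entry, Rényi divergence of order $\alpha$ between output laws $\le\rho\alpha$ for all $\alpha>1$. *)

(* Defs.v *)
From HB Require Import structures.
From mathcomp Require Import all_boot all_order all_algebra.
From mathcomp Require Import complex.
From mathcomp Require Import all_classical all_reals all_analysis.
Set Implicit Arguments.
Unset Strict Implicit.
Unset Printing Implicit Defensive.
Import Order.TTheory GRing.Theory Num.Theory.
Import numFieldTopology.Exports numFieldNormedType.Exports.
Local Open Scope ring_scope.

Definition unit_cube (R : realType) (d : nat) : set 'rV[R]_d :=
  [set x | forall i, 0 <= x ord0 i <= 1].

Fixpoint cube_int (R : realType) (n : nat) : ('rV[R]_n -> R) -> R :=
  match n with
  | 0 => fun g => g 0
  | m.+1 => fun g => Rintegral (@lebesgue_measure R) `[0, 1]%classic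
             (fun t => cube_int (fun v : 'rV[R]_m => g (row_mx (\row_(j < 1) t) v)))
  end.

Fixpoint cube_eint (R : realType) (n : nat) : ('rV[R]_n -> \bar R) -> \bar R :=
  match n with
  | 0 => fun g => g 0
  | m.+1 => fun g => integral (@lebesgue_measure R) `[(0:R), 1]%classic
             (fun t => cube_eint (fun v : 'rV[R]_m => g (row_mx (\row_(j < 1) t) v)))
  end.

Definition dotk (R : realType) (d : nat) (k : 'rV[int]_d) (x : 'rV[R]_d) : R :=
  \sum_(i < d) (k ord0 i)%:~R * x ord0 i.

Definition phi (R : realType) (d : nat) (k : 'rV[int]_d) (x : 'rV[R]_d) : R[i] :=
  Complex (cos (2 * pi * dotk k x)) (sin (2 * pi * dotk k x)).

(* the frequency set {-M,...,M}^d is indexed by 'rV['I_(2M+1)]_d *)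
Definition kval (M d : nat) (k : 'rV['I_(2 * M + 1)]_d) : 'rV[int]_d :=
  map_mx (fun a : 'I_(2 * M + 1) => (a : nat)%:Z - M%:Z) k.

Definition cube_intC (R : realType) (d : nat) (g : 'rV[R]_d -> R[i]) : R[i] :=
  Complex (cube_int (fun x => complex.Re (g x))) (cube_int (fun x => complex.Im (g x))).

Definition L2inner (R : realType) (d : nat) (g h : 'rV[R]_d -> R[i]) : R[i] :=
  cube_intC (fun x => g x * conjc (h x)).

Definition sqmod (R : realType) (z : R[i]) : R :=
  complex.Re z ^+ 2 + complex.Im z ^+ 2.

Definition L2sq (R : realType) (d : nat) (g : 'rV[R]_d -> R[i]) : R :=
  cube_int (fun x => sqmod (g x)).

(* orthogonal projection onto S_M = span(phi_k, k in {-M..M}^d)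
   (expansion on the orthonormal family (phi_k)) *)
Definition projS (R : realType) (d M : nat) (g : 'rV[R]_d -> R[i]) : 'rV[R]_d -> R[i] :=
  fun x => \sum_(k : 'rV['I_(2 * M + 1)]_d) L2inner g (phi (kval k)) * phi (kval k) x.

Definition log2 (R : realType) (x : R) : R := ln x / ln 2.

(* M ranges over {1,2,4,...,2^Jmax}, Jmax = floor(log2((n^(1/d)-1)/2)) *)
Definition Jmax (R : realType) (n d : nat) : nat :=
  Num.truncn (log2 ((((n%:R : R) `^ (d%:R)^-1) - 1) / 2)).

(* index of the noise variables xi_k^{(M)}, M = 2^m, k in {-M..M}^d *)
Definition noise_idx (J d : nat) : finType :=
  {m : 'I_J.+1 & 'rV['I_(2 * expn 2 m + 1)]_d}.

Definition theta_tilde (R : realType) (n d : nat) (x : 'I_n -> 'rV[R]_d)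
  (k : 'rV[int]_d) : R[i] :=
  (n%:R)^-1 * \sum_(j < n) conjc (phi k (x j)).

Definition sigmaM (R : realType) (n d : nat) (rho : R) (cardM M : nat) : R :=
  2 * Num.sqrt ((expn (2 * M + 1) d)%:R) / (n%:R * Num.sqrt (rho / cardM%:R)).

Definition Lambda1 (R : realType) (n d : nat) (rho : R) (cardM M : nat) : R :=
  96 * (expn (2 * M + 1) d)%:R / n%:R
  + 96 * (expn (2 * M + 1) (2 * d))%:R / (n%:R ^+ 2 * (rho / cardM%:R)).

Definition Lambda2 (R : realType) (n d : nat) (rho : R) (cardM M : nat) : R :=
  Lambda1 n d rho cardM M
  + 16 * (expn (2 * M + 1) (2 * d))%:R / (n%:R ^+ 2 * (rho / cardM%:R)).

Section procedure.
Variables (R : realType) (n d : nat) (rho : R).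
Let J := Jmax R n d.
Let cardM := J.+1.
Let Mv (m : 'I_J.+1) : nat := expn 2 m.

Definition fhat (x : 'I_n -> 'rV[R]_d) (xi : noise_idx J d -> R[i])
  (m : 'I_J.+1) : 'rV[R]_d -> R[i] :=
  fun y => \sum_(k : 'rV['I_(2 * expn 2 m + 1)]_d)
    (theta_tilde x (kval k) + ((sigmaM n d rho cardM (Mv m))%:C)%C * xi (existT _ m k))
    * phi (kval k) y.

Definition B2 (x : 'I_n -> 'rV[R]_d) (xi : noise_idx J d -> R[i]) (m : 'I_J.+1) : R :=
  let F := fun m' : 'I_J.+1 =>
    L2sq (fun y => projS (Mv m') (fhat x xi m) y - fhat x xi m' y)
    - Lambda1 n d rho cardM (Mv m') in
  \big[Num.max/F ord0]_(m' < J.+1) F m'.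

Definition Mhat (x : 'I_n -> 'rV[R]_d) (xi : noise_idx J d -> R[i]) : 'I_J.+1 :=
  [arg min_(m < ord0) (B2 x xi m + Lambda2 n d rho cardM (Mv m))]%O.

Definition fhat_sel (x : 'I_n -> 'rV[R]_d) (xi : noise_idx J d -> R[i]) :
  'rV[R]_d -> R[i] := fhat x xi (Mhat x xi).

(* Output space of the released function: hat f_{hat M} lies in S_{Mmax}
   (Mmax = 2^J); it is identified with its Fourier coefficients on
   {-Mmax..Mmax}^d (real and imaginary parts), i.e. a tuple of reals. *)
Definition out_idx : finType := ('rV['I_(2 * expn 2 J + 1)]_d * bool)%type.

Definition out_type := (#|{: out_idx}|).-tuple R.

Definition release (x : 'I_n -> 'rV[R]_d) (xi : noise_idx J d -> R[i]) : out_type :=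
  [tuple (let kb := enum_val i in
          let c := L2inner (fhat_sel x xi) (phi (kval kb.1)) in
          if kb.2 then complex.Re c else complex.Im c) | i < #|{: out_idx}|].

End procedure.

Definition eln (R : realType) (x : \bar R) : \bar R :=
  match x with
  | EFin r => (ln r)%:E
  | +oo%E => +oo%E
  | -oo%E => -oo%E
  end.

Definition renyi_div (dS : measure_display) (S : measurableType dS) (R : realType)
  (alpha : R) (P Q : probability S R) : \bar R :=
  if `[< charge_of_finite_measure P `<< Q >] then
    (((alpha - 1)^-1)%:E *
      eln (\int[Q]_s ((fine (Radon_Nikodym (charge_of_finite_measure P) Q s)) `^ alpha)%:E))%E
  else +oo%E.

Definition zCDP (R : realType) (rho : R) (D : Type) (n : nat) (Dom : set D)
  (dS : measure_display) (S : measurableType dS)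
  (mech : ('I_n -> D) -> probability S R) : Prop :=
  forall x x' : 'I_n -> D,
    (forall j, Dom (x j)) -> (forall j, Dom (x' j)) ->
    (exists j0, forall j, j != j0 -> x j = x' j) ->
    forall alpha : R, 1 < alpha ->
      (renyi_div alpha (mech x) (mech x') <= (rho * alpha)%:E)%E.

Definition partial (R : realType) (d : nat) (i : 'I_d) (g : 'rV[R]_d -> R) :
  'rV[R]_d -> R := fun x => 'D_('e_i) g x.

Definition Dseq (R : realType) (d : nat) (s : seq 'I_d) (g : 'rV[R]_d -> R) :
  'rV[R]_d -> R := foldr (fun i h => partial i h) g s.

Definition dalpha (R : realType) (d : nat) (a : 'I_d -> nat) (g : 'rV[R]_d -> R) :
  'rV[R]_d -> R := Dseq (flatten [seq nseq (a i) i | i <- enum 'I_d]) g.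

Definition Cbeta (R : realType) (d beta : nat) (g : 'rV[R]_d -> R) : Prop :=
  forall s : seq 'I_d, (size s <= beta)%N ->
    continuous (Dseq s g) /\
    ((size s < beta)%N -> forall (i : 'I_d) (x : 'rV[R]_d), derivable (Dseq s g) x 'e_i).

Definition flip_coord (R : realType) (d : nat) (i : 'I_d) (x : 'rV[R]_d) : 'rV[R]_d :=
  \row_(l < d) (if l == i then 1 - x ord0 i else x ord0 l).

(* f in S^p_L(beta): f in C^beta([0,1]^d) (restriction to the cube of a
   C^beta function g on R^d; derivatives on the closed cube are those of g),
   sum_{|alpha|=beta} \int |partial^alpha f|^2 <= L^2, and periodicity of the
   derivatives of order < beta. *)
Definition sobolev_periodic (R : realType) (d beta : nat) (L : R) (f : 'rV[R]_d -> R) : Prop :=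
  exists g : 'rV[R]_d -> R,
    [/\ Cbeta beta g,
        (forall x, unit_cube x -> g x = f x),
        \sum_(a : {ffun 'I_d -> 'I_beta.+1} | (\sum_(i < d) (a i : nat) == beta)%N)
            cube_int (fun x => (dalpha (fun i => a i : nat) g x) ^+ 2) <= L ^+ 2 &
        forall a : 'I_d -> nat, (\sum_(i < d) a i < beta)%N ->
          forall x i, unit_cube x -> (x ord0 i = 0 \/ x ord0 i = 1) ->
            dalpha a g x = dalpha a g (flip_coord i x)].

Definition cube_density (R : realType) (d : nat) (f : 'rV[R]_d -> R) : Prop :=
  (forall x, unit_cube x -> 0 <= f x) /\ cube_eint (fun x => (f x)%:E) = 1%E.

Definition sup_norm (R : realType) (d : nat) (f : 'rV[R]_d -> R) : R :=
  sup [set `|f x| | x in unit_cube (R:=R) (d:=d)]%classic.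

Definition borel_rV (R : realType) (d : nat) : set (set 'rV[R]_d) :=
  <<s [set U : set 'rV[R]_d | open U] >>%classic.

Definition noise_of (T : Type) (R : realType) (I : Type) (Z : (I * bool)%type -> T -> R)
  (w : T) : I -> R[i] := fun i => Complex (Z (i, true) w) (Z (i, false) w).

Local Open Scope classical_set_scope.

Definition sample_model (dT : measure_display) (T : measurableType dT) (R : realType)
  (P : probability T R) (n d : nat) (I : finType) (f : 'rV[R]_d -> R)
  (X : 'I_n -> T -> 'rV[R]_d) (Z : (I * bool)%type -> T -> R) : Prop :=
  [/\ (forall j B, borel_rV B -> measurable (X j @^-1` B)),
      (forall ib, measurable_fun setT (Z ib)),
      (forall j B, borel_rV B ->
          P (X j @^-1` B) = cube_eint (fun y => ((\1_B y)%:E * (f y)%:E)%E)),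
      (forall ib (A : set R), measurable A -> P (Z ib @^-1` A) = normal_prob 0 1 A) &
      (forall (B : 'I_n -> set 'rV[R]_d) (A : (I * bool)%type -> set R),
          (forall j, borel_rV (B j)) -> (forall ib, measurable (A ib)) ->
          P ((\bigcap_j (X j @^-1` B j)) `&` (\bigcap_ib (Z ib @^-1` A ib)))%classic
          = ((\prod_j P (X j @^-1` B j)) * (\prod_ib P (Z ib @^-1` A ib)))%E)].

(* Main.v *)
(** Everything reduces to Fourier coefficients, where [fhat] at level [m] is the
    empirical coefficient sequence plus Gaussian noise, truncated to a cube of
    frequencies.

    Bias: Chernoff's pointwise convergence argument gives Parseval's equality for
    Lipschitz functions of one variable, and induction on the dimension gives it on
    the cube, so the bias of [f] is its tail of squared coefficients.  Integration by
    parts and Bessel's inequality for the pure derivatives of order [beta], which need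
    not be Lipschitz, bound the tail beyond [M] by [L^2 (2 pi (M + 1))^(- 2 beta)].

    Risk: a deterministic Goldenshluger--Lepski comparison bounds the selected
    risk by the risk of any fixed level plus the positive parts of the excesses of
    the stochastic terms over their penalties.  The empirical excess is controlled
    by the second moment of a degenerate U-statistic (Bessel's inequality makes it
    small), the noise excess by a Chernoff bound.  A dyadic level then balances
    bias and variance, and [C2] absorbs the excess term of order [log n / n].

    Privacy: changing one observation translates the Gaussian noise by some [delta]
    with [|delta|^2 <= rho].  By Cameron--Martin the shifted output law is the
    original one weighted by [exp (<delta, Z> - |delta|^2 / 2)], whose moment of
    order [alpha] is [exp ((alpha^2 - alpha) |delta|^2 / 2)]; this moment bound
    passes to the Radon--Nikodym derivative of the output laws. *)

Require Import Defs.
From HB Require Import structures.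
From mathcomp Require Import all_boot all_order all_algebra.
From mathcomp Require Import complex.
From mathcomp Require Import all_classical all_reals all_analysis.
From mathcomp Require Import measurable_realfun.
From mathcomp Require Import zify ring lra.
Set Implicit Arguments.
Unset Strict Implicit.
Unset Printing Implicit Defensive.
Import Order.TTheory GRing.Theory Num.Theory.
Import numFieldTopology.Exports numFieldNormedType.Exports.
Local Open Scope classical_set_scope.
Local Open Scope ring_scope.

(** * Integration over the cube *)

(** Two demands shape the estimates. [C1] must not depend on [d]: each frequency outside the cube is
    charged to a single coordinate in which it is large, so only pure derivatives enter the bias,
    and the factor 4 lost by rounding to a dyadic level is absorbed by [2 * pi >= 4]. The sampling
    excess must be of order [1 / n] at every level, although the number of coefficients grows: by
    Bessel's inequality the covariance matrix of the coefficients has squared Hilbert--Schmidt norm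
    at most [sup f] times its trace, and this makes a second moment enough, with no exponential
    inequality for the sampling error. The model brings the other obstacles. Integrals over the cube
    are iterated, so they are first turned into expectations under a Borel probability [Lam]. The
    density is controlled on the cube only, so functions are clamped to bounded ones on the whole
    space. Independence is a product rule on events, so it is carried over to functions one index at
    a time, without a joint law on a product space. *)

Definition bRV (R : realType) (d : nat) :=
  g_sigma_algebraType [set U : set 'rV[R]_d | open U].

Section borel_vectors.
Context (R : realType).

Lemma open_measurable_bRV d (U : set 'rV[R]_d) : open U ->
  measurable (U : set (bRV R d)).
Proof. by move=> oU; apply: sub_sigma_algebra. Qed.

Lemma continuous_measurable_bRV d (h : 'rV[R]_d -> R) :
  continuous h -> measurable_fun [set: bRV R d] (h : bRV R d -> R).
Proof.
move=> ch; apply: (measurability _ (RGenOInfty.measurableE R)) => _ [_ [r ->] <-].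
rewrite setTI; apply: open_measurable_bRV.
by apply: open_comp => [x _|]; [exact: ch|exact: interval_open].
Qed.

Lemma coord_measurable_bRV d (i : 'I_d) :
  measurable_fun [set: bRV R d] (fun x : bRV R d => (x : 'rV[R]_d) ord0 i).
Proof. by apply: continuous_measurable_bRV => x; exact: coord_continuous. Qed.

(** Cubes with rational centre and radius form a countable base of the sup-norm topology, so the
    preimage of an open set is a countable union of finite intersections of coordinate
    conditions. *)
Lemma measurable_bRV dT (T : measurableType dT) d (F : T -> bRV R d) :
  (forall i, measurable_fun [set: T] (fun t => (F t : 'rV[R]_d) ord0 i)) ->
  measurable_fun [set: T] F.
Proof.
move=> mF; apply: (@measurability _ _ _ (bRV R d) _ _ [set U : set 'rV[R]_d | open U] erefl).
move=> _ [U oU <-]; rewrite setTI.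
have -> : F @^-1` U = \bigcup_(p in [set p : 'rV[rat]_d * rat |
    (forall x : 'rV[R]_d, (forall i, `|x ord0 i - ratr (p.1 ord0 i)| < ratr p.2) -> U x)])
    [set t | forall i, `|(F t : 'rV[R]_d) ord0 i - ratr (p.1 ord0 i)| < ratr p.2].
  apply/seteqP; split => [t Ut|t [[q r] /= qrU]]; last by move=> /qrU.
  have := open_nbhs_nbhs (conj oU Ut : open_nbhs (F t) U).
  rewrite -nbhs_ballE => -[e /= e0 eU].
  (* Half of [e], because a point within [r] of the rational centre lies within [2 r] of [F t]. *)
  have [r /andP[r0 re]] : exists r : rat, (0 < (ratr r : R) < e / 2).
    have : (0 : R) < e / 2 by rewrite divr_gt0.
    by move=> /rat_in_itvoo[r]; rewrite in_itv/= => ?; exists r.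
  have /choice[q qP] : forall i, exists q : rat,
      `|(F t : 'rV[R]_d) ord0 i - ratr q| < ratr r.
    move=> i; have : (F t : 'rV[R]_d) ord0 i - ratr r < (F t : 'rV[R]_d) ord0 i + ratr r.
      by rewrite ltrD2l (lt_trans _ r0)// oppr_lt0.
    move=> /rat_in_itvoo[q]; rewrite in_itv/= => /andP[q1 q2]; exists q.
    by rewrite ltr_norml; apply/andP; split; lra.
  exists (\row_i q i, r) => /=; last by move=> i; rewrite mxE.
  move=> x xq; apply: eU; split=> // i j; rewrite ord1.
  have := xq j; rewrite mxE => xj; have tj := qP j; rewrite /ball/=.
  rewrite (_ : (F t : 'rV[R]_d) ord0 j - x ord0 j = ((F t : 'rV[R]_d) ord0 j - ratr (q j))
    - (x ord0 j - ratr (q j))); last by ring.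
  by rewrite (le_lt_trans (ler_normB _ _))//; lra.
rewrite bigcup_mkcond; apply: countable_bigcupT_measurable => [|p].
  exact: countableP.
case: ifP => // _.
have -> : [set t | forall i, `|(F t : 'rV[R]_d) ord0 i - ratr (p.1 ord0 i)| < ratr p.2] =
   \bigcap_(i in [set: 'I_d]) ((fun t => `|(F t : 'rV[R]_d) ord0 i - ratr (p.1 ord0 i)|) @^-1` `]-oo, (ratr p.2)[).
  by apply/seteqP; split => [t tP i _ /=|t tP i]; rewrite ?in_itv/=//; have := tP i I; rewrite /= in_itv.
apply: fin_bigcap_measurable => // i _.
rewrite -[X in measurable X]setTI.
have mi : measurable_fun [set: T] (fun t => `|(F t : 'rV[R]_d) ord0 i - ratr (p.1 ord0 i)|).
  apply: measurableT_comp => //; exact: measurable_funB.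
exact: mi.
Qed.

End borel_vectors.

Section change_of_density.
Context dS dT (S : measurableType dS) (T : measurableType dT) (R : realType).
Variables (mu : {measure set S -> \bar R}) (P : {measure set T -> \bar R}).
Variables (Y : T -> S) (V : T -> R).
Hypotheses (mY : measurable_fun [set: T] Y) (mV : measurable_fun [set: T] V).
Hypothesis V0 : forall t, 0 <= V t.
Hypothesis muE : forall A, measurable A ->
  mu A = (\int[P]_t ((\1_A (Y t))%:E * (V t)%:E))%E.

Import HBNNSimple.

(** Passes from indicators to simple functions and then to the limit by monotone convergence. It
    serves for the Gaussian density, the law of the observations and the privacy loss alike. *)
Lemma integral_change_of_density (h : S -> \bar R) :
  measurable_fun [set: S] h -> (forall s, 0 <= h s)%E ->
  (\int[mu]_s h s = \int[P]_t (h (Y t) * (V t)%:E))%E.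
Proof.
move=> mh h0; pose h_ := nnsfun_approx measurableT mh.
have m1 A : measurable A -> measurable_fun [set: T] (fun t => (\1_A (Y t))%:E * (V t)%:E)%E.
  move=> mA; apply: emeasurable_funM; last exact/measurable_EFinP.
  apply/measurable_EFinP; apply: (measurableT_comp (f := (\1_A : S -> R))) => //.
transitivity (limn (fun n => \int[mu]_x (h_ n x)%:E))%E.
  rewrite -monotone_convergence//=.
  - apply: eq_integral => y _; apply/esym/cvg_lim => //.
    exact: cvg_nnsfun_approx.
  - by move=> n; exact/measurable_EFinP/measurable_funP.
  - by move=> n y _; rewrite lee_fin.
  - by move=> y _ m n mn; rewrite lee_fin; exact/lefP/nd_nnsfun_approx.
transitivity (limn (fun n => \int[P]_t ((h_ n (Y t))%:E * (V t)%:E)))%E; last first.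
  rewrite -monotone_convergence//=.
  - apply: eq_integral => t _; apply/cvg_lim => //.
    by apply: cvgeZr => //; exact: cvg_nnsfun_approx.
  - move=> n; apply: emeasurable_funM; last exact/measurable_EFinP.
    by apply/measurable_EFinP; apply: measurableT_comp.
  - by move=> n y _; rewrite mule_ge0// lee_fin.
  - move=> y _ m n mn; rewrite lee_wpmul2r ?lee_fin//.
    exact/lefP/nd_nnsfun_approx.
apply: congr_lim; apply/funext => n.
rewrite integralT_nnsfun sintegralE.
under [RHS]eq_integral => t _.
  rewrite fimfunE -fsumEFin// ge0_mule_fsuml; last first.
    by move=> r; rewrite EFinM nnfun_muleindic_ge0.
  over.
rewrite ge0_integral_fsum//; last 2 first.
- move=> r; apply: emeasurable_funM; last exact/measurable_EFinP.
  apply/measurable_EFinP; apply: measurable_funM => //.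
  by apply: (measurableT_comp (f := (\1_(h_ n @^-1` [set r]) : S -> R))).
- move=> r t _; apply: mule_ge0; last by rewrite lee_fin.
  by rewrite EFinM nnfun_muleindic_ge0.
apply: eq_fsbigr => r; rewrite inE => -[s _ <-].
rewrite muE// -ge0_integralZl//=; last 3 first.
- exact: m1.
- by move=> t _; rewrite mule_ge0 ?lee_fin.
- by rewrite lee_fin.
by apply: eq_integral => t _; rewrite EFinM muleA.
Qed.

End change_of_density.

(** A class stable under sums, products and slices, on which every integral against a probability is
    finite; expectations can then be manipulated without integrability conditions at each step. *)
Definition bm (R : realType) d (T : measurableType d) (f : T -> R) :=
  measurable_fun [set: T] f /\ exists C : R, forall x, `|f x| <= C.

Section bounded_measurable.
Context (R : realType) d (T : measurableType d).
Implicit Types f g : T -> R.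

Lemma bm_cst (c : R) : bm (fun _ : T => c).
Proof. by split; [exact: measurable_cst|exists `|c|]. Qed.

Lemma bmD f g : bm f -> bm g -> bm (fun x => f x + g x).
Proof.
move=> [mf [a fa]] [mg [b gb]]; split; first exact: measurable_funD.
by exists (a + b) => x; rewrite (le_trans (ler_normD _ _))// lerD.
Qed.

Lemma bmM f g : bm f -> bm g -> bm (fun x => f x * g x).
Proof.
move=> [mf [a fa]] [mg [b gb]]; split; first exact: measurable_funM.
by exists (a * b) => x; rewrite normrM ler_pM.
Qed.

Lemma bmN f : bm f -> bm (fun x => - f x).
Proof.
move=> [mf [a fa]]; split; first exact: measurable_funN.
by exists a => x; rewrite normrN.
Qed.

Lemma bmB f g : bm f -> bm g -> bm (fun x => f x - g x).
Proof. by move=> bf bg; apply: bmD => //; exact: bmN. Qed.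

Lemma bmZ c f : bm f -> bm (fun x => c * f x).
Proof. by move=> bf; apply: bmM => //; exact: bm_cst. Qed.

Lemma bmX f n : bm f -> bm (fun x => f x ^+ n).
Proof.
move=> bf; elim: n => [|n ih]; first by under eq_fun do rewrite expr0; exact: bm_cst.
by under eq_fun do rewrite exprS; exact: bmM.
Qed.

Lemma bm_sum I (r : seq I) (p : pred I) (F : I -> T -> R) :
  (forall i, p i -> bm (F i)) -> bm (fun x => \sum_(i <- r | p i) F i x).
Proof.
move=> bF; elim: r => [|i r ih].
  by under eq_fun do rewrite big_nil; exact: bm_cst.
under eq_fun do rewrite big_cons.
by case: (boolP (p i)) => pi //; apply: bmD => //; exact: bF.
Qed.

Lemma bm_comp d' (T' : measurableType d') (Y : T' -> T) f :
  measurable_fun [set: T'] Y -> bm f -> bm (f \o Y).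
Proof.
by move=> mY [mf [C fC]]; split; [exact: measurableT_comp|exists C => x /=].
Qed.

Lemma bm_max f g : bm f -> bm g -> bm (fun x => Num.max (f x) (g x)).
Proof.
move=> [mf [a fa]] [mg [b gb]]; split; first exact: measurable_maxr.
exists (a + b) => x; have := fa x; have := gb x.
have := normr_ge0 (f x); have := normr_ge0 (g x).
by rewrite /Num.max; case: ifP => _; lra.
Qed.

End bounded_measurable.

Section bm_expectation.
Context (R : realType) d (T : measurableType d) (P : probability T R).
Implicit Types f g : T -> R.

Lemma bm_integrable f : bm f -> P.-integrable [set: T] (EFin \o f).
Proof.
move=> [mf [C fC]].
apply: (@le_integrable _ _ _ P _ measurableT (EFin \o f) (cst C%:E)).
- exact/measurable_EFinP.
- move=> x _ /=; rewrite lee_fin; exact: le_trans (fC x) (ler_norm _).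
- exact: finite_measure_integrable_cst.
Qed.

Lemma EFin_Rint f : bm f -> (\int[P]_x (f x)%:E = (\int[P]_x f x)%R%:E)%E.
Proof. by move=> bf; rewrite fineK// integrable_fin_num//; exact: bm_integrable. Qed.

Lemma RintD f g : bm f -> bm g ->
  \int[P]_x (f x + g x) = \int[P]_x f x + \int[P]_x g x.
Proof. by move=> bf bg; rewrite RintegralD//; exact: bm_integrable. Qed.

Lemma RintB f g : bm f -> bm g ->
  \int[P]_x (f x - g x) = \int[P]_x f x - \int[P]_x g x.
Proof. by move=> bf bg; rewrite RintegralB//; exact: bm_integrable. Qed.

Lemma RintZ c f : bm f -> \int[P]_x (c * f x) = c * \int[P]_x f x.
Proof. by move=> bf; rewrite RintegralZl//; exact: bm_integrable. Qed.

Lemma Rint_cst (c : R) : \int[P]_(_ in setT) c = c.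
Proof. by rewrite Rintegral_cst// [X in fine X](probability_setT P)/= mulr1. Qed.

Lemma Rint_sum I (r : seq I) (p : pred I) (F : I -> T -> R) :
  (forall i, p i -> bm (F i)) ->
  \int[P]_x (\sum_(i <- r | p i) F i x) = \sum_(i <- r | p i) \int[P]_x F i x.
Proof.
move=> bF; elim: r => [|i r ih].
  by under eq_Rintegral do rewrite big_nil; rewrite Rint_cst big_nil.
under eq_Rintegral do rewrite big_cons.
rewrite big_cons; case: (boolP (p i)) => pi //.
by rewrite RintD ?ih//; [exact: bF|exact: bm_sum].
Qed.

Lemma le_Rint f g : bm f -> bm g -> (forall x, f x <= g x) ->
  \int[P]_x f x <= \int[P]_x g x.
Proof. by move=> bf bg fg; apply: le_Rintegral => //; exact: bm_integrable. Qed.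

Lemma Rint_ge0 f : (forall x, 0 <= f x) -> 0 <= \int[P]_x f x.
Proof. by move=> f0; exact: Rintegral_ge0. Qed.

End bm_expectation.

Section bm_fubini.
Context (R : realType) d1 d2 (T1 : measurableType d1) (T2 : measurableType d2).
Variables (P1 : probability T1 R) (P2 : probability T2 R).
Variable f : T1 * T2 -> R.
Hypothesis bf : bm f.

Let P12 : probability (T1 * T2)%type R := (P1 \x P2)%E.

Lemma bm_slice1 x : bm (fun y => f (x, y)).
Proof. by case: bf => mf [C fC]; split; [exact: measurableT_comp|exists C]. Qed.

Lemma bm_slice2 y : bm (fun x => f (x, y)).
Proof. by case: bf => mf [C fC]; split; [exact: measurableT_comp|exists C]. Qed.

Lemma Rint_bound d (T : measurableType d) (P : probability T R) (g : T -> R) C :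
  bm g -> (forall x, `|g x| <= C) -> `|\int[P]_x g x| <= C.
Proof.
move=> bg gC; rewrite ler_norml -{1}(Rint_cst P (- C)) -{2}(Rint_cst P C).
by apply/andP; split; (apply: le_Rint => //; try exact: bm_cst) => x;
  have := gC x; rewrite ler_norml => /andP[].
Qed.

Lemma bm_Rint2 : bm (fun x => \int[P2]_y f (x, y)).
Proof.
case: (bf) => mf [C fC]; split; last first.
  by exists C => x; apply: Rint_bound => //; exact: bm_slice1.
apply/measurable_EFinP; rewrite [X in measurable_fun _ X](_ : _ = fubini_F P2 (EFin \o f)).
  apply: (measurable_fubini_F (m1 := P1)); exact: (@bm_integrable _ _ _ P12).
by apply/funext => x /=; rewrite /fubini_F EFin_Rint//; exact: bm_slice1.
Qed.

Lemma bm_Rint1 : bm (fun y => \int[P1]_x f (x, y)).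
Proof.
case: (bf) => mf [C fC]; split; last first.
  by exists C => y; apply: Rint_bound => //; exact: bm_slice2.
apply/measurable_EFinP; rewrite [X in measurable_fun _ X](_ : _ = fubini_G P1 (EFin \o f)).
  apply: (measurable_fubini_G (m2 := P2)); exact: (@bm_integrable _ _ _ P12).
by apply/funext => x /=; rewrite /fubini_G EFin_Rint//; exact: bm_slice2.
Qed.

Lemma Rint_prod12 :
  \int[(P1 \x P2)%E]_z f z = \int[P1]_x \int[P2]_y f (x, y).
Proof.
rewrite {1}/Rintegral -(integral12_prod_meas1 (@bm_integrable _ _ _ P12 _ bf)).
rewrite /Rintegral; congr fine; apply: eq_integral => x _.
by rewrite /fubini_F -EFin_Rint//; exact: bm_slice1.
Qed.

Lemma Rint_prod21 :
  \int[(P1 \x P2)%E]_z f z = \int[P2]_y \int[P1]_x f (x, y).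
Proof.
rewrite {1}/Rintegral -(integral21_prod_meas1 (@bm_integrable _ _ _ P12 _ bf)).
rewrite /Rintegral; congr fine; apply: eq_integral => x _.
by rewrite /fubini_G -EFin_Rint//; exact: bm_slice2.
Qed.

End bm_fubini.

Definition Unif (R : realType) : probability (measurableTypeR R) R :=
  @uniform_prob R 0 1 (@ltr01 R).

Lemma integral_Unif (R : realType) (f : measurableTypeR R -> \bar R) :
  measurable_fun [set: measurableTypeR R] f -> (forall x, 0 <= f x)%E ->
  (\int[Unif R]_x f x = \int[lebesgue_measure]_(x in `[0%R, 1%R]) f x)%E.
Proof. by move=> mf f0; rewrite integral_uniform// subr0 invr1 mul1e. Qed.

Lemma Rint_Unif (R : realType) (f : measurableTypeR R -> R) : bm f ->
  \int[Unif R]_x f x = \int[lebesgue_measure]_(x in `[0, 1]) f x.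
Proof.
move=> [mf _]; have mf' : measurable_fun [set: measurableTypeR R] (EFin \o f) by exact/measurable_EFinP.
rewrite /Rintegral; congr fine; rewrite integralE [RHS]integralE.
by congr (_ - _)%E; apply: integral_Unif => //;
  [exact: measurable_funepos|exact: measurable_funeneg].
Qed.

Section cube_measure.
Context (R : realType).

Definition vcons m (p : measurableTypeR R * bRV R m) : bRV R m.+1 :=
  row_mx (\row_(j < 1) p.1) (p.2 : 'rV[R]_m) : 'rV[R]_(1 + m).

Lemma vcons0 m (p : measurableTypeR R * bRV R m) : (vcons p : 'rV[R]_m.+1) ord0 ord0 = p.1.
Proof.
rewrite /vcons (_ : ord0 = lshift m (ord0 : 'I_1) :> 'I_(1 + m)); last exact/val_inj.
by rewrite (row_mxEl (\row_(j < 1) p.1)) mxE.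
Qed.

Lemma vconsS m (p : measurableTypeR R * bRV R m) (i : 'I_m) :
  (vcons p : 'rV[R]_m.+1) ord0 (lift ord0 i) = (p.2 : 'rV[R]_m) ord0 i.
Proof.
rewrite /vcons (_ : lift ord0 i = rshift 1 i :> 'I_(1 + m)); last exact/val_inj.
by rewrite (row_mxEr (\row_(j < 1) p.1)).
Qed.

Lemma measurable_vcons m : measurable_fun [set: measurableTypeR R * bRV R m] (@vcons m).
Proof.
apply: measurable_bRV => i; case: (unliftP ord0 i) => [j ->|->].
  rewrite [X in measurable_fun _ X](_ : _ = fun t => (t.2 : 'rV[R]_m) ord0 j); last first.
    by apply/funext => t; exact: vconsS.
  apply: (measurableT_comp (f := fun v : bRV R m => (v : 'rV[R]_m) ord0 j)) => //.
  exact: coord_measurable_bRV.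
by rewrite [X in measurable_fun _ X](_ : _ = fst)//; apply/funext => t; exact: vcons0.
Qed.

HB.instance Definition _ m :=
  isMeasurableFun.Build _ _ _ _ (@vcons m) (@measurable_vcons m).

(** A pushforward of a product measure: Fubini's theorem for products matches the recursion of
    [cube_int], while the carrier keeps the Borel structure in which the sample is measurable. *)
Fixpoint Lam d : probability (bRV R d) R :=
  match d with
  | 0 => \d_ ((0 : 'rV[R]_0) : bRV R 0)
  | m.+1 => distribution (Unif R \x Lam m)%E (@vcons m)
  end.

Lemma cube_eintE d (g : 'rV[R]_d -> \bar R) :
  measurable_fun [set: bRV R d] (g : bRV R d -> \bar R) -> (forall x, 0 <= g x)%E ->
  cube_eint g = (\int[Lam d]_x g x)%E.
Proof.
elim: d g => [|d ih] g mg g0 /=; first by rewrite integral_dirac// diracT mul1e.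
have mgg : measurable_fun [set: measurableTypeR R * bRV R d] ((g : bRV R d.+1 -> \bar R) \o @vcons d).
  by apply: measurableT_comp => //; exact: measurable_vcons.
rewrite ge0_integral_distribution// (fubini_tonelli1 (g \o @vcons d))//; last first.
  by move=> x; exact: g0.
rewrite integral_Unif//; last 2 first.
- by apply: measurable_fun_fubini_tonelli_F => // x; exact: g0.
- by move=> x; apply: integral_ge0 => y _; exact: g0.
apply: eq_integral => t _; rewrite ih//.
exact: (measurableT_comp mgg (pair1_measurable t)).
Qed.

Lemma unit_cube_row_mx m (t : R) (v : 'rV[R]_m) : 0 <= t <= 1 -> unit_cube v ->
  unit_cube (row_mx (\row_(j < 1) t) v : 'rV[R]_(m.+1)).
Proof.
move=> t01 v01 i; case: (unliftP ord0 i) => [j ->|->].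
  by rewrite (vconsS (t, v)); exact: v01.
by rewrite (vcons0 (t, v)).
Qed.

(** Lets a function whose behaviour off the cube is arbitrary be exchanged for a bounded measurable
    extension. *)
Lemma eq_cube_int d (f g : 'rV[R]_d -> R) :
  (forall x, unit_cube x -> f x = g x) -> cube_int f = cube_int g.
Proof.
elim: d f g => [|d ih] f g fg /=; first by apply: fg => -[].
apply: eq_Rintegral => t /[!inE]/=; rewrite in_itv/= => t01.
by apply: ih => v v01; apply: fg; exact: unit_cube_row_mx.
Qed.

Lemma Rint_Lam_vcons d (g : bRV R d.+1 -> R) : bm g ->
  \int[Lam d.+1]_x g x = \int[(Unif R \x Lam d)%E]_z g (vcons z).
Proof.
move=> bg; rewrite /Rintegral; congr fine; apply: integral_distribution.
  by apply/measurable_EFinP; case: bg.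
apply: (@bm_integrable _ _ _ (Unif R \x Lam d)%E (g \o @vcons d)).
by apply: bm_comp => //; exact: measurable_vcons.
Qed.

Lemma bm_vcons d (g : bRV R d.+1 -> R) : bm g -> bm (g \o @vcons d).
Proof. by move=> bg; apply: bm_comp => //; exact: measurable_vcons. Qed.

Lemma Rint_LamS d (g : bRV R d.+1 -> R) : bm g ->
  \int[Lam d.+1]_x g x = \int[Unif R]_t \int[Lam d]_v g (vcons (t, v)).
Proof.
by move=> bg; rewrite Rint_Lam_vcons// (Rint_prod12 (Unif R) (Lam d) (bm_vcons bg)).
Qed.

Lemma Rint_LamS' d (g : bRV R d.+1 -> R) : bm g ->
  \int[Lam d.+1]_x g x = \int[Lam d]_v \int[Unif R]_t g (vcons (t, v)).
Proof.
by move=> bg; rewrite Rint_Lam_vcons// (Rint_prod21 (Unif R) (Lam d) (bm_vcons bg)).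
Qed.

Lemma cube_intE d (g : 'rV[R]_d -> R) : bm (g : bRV R d -> R) ->
  cube_int g = \int[Lam d]_x g x.
Proof.
elim: d g => [|d ih] g bg.
  by rewrite /Rintegral integral_dirac//; [rewrite diracT mul1e|case: bg => mg _; exact/measurable_EFinP].
rewrite Rint_LamS// Rint_Unif; last exact: (bm_Rint2 (Unif R) (Lam d) (bm_vcons bg)).
by apply: eq_Rintegral => t _; rewrite -ih//; exact: (bm_slice1 (bm_vcons bg)).
Qed.

Lemma Rint_Lam0 (g : bRV R 0 -> R) : bm g -> \int[Lam 0]_x g x = g (0 : 'rV[R]_0).
Proof. by move=> bg; rewrite -cube_intE. Qed.

End cube_measure.

(** * Independence and moments *)

Section independence.
Context (R : realType) dT (T : measurableType dT) (P : probability T R).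

Definition law dS (S : measurableType dS) (Y : T -> S)
    (mY : measurable_fun [set: T] Y) : probability S R :=
  distribution P (HB.pack_for {mfun T >-> S} Y (isMeasurableFun.Build _ _ _ _ Y mY)).

Lemma lawE dS (S : measurableType dS) (Y : T -> S)
  (mY : measurable_fun [set: T] Y) A : law mY A = P (Y @^-1` A).
Proof. by []. Qed.

Lemma ge0_integral_law dS (S : measurableType dS) (Y : T -> S)
    (mY : measurable_fun [set: T] Y) (h : S -> \bar R) :
  measurable_fun [set: S] h -> (forall s, 0 <= h s)%E ->
  (\int[law mY]_s h s = \int[P]_t h (Y t))%E.
Proof. by move=> mh h0; rewrite ge0_integral_distribution. Qed.

Lemma Rint_law dS (S : measurableType dS) (Y : T -> S)
    (mY : measurable_fun [set: T] Y) (h : S -> R) :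
  bm h -> \int[law mY]_s h s = \int[P]_t h (Y t).
Proof.
move=> bh; rewrite /Rintegral; congr fine; apply: integral_distribution.
  by apply/measurable_EFinP; case: bh.
by apply: bm_integrable; apply: (bm_comp mY).
Qed.

(** Adding the bound [C] makes [h] nonnegative, where the previous formula applies; the constant
    cancels because both sides are additive. *)
Lemma Rint_change_of_density dS (S : measurableType dS) (mu : probability S R)
    (Y : T -> S) (V : T -> R) :
  measurable_fun [set: T] Y -> bm V -> (forall t, 0 <= V t) ->
  (forall A, measurable A -> mu A = (\int[P]_t ((\1_A (Y t))%:E * (V t)%:E))%E) ->
  forall h, bm h -> \int[mu]_s h s = \int[P]_t (h (Y t) * V t).
Proof.
move=> mY bV V0 muE h bh; have mV := bV.1.
have ge0E (k : S -> R) : bm k -> (forall s, 0 <= k s) ->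
    \int[mu]_s k s = \int[P]_t (k (Y t) * V t).
  move=> bk k0; rewrite /Rintegral; congr fine.
  rewrite (integral_change_of_density mY mV V0 muE)//.
  by apply/measurable_EFinP; case: bk.
case: (bh) => mh [C hC].
have C0 : 0 <= C by apply: le_trans (hC point).
have bhC : bm (fun s => h s + C) by apply: bmD => //; exact: bm_cst.
have hC0 s : 0 <= h s + C by have := hC s; rewrite ler_norml => /andP[]; lra.
have := ge0E _ bhC hC0; rewrite RintD//; last exact: bm_cst.
under [in RHS]eq_Rintegral do rewrite mulrDl.
rewrite RintD//; last 2 first.
- by apply: bmM => //; exact: (bm_comp mY).
- exact: bmZ.
by rewrite -(ge0E (fun=> C))//; [move/addIr|exact: bm_cst].
Qed.

Lemma bm_indic dS (S : measurableType dS) (A : set S) :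
  measurable A -> bm (\1_A : S -> R).
Proof.
move=> mA; split; first exact: measurable_indic.
by exists 1 => x; rewrite indicE; case: (x \in A); rewrite ?normr1 ?normr0.
Qed.

(** Factorisation against indicators of [Y] says that reweighting by the positive normalised [V']
    leaves the law of [Y] unchanged. Integrating [h] under that law and undoing the affine
    normalisation gives the product. *)
Lemma indep_step dS (S : measurableType dS) (Y : T -> S) (V : T -> R) :
  measurable_fun [set: T] Y -> bm V ->
  (forall B, measurable B -> \int[P]_t (\1_B (Y t) * V t) =
     \int[P]_t \1_B (Y t) * \int[P]_t V t) ->
  forall h, bm h -> \int[P]_t (h (Y t) * V t) = \int[P]_t h (Y t) * \int[P]_t V t.
Proof.
move=> mY bV VE h bh; case: (bV) => mV [C VC].
have C0 : 0 <= C by apply: le_trans (VC point).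
(* Since [V] and its mean are at least [- C], the shift by [C + 1] makes both [V + c] and [v + c]
   positive. *)
set v := \int[P]_t V t; pose c := C + 1.
have vC : `|v| <= C by apply: Rint_bound.
have vc : 0 < v + c by move: vC; rewrite ler_norml /c => /andP[]; lra.
have bVc : bm (fun t => V t + c) by apply: bmD => //; exact: bm_cst.
have bhY (k : S -> R) : bm k -> bm (fun t => k (Y t)) by exact: bm_comp.
pose V' t := (v + c)^-1 * (V t + c).
have bV' : bm V' by apply: bmZ.
have V'0 t : 0 <= V' t.
  rewrite mulr_ge0 ?invr_ge0 ?(ltW vc)//.
  by have := VC t; rewrite ler_norml /c => /andP[]; lra.
have lawV' B : measurable B ->
    law mY B = (\int[P]_t ((\1_B (Y t))%:E * (V' t)%:E))%E.
  move=> mB; under eq_integral do rewrite -EFinM.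
  have b1 := bhY _ (bm_indic mB).
  rewrite EFin_Rint; last exact: bmM.
  under eq_Rintegral do rewrite /V' mulrCA mulrDr (mulrC _ c).
  rewrite RintZ; last by apply: bmD; [exact: bmM|exact: bmZ].
  rewrite RintD ?VE//; [|exact: bmM|exact: bmZ].
  rewrite RintZ// -/v (mulrC c) -mulrDr mulrCA mulVf ?gt_eqF// mulr1.
  rewrite -EFin_Rint// lawE integral_indic//= ?setIT//.
  by rewrite -[X in measurable X]setTI; exact: mY.
have := Rint_change_of_density mY bV' V'0 lawV' bh; rewrite Rint_law//.
under [RHS]eq_Rintegral do rewrite /V' mulrCA mulrDr (mulrC _ c).
have bh' := bhY _ bh.
rewrite RintZ; last by apply: bmD; [exact: bmM|exact: bmZ].
rewrite RintD//; [|exact: bmM|exact: bmZ].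
rewrite RintZ// => hE.
have : (v + c) * \int[P]_t h (Y t) = \int[P]_x (h (Y x) * V x) + c * \int[P]_x h (Y x).
  by rewrite {1}hE mulVKf ?gt_eqF.
by rewrite mulrDl => /eqP; rewrite (inj_eq (addIr _)) mulrC => /eqP.
Qed.

Definition indep_family dS (S : measurableType dS) (I : finType) (Y : I -> T -> S) :=
  forall A : I -> set S, (forall i, measurable (A i)) ->
  P (\bigcap_i (Y i @^-1` A i)) = (\prod_i P (Y i @^-1` A i))%E.

(** Indicators are replaced by the functions [h i] one index at a time: [F s A] uses [h] on the
    indices in [s] and indicators elsewhere. The case of empty [s] is the product rule on events,
    and each replacement is one use of [indep_step]. *)
Lemma indep_prod dS (S : measurableType dS) (I : finType) (Y : I -> T -> S)
    (h : I -> S -> R) :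
  (forall i, measurable_fun [set: T] (Y i)) -> indep_family Y ->
  (forall i, bm (h i)) ->
  \int[P]_t (\prod_i h i (Y i t)) = \prod_i \int[P]_t h i (Y i t).
Proof.
move=> mY indY bh.
pose F (s : seq I) (A : I -> set S) i := if i \in s then h i else \1_(A i).
have bF s A i : (forall i, measurable (A i)) -> bm (F s A i).
  by move=> mA; rewrite /F; case: ifP => _ //; exact: bm_indic.
have bFY s A i : (forall i, measurable (A i)) -> bm (fun t => F s A i (Y i t)).
  by move=> mA; apply: (bm_comp (mY i)); exact: bF.
have bprod (r : seq I) (p : pred I) s A : (forall i, measurable (A i)) ->
    bm (fun t => \prod_(i <- r | p i) F s A i (Y i t)).
  move=> mA; elim: r => [|i r ih].
    by under eq_fun do rewrite big_nil; exact: bm_cst.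
  under eq_fun do rewrite big_cons.
  by case: (p i) => //; apply: bmM => //; exact: bFY.
have main (s : seq I) (A : I -> set S) : uniq s -> (forall i, measurable (A i)) ->
    \int[P]_t (\prod_i F s A i (Y i t)) = \prod_i \int[P]_t F s A i (Y i t).
  elim: s A => [|i0 s ih] A /=.
    move=> _ mA.
    have E1 i : \int[P]_t \1_(A i) (Y i t) = fine (P (Y i @^-1` A i)).
      rewrite /Rintegral integral_indic//= ?setIT//.
      by rewrite -[X in measurable X]setTI; exact: mY.
    under [RHS]eq_bigr do rewrite /F in_nil E1.
    apply: EFin_inj; rewrite -[RHS]prodEFin.
    have mYA i : measurable (Y i @^-1` A i).
      by rewrite -[X in measurable X]setTI; exact: mY.
    have finP i : (fine (P (Y i @^-1` A i)))%:E = P (Y i @^-1` A i).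
      by rewrite fineK// fin_num_measure.
    under [RHS]eq_bigr do rewrite finP.
    rewrite -indY// -[X in P X]setIT -integral_indic//; last first.
      by apply: fin_bigcap_measurable => // i _; exact: mYA.
    rewrite -EFin_Rint; last exact: bprod.
    apply: eq_integral => t _; congr EFin; rewrite indicE.
    have [tA|tA] := boolP (t \in _).
      rewrite big1// => i _; rewrite /F in_nil indicE mem_set//.
      by move: tA; rewrite inE => /(_ i Logic.I).
    have [i Ai] : exists i, ~ A i (Y i t).
      by apply/existsNP => tA'; move/negP: tA; apply; rewrite inE => i _; exact: tA'.
    by rewrite (bigD1 i)//= /F in_nil indicE memNset// mul0r.
  move=> /andP[i0s us] mA.
  pose V t := \prod_(i | i != i0) F (i0 :: s) A i (Y i t).
  pose A' B i := if i == i0 then B else A i.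
  have mA' B : measurable B -> forall i, measurable (A' B i).
    by move=> mB i; rewrite /A'; case: ifP.
  have FA' B i : i != i0 -> F s (A' B) i = F (i0 :: s) A i.
    by move=> ii0; rewrite /F /A' in_cons (negbTE ii0).
  have FA'0 B : F s (A' B) i0 = \1_B.
    by rewrite /F /A' (negbTE i0s) eqxx.
  have VB B : measurable B -> \int[P]_t (\1_B (Y i0 t) * V t) =
      \int[P]_t \1_B (Y i0 t) * \prod_(i | i != i0) \int[P]_t F (i0 :: s) A i (Y i t).
    move=> mB; have := ih _ us (mA' B mB).
    rewrite [in RHS](bigD1 i0)//= FA'0 => ihE.
    under [in RHS]eq_bigr => i ii0 do rewrite -(FA' B)//.
    rewrite -ihE; apply: eq_Rintegral => t _; rewrite [RHS](bigD1 i0)//= FA'0.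
    by congr (_ * _); apply: eq_bigr => i ii0; rewrite FA'.
  have bV : bm V by exact: bprod.
  (* The choice [B = setT] computes the mean of [V] and turns [VB] into the hypothesis of
     [indep_step]. *)
  have EV : \int[P]_t V t = \prod_(i | i != i0) \int[P]_t F (i0 :: s) A i (Y i t).
    have := VB setT measurableT; rewrite indicT.
    by under eq_Rintegral do rewrite mul1r; rewrite Rint_cst mul1r.
  rewrite [RHS](bigD1 i0)//= -EV.
  rewrite (_ : F (i0 :: s) A i0 = h i0); last by rewrite /F in_cons eqxx.
  rewrite -(indep_step (mY i0) bV); [|by move=> B mB; rewrite EV VB|exact: bh].
  apply: eq_Rintegral => t _; rewrite (bigD1 i0)//=.
  by rewrite {1}/F in_cons eqxx.
have := main (enum I) (fun=> setT) (enum_uniq _) (fun=> measurableT); rewrite /F.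
under eq_Rintegral do under eq_bigr do rewrite mem_enum.
by under [in X in _ = X -> _]eq_bigr do rewrite mem_enum.
Qed.

End independence.

Section independence_ge0.
Context (R : realType) dT (T : measurableType dT) (P : probability T R).

Lemma cvg_prod_seq I (r : seq I) (a : I -> nat -> R) (l : I -> R) :
  (forall i, a i n @[n --> \oo] --> l i) ->
  (\prod_(i <- r) a i n) @[n --> \oo] --> \prod_(i <- r) l i.
Proof.
move=> al; elim: r => [|i r ih].
  by under eq_fun do rewrite big_nil; rewrite big_nil; exact: cvg_cst.
by under eq_fun do rewrite big_cons; rewrite big_cons; apply: cvgM.
Qed.

Lemma min_nd (x : R) : {homo (fun n : nat => Num.min x n%:R) : m n / (m <= n)%N >-> m <= n}.
Proof. by move=> m n mn; rewrite le_min !ge_min lexx/= ler_nat mn orbT. Qed.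

Lemma cvg_min_nat (x : R) : Num.min x n%:R @[n --> \oo] --> x.
Proof.
apply: cvg_near_cst; near=> n; apply/min_idPl; apply: ltW; near: n.
exact: nbhs_infty_gtr.
Unshelve. all: by end_near. Qed.

(** Truncation at height [n] and monotone convergence remove boundedness, as needed for exponentials
    of Gaussian variables. *)
Lemma indep_prod_ge0 dS (S : measurableType dS) (I : finType) (Y : I -> T -> S)
    (h : I -> S -> R) (c : I -> R) :
  (forall i, measurable_fun [set: T] (Y i)) -> indep_family P Y ->
  (forall i, measurable_fun [set: S] (h i)) -> (forall i s, 0 <= h i s) ->
  (forall i, \int[P]_t (h i (Y i t))%:E = (c i)%:E)%E ->
  (\int[P]_t (\prod_i h i (Y i t))%:E = (\prod_i c i)%:E)%E.
Proof.
move=> mY indY mh h0 hc.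
pose g i n s := Num.min (h i s) n%:R.
have g0 i n s : 0 <= g i n s by rewrite /g le_min h0/=.
have bg i n : bm (g i n).
  split; first exact: measurable_minr.
  by exists n%:R => s; rewrite ger0_norm// /g ge_min lexx orbT.
have bgY i n : bm (fun t => g i n (Y i t)) by apply: (bm_comp (mY i)).
have bprod n (r : seq I) : bm (fun t => \prod_(i <- r) g i n (Y i t)).
  elim: r => [|i r ih]; first by under eq_fun do rewrite big_nil; exact: bm_cst.
  by under eq_fun do rewrite big_cons; exact: bmM.
have lhs : (\int[P]_t (\prod_i g i n (Y i t))%:E)%E @[n --> \oo] -->
    (\int[P]_t (\prod_i h i (Y i t))%:E)%E.
  have -> : (\int[P]_t (\prod_i h i (Y i t))%:E)%E =
      (\int[P]_t (limn (fun n => (\prod_i g i n (Y i t))%:E)))%E.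
    apply: eq_integral => t _; apply/esym/cvg_lim => //; apply: cvg_EFin.
      by near=> n.
    by apply: cvg_prod_seq => i; exact: cvg_min_nat.
  apply: cvg_monotone_convergence => //.
  - by move=> n; apply/measurable_EFinP; case: (bprod n (index_enum I)).
  - by move=> n t _; rewrite lee_fin prodr_ge0.
  - move=> t _ m n mn; rewrite lee_fin; apply: ler_prod => i _.
    by rewrite g0/=; exact: min_nd.
have cvg_c i : \int[P]_t g i n (Y i t) @[n --> \oo] --> c i.
  apply: fine_cvg; rewrite -hc.
  have -> : (\int[P]_t (h i (Y i t))%:E)%E =
      (\int[P]_t (limn (fun n => (g i n (Y i t))%:E)))%E.
    apply: eq_integral => t _; apply/esym/cvg_lim => //; apply: cvg_EFin.
      by near=> n.
    exact: cvg_min_nat.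
  apply: cvg_monotone_convergence => //.
  - by move=> n; apply/measurable_EFinP; case: (bgY i n).
  - by move=> n t _; rewrite lee_fin.
  - by move=> t _ m n mn; rewrite lee_fin; exact: min_nd.
have rhs : (\int[P]_t (\prod_i g i n (Y i t))%:E)%E @[n --> \oo] --> (\prod_i c i)%:E%E.
  under eq_fun do rewrite EFin_Rint// (indep_prod mY indY (fun i => bg i _)).
  apply: cvg_EFin; first by near=> n.
  exact: cvg_prod_seq.
by apply: (cvg_unique _ lhs rhs).
Unshelve. all: by end_near. Qed.

End independence_ge0.

(** * Gaussian integrals and translations *)

Section gaussian.
Context (R : realType).
Notation mu := (@lebesgue_measure R).

Lemma measurable_addr (c : R) :
  measurable_fun [set: measurableTypeR R] (fun x : measurableTypeR R => (x + c : measurableTypeR R)).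
Proof. exact: measurable_funD. Qed.

Lemma lebesgue_shift (c : R) (A : set (measurableTypeR R)) : measurable A ->
  mu ((fun x => x + c) @^-1` A) = mu A.
Proof.
move=> mA; apply/esym.
pose f := HB.pack_for {mfun (measurableTypeR R) >-> (measurableTypeR R)}
  (fun x : measurableTypeR R => (x + c : measurableTypeR R))
  (isMeasurableFun.Build _ _ _ _ _ (measurable_addr c)).
apply: (lebesgue_measure_unique (mu := pushforward mu f)) => //.
move=> _ [[a b] _ <-] /=; rewrite /pushforward.
rewrite (_ : f @^-1` _ = `]a - c, b - c]%classic); last first.
  by apply/seteqP; split => x /=; rewrite !in_itv/= ltrBlDr lerBrDr.
rewrite !lebesgue_measure_itv/= !lte_fin ltrD2r; case: ifP => // _.
by rewrite -!EFinB; congr EFin; ring.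
Qed.

Lemma ge0_integral_lebesgue_shift (c : R) (f : measurableTypeR R -> \bar R) :
  measurable_fun [set: measurableTypeR R] f -> (forall x, 0 <= f x)%E ->
  (\int[mu]_x f (x + c)%R = \int[mu]_x f x)%E.
Proof.
move=> mf f0.
rewrite -[LHS](ge0_integral_pushforward (measurable_addr c) mu measurableT mf)//.
apply: eq_measure_integral => [|mc A mA _]; first exact: measurable_addr.
exact: lebesgue_shift.
Qed.

Definition N01 : probability (measurableTypeR R) R := normal_prob 0 1.

Lemma ge0_integral_N01 (h : measurableTypeR R -> \bar R) :
  measurable_fun [set: measurableTypeR R] h -> (forall x, 0 <= h x)%E ->
  (\int[N01]_x h x = \int[mu]_x (h x * (normal_pdf 0 1 x)%:E))%E.
Proof.
move=> mh h0.
rewrite (@integral_change_of_density _ _ _ _ _ N01 mu idfun (normal_pdf 0 1))//.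
- exact: measurable_id.
- exact: measurable_normal_pdf.
- by move=> x; exact: normal_pdf_ge0.
move=> A mA; rewrite /N01 /= /normal_prob integral_mkcond.
apply: eq_integral => x _; rewrite patchE indicE.
by case: ifP => _; rewrite ?mul1e ?mul0e.
Qed.

Lemma normal_pdf_shift (d x : R) :
  normal_pdf 0 1 (x - d) = expR (d * x - d ^+ 2 / 2) * normal_pdf 0 1 x.
Proof.
rewrite normal_pdfE ?oner_neq0// /normal_fun mulrCA -expRD; congr (_ * expR _).
by field.
Qed.

(** The one-dimensional Cameron--Martin formula: translation invariance of Lebesgue measure, then
    completion of the square in the density. *)
Lemma ge0_integral_N01_shift (d : R) (h : measurableTypeR R -> \bar R) :
  measurable_fun [set: measurableTypeR R] h -> (forall x, 0 <= h x)%E ->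
  (\int[N01]_x h (x + d)%R =
   \int[N01]_x (h x * (expR (d * x - d ^+ 2 / 2))%:E))%E.
Proof.
move=> mh h0.
have me : measurable_fun [set: measurableTypeR R]
    (fun x => (expR (d * x - d ^+ 2 / 2))%:E).
  apply/measurable_EFinP; apply: measurableT_comp => //.
  by apply: measurable_funB => //; exact: measurable_funM.
rewrite !ge0_integral_N01//; last 3 first.
- by apply: emeasurable_funM.
- by move=> x; rewrite mule_ge0// lee_fin expR_ge0.
- apply: measurableT_comp => //; exact: measurable_addr.
rewrite -[RHS](ge0_integral_lebesgue_shift d); last 2 first.
- apply: emeasurable_funM; first exact: emeasurable_funM.
  by apply/measurable_EFinP; exact: measurable_normal_pdf.
- by move=> x; rewrite !mule_ge0// lee_fin ?expR_ge0 ?normal_pdf_ge0.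
apply: eq_integral => x _; rewrite -muleA -EFinM; congr (_ * _%:E)%E.
by rewrite -normal_pdf_shift addrK.
Qed.

(** The translation formula for the constant function 1 has total mass 1 on one side and, up to the
    factor [expR (- d^2 / 2)], the moment generating function on the other. *)
Lemma integral_N01_expR (d : R) :
  (\int[N01]_x (expR (d * x))%:E = (expR (d ^+ 2 / 2))%:E)%E.
Proof.
have lexx_01 : (0 <= 1 :> \bar R)%E by [].
have := @ge0_integral_N01_shift d (fun=> 1%E) (measurable_cst _) (fun _ : R => lexx_01).
rewrite integral_cst// mul1e [X in X = _](probability_setT N01).
under eq_integral do rewrite mul1e expRD mulrC EFinM.
rewrite ge0_integralZl//=; last first.
  by apply/measurable_EFinP; apply: measurableT_comp => //; exact: measurable_funM.
move=> /(congr1 (fun z => (expR (d ^+ 2 / 2))%:E * z)%E).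
by rewrite mule1 muleA -EFinM -expRD subrr expR0 mul1e => ->.
Qed.

(** The integrand times the standard density is [sqrt 2] times the density of the centred Gaussian
    of variance 2. *)
Lemma integral_N01_expR_sq :
  (\int[N01]_x (expR (x ^+ 2 / 4))%:E = (Num.sqrt 2)%:E)%E.
Proof.
rewrite ge0_integral_N01; last 2 first.
- apply/measurable_EFinP; apply: measurableT_comp => //.
  by apply: measurable_funM => //; exact: measurable_funX.
- by move=> x; rewrite lee_fin expR_ge0.
have s0 : Num.sqrt 2 != 0 :> R by rewrite gt_eqF// sqrtr_gt0.
under eq_integral => x _.
  rewrite -EFinM (_ : _ * _ = Num.sqrt 2 * normal_pdf 0 (Num.sqrt 2) x).
    rewrite EFinM; over.
  rewrite !normal_pdfE ?oner_neq0// /normal_peak /normal_fun sqr_sqrtr//.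
  rewrite mulrCA -expRD mulrA; congr (_ * expR _); last by field.
  rewrite (_ : 2 * pi *+ 2 = 2 * (1 ^+ 2 * pi *+ 2)); last by rewrite expr1n mul1r mulrnAr.
  by rewrite sqrtrM// invfM mulVKf.
rewrite ge0_integralZl//= ?integral_normal_pdf ?mule1//.
- by apply/measurable_EFinP; exact: measurable_normal_pdf.
- by move=> x _; rewrite lee_fin normal_pdf_ge0.
Qed.

End gaussian.

(** * Fourier analysis on the cube *)

Section trigonometry.
Context (R : realType).

Lemma cos_2pi_int (k : int) : cos (2 * pi * k%:~R) = 1 :> R.
Proof.
have cosn (n : nat) : cos (2 * pi * n%:R) = 1 :> R.
  rewrite (_ : 2 * pi * n%:R = 0 + (pi *+ 2) *+ n); last first.
    by rewrite add0r -[in RHS]mulr_natr -[in RHS](mulr_natl pi).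
  by rewrite (periodicn (@cosD2pi R)) cos0.
case: k => n; first exact: cosn.
by rewrite NegzE mulrNz mulrN cosN; exact: cosn.
Qed.

Lemma sin_2pi_int (k : int) : sin (2 * pi * k%:~R) = 0 :> R.
Proof.
have sinn (n : nat) : sin (2 * pi * n%:R) = 0 :> R.
  rewrite (_ : 2 * pi * n%:R = 0 + (pi *+ 2) *+ n); last first.
    by rewrite add0r -[in RHS]mulr_natr -[in RHS](mulr_natl pi).
  by rewrite (periodicn (@sinD2pi R)) sin0.
case: k => n; first exact: sinn.
by rewrite NegzE mulrNz mulrN sinN [sin _]sinn oppr0.
Qed.

Lemma bm_cos d (T : measurableType d) (f : T -> R) :
  measurable_fun [set: T] f -> bm (fun x => cos (f x)).
Proof.
move=> mf; split; last by exists 1 => x; exact: cos_max.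
by apply: measurableT_comp => //; apply: continuous_measurable_fun; exact: continuous_cos.
Qed.

Lemma bm_sin d (T : measurableType d) (f : T -> R) :
  measurable_fun [set: T] f -> bm (fun x => sin (f x)).
Proof.
move=> mf; split; last by exists 1 => x; exact: sin_max.
by apply: measurableT_comp => //; apply: continuous_measurable_fun; exact: continuous_sin.
Qed.

Lemma measurable_mulr (c : R) :
  measurable_fun [set: measurableTypeR R] (fun x : measurableTypeR R => c * x).
Proof. exact: measurable_funM. Qed.

(** The fundamental theorem of calculus on the segment. [G] is a bounded stand-in for [f], which may
    be unbounded on the line and matters only on [[0, 1]]. *)
Lemma Rint_Unif_derive (F f : R -> R) (G : measurableTypeR R -> R) :
  continuous f -> (forall x : R, is_derive x 1 F (f x)) ->
  bm G -> (forall x : R, 0 <= x <= 1 -> G x = f x) -> F 0 = F 1 ->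
  \int[Unif R]_t G t = 0.
Proof.
move=> cf dF bG Gf F01; rewrite Rint_Unif//.
have -> : \int[lebesgue_measure]_(x in `[0, 1]) G x = \int[lebesgue_measure]_(x in `[0, 1]) f x.
  by apply: eq_Rintegral => x; rewrite inE/= in_itv/= => /Gf.
have cF : continuous F.
  by move=> x; apply: differentiable_continuous; apply/derivable1_diffP; case: (dF x).
rewrite /Rintegral (@continuous_FTC2 R f F 0 1)//.
- by rewrite F01 subee.
- exact: continuous_subspaceT.
- split; first by move=> x _; case: (dF x).
    by apply: cvg_at_right_filter; exact: cF.
  by apply: cvg_at_left_filter; exact: cF.
- by move=> x _; rewrite derive1E; exact: derive_val.
Qed.

Lemma is_derive_sin_mul (c x : R) : is_derive x 1 (fun t => sin (c * t)) (c * cos (c * x)).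
Proof.
have h : is_derive x 1 (cst c * id : R -> R) c.
  by apply: is_derive_eq; rewrite scaler0 addr0 [LHS]mulr1.
have := @is_derive1_comp _ sin (cst c * id) x _ _ (is_derive_sin _) h.
by rewrite (mulrC _ c).
Qed.

Lemma is_derive_cos_mul (c x : R) : is_derive x 1 (fun t => cos (c * t)) (- (c * sin (c * x))).
Proof.
have h : is_derive x 1 (cst c * id : R -> R) c.
  by apply: is_derive_eq; rewrite scaler0 addr0 [LHS]mulr1.
have := @is_derive1_comp _ cos (cst c * id) x _ _ (is_derive_cos _) h.
by rewrite mulNr (mulrC _ c).
Qed.

Lemma continuous_cos_mul (c : R) : continuous (fun t : R => cos (c * t)).
Proof.
by move=> x; apply: differentiable_continuous; apply/derivable1_diffP; case: (is_derive_cos_mul c x).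
Qed.

Lemma continuous_sin_mul (c : R) : continuous (fun t : R => sin (c * t)).
Proof.
by move=> x; apply: differentiable_continuous; apply/derivable1_diffP; case: (is_derive_sin_mul c x).
Qed.

Lemma Rint_Unif_cos (k : int) :
  \int[Unif R]_t cos (2 * pi * k%:~R * t) = (k == 0)%:R.
Proof.
have [->|k0] := eqVneq k 0.
  by under eq_Rintegral do rewrite mulr0 mul0r cos0; rewrite Rint_cst.
have c0 : 2 * pi * k%:~R != 0 :> R.
  by apply: mulf_neq0; [rewrite gt_eqF// mulr_gt0// pi_gt0|rewrite intr_eq0].
have bc : bm (fun t : measurableTypeR R => cos (2 * pi * k%:~R * t)).
  by apply: bm_cos; exact: measurable_mulr.
apply: (mulfI c0); rewrite mulr0 -RintZ//.
apply: (@Rint_Unif_derive (fun t => sin (2 * pi * k%:~R * t))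
  (fun t => 2 * pi * k%:~R * cos (2 * pi * k%:~R * t))) => //.
- by move=> x; apply: cvgM; [exact: cvg_cst|exact: continuous_cos_mul].
- by move=> x; exact: is_derive_sin_mul.
- exact: bmZ.
- by rewrite mulr0 mulr1 sin_2pi_int sin0.
Qed.

Lemma Rint_Unif_sin (k : int) : \int[Unif R]_t sin (2 * pi * k%:~R * t) = 0.
Proof.
have [->|k0] := eqVneq k 0.
  by under eq_Rintegral do rewrite mulr0 mul0r sin0; rewrite Rint_cst.
have c0 : - (2 * pi * k%:~R) != 0 :> R.
  by rewrite oppr_eq0; apply: mulf_neq0; [rewrite gt_eqF// mulr_gt0// pi_gt0|rewrite intr_eq0].
have bc : bm (fun t : measurableTypeR R => sin (2 * pi * k%:~R * t)).
  by apply: bm_sin; exact: measurable_mulr.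
apply: (mulfI c0); rewrite mulr0 -RintZ//.
apply: (@Rint_Unif_derive (fun t => cos (2 * pi * k%:~R * t))
  (fun t => - (2 * pi * k%:~R) * sin (2 * pi * k%:~R * t))) => //.
- by move=> x; apply: cvgM; [exact: cvg_cst|exact: continuous_sin_mul].
- by move=> x; rewrite mulNr; exact: is_derive_cos_mul.
- exact: bmZ.
- by rewrite mulr0 mulr1 cos_2pi_int cos0.
Qed.

End trigonometry.

Section fourier_basis.
Context (R : realType).

Definition ck d (k : 'rV[int]_d) (x : 'rV[R]_d) := cos (2 * pi * dotk k x).
Definition sk d (k : 'rV[int]_d) (x : 'rV[R]_d) := sin (2 * pi * dotk k x).

Lemma measurable_dotk d (k : 'rV[int]_d) :
  measurable_fun [set: bRV R d] (fun x : bRV R d => 2 * pi * dotk k (x : 'rV[R]_d)).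
Proof.
apply: measurable_funM => //; apply: measurable_sum => i.
by apply: measurable_funM => //; exact: coord_measurable_bRV.
Qed.

Lemma bm_ck d (k : 'rV[int]_d) : bm (ck k : bRV R d -> R).
Proof. by apply: bm_cos; exact: measurable_dotk. Qed.

Lemma bm_sk d (k : 'rV[int]_d) : bm (sk k : bRV R d -> R).
Proof. by apply: bm_sin; exact: measurable_dotk. Qed.

Definition ktail d (k : 'rV[int]_d.+1) : 'rV[int]_d := \row_i k ord0 (lift ord0 i).

Lemma dotk_vcons d (k : 'rV[int]_d.+1) t (v : 'rV[R]_d) :
  dotk k (vcons (t, v)) = (k ord0 ord0)%:~R * t + dotk (ktail k) v.
Proof.
rewrite /dotk big_ord_recl vcons0; congr (_ + _).
by apply: eq_bigr => i _; rewrite vconsS mxE.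
Qed.

Lemma ck_vcons d (k : 'rV[int]_d.+1) t (v : 'rV[R]_d) : ck k (vcons (t, v)) =
  cos (2 * pi * (k ord0 ord0)%:~R * t) * ck (ktail k) v
  - sin (2 * pi * (k ord0 ord0)%:~R * t) * sk (ktail k) v.
Proof. by rewrite /ck dotk_vcons mulrDr mulrA cosD. Qed.

Lemma sk_vcons d (k : 'rV[int]_d.+1) t (v : 'rV[R]_d) : sk k (vcons (t, v)) =
  sin (2 * pi * (k ord0 ord0)%:~R * t) * ck (ktail k) v
  + cos (2 * pi * (k ord0 ord0)%:~R * t) * sk (ktail k) v.
Proof. by rewrite /sk dotk_vcons mulrDr mulrA sinD. Qed.

Lemma k0E d (k : 'rV[int]_d.+1) : (k == 0) = (k ord0 ord0 == 0) && (ktail k == 0).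
Proof.
apply/eqP/andP => [->|[/eqP k0 /eqP kt]].
  by rewrite mxE; split=> //; apply/eqP/rowP => i; rewrite !mxE.
apply/rowP => i; rewrite mxE; case: (unliftP ord0 i) => [j ->|->//].
by have /rowP/(_ j) := kt; rewrite !mxE.
Qed.

(** Cosine and sine are treated together because the addition formulas mix them when the first
    coordinate is split off. *)
Lemma Rint_ck_sk d (k : 'rV[int]_d) :
  \int[Lam R d]_x ck k x = (k == 0)%:R /\ \int[Lam R d]_x sk k x = 0.
Proof.
elim: d k => [|d ih] k.
  rewrite (Rint_Lam0 (bm_ck k)) (Rint_Lam0 (bm_sk k)) /ck /sk /dotk big_ord0 mulr0 cos0 sin0.
  by split=> //; rewrite (_ : k == 0)//; apply/eqP/rowP => -[].
have [cE sE] := ih (ktail k).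
have bct (v : bRV R d) : bm (fun t : measurableTypeR R => cos (2 * pi * (k ord0 ord0)%:~R * t)).
  by apply: bm_cos; exact: measurable_mulr.
have bst (v : bRV R d) : bm (fun t : measurableTypeR R => sin (2 * pi * (k ord0 ord0)%:~R * t)).
  by apply: bm_sin; exact: measurable_mulr.
split.
  rewrite (Rint_LamS (bm_ck k)).
  under eq_Rintegral => t _.
    under eq_Rintegral do rewrite ck_vcons.
    rewrite RintB; [|apply: bmZ; exact: bm_ck|apply: bmZ; exact: bm_sk].
    rewrite !RintZ; [|exact: bm_sk|exact: bm_ck]; rewrite cE sE mulr0 subr0 mulrC.
    over.
  rewrite RintZ; last exact: (bct point).
  by rewrite Rint_Unif_cos k0E mulrC -natrM mulnb.
rewrite (Rint_LamS (bm_sk k)).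
under eq_Rintegral => t _.
  under eq_Rintegral do rewrite sk_vcons.
  rewrite RintD; [|apply: bmZ; exact: bm_ck|apply: bmZ; exact: bm_sk].
  rewrite !RintZ; [|exact: bm_sk|exact: bm_ck]; rewrite cE sE mulr0 addr0 mulrC.
  over.
rewrite RintZ; last exact: (bst point).
by rewrite Rint_Unif_sin mulr0.
Qed.

Lemma dotkB d (k l : 'rV[int]_d) (x : 'rV[R]_d) : dotk (k - l) x = dotk k x - dotk l x.
Proof.
by rewrite /dotk -sumrB; apply: eq_bigr => i _; rewrite !mxE rmorphB/= mulrBl.
Qed.

End fourier_basis.

Section complex_expectation.
Context (R : realType) d (T : measurableType d) (P : probability T R).
Implicit Types (F G : T -> R[i]) (a : R[i]).

Definition cbm F := bm (fun x => complex.Re (F x)) /\ bm (fun x => complex.Im (F x)).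

Definition CE F : R[i] :=
  Complex (\int[P]_x complex.Re (F x)) (\int[P]_x complex.Im (F x)).

Lemma cReM (x y : R[i]) : complex.Re (x * y) =
  complex.Re x * complex.Re y - complex.Im x * complex.Im y.
Proof. by case: x y => [? ?] [? ?]. Qed.

Lemma cImM (x y : R[i]) : complex.Im (x * y) =
  complex.Re x * complex.Im y + complex.Im x * complex.Re y.
Proof. by case: x y => [? ?] [? ?]. Qed.

Lemma cReD (x y : R[i]) : complex.Re (x + y) = complex.Re x + complex.Re y.
Proof. by case: x y => [? ?] [? ?]. Qed.

Lemma cImD (x y : R[i]) : complex.Im (x + y) = complex.Im x + complex.Im y.
Proof. by case: x y => [? ?] [? ?]. Qed.

Lemma cReN (x : R[i]) : complex.Re (- x) = - complex.Re x.
Proof. by case: x. Qed.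

Lemma cImN (x : R[i]) : complex.Im (- x) = - complex.Im x.
Proof. by case: x. Qed.

Lemma cReJ (x : R[i]) : complex.Re (conjc x) = complex.Re x.
Proof. by case: x. Qed.

Lemma cImJ (x : R[i]) : complex.Im (conjc x) = - complex.Im x.
Proof. by case: x. Qed.

Lemma complex_ext (x y : R[i]) :
  complex.Re x = complex.Re y -> complex.Im x = complex.Im y -> x = y.
Proof. by case: x y => [? ?] [? ?] /= -> ->. Qed.

Lemma cRe_sum I (r : seq I) (p : pred I) (f : I -> R[i]) :
  complex.Re (\sum_(i <- r | p i) f i) = \sum_(i <- r | p i) complex.Re (f i).
Proof. by apply: (big_morph _ cReD). Qed.

Lemma cIm_sum I (r : seq I) (p : pred I) (f : I -> R[i]) :
  complex.Im (\sum_(i <- r | p i) f i) = \sum_(i <- r | p i) complex.Im (f i).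
Proof. by apply: (big_morph _ cImD). Qed.

Lemma cbm_cst a : cbm (fun=> a). Proof. by split; exact: bm_cst. Qed.

Lemma cbmM F G : cbm F -> cbm G -> cbm (fun x => F x * G x).
Proof.
move=> [f1 f2] [g1 g2]; split.
  by under eq_fun do rewrite cReM; apply: bmB; exact: bmM.
by under eq_fun do rewrite cImM; apply: bmD; exact: bmM.
Qed.

Lemma cbmD F G : cbm F -> cbm G -> cbm (fun x => F x + G x).
Proof.
move=> [f1 f2] [g1 g2]; split.
  by under eq_fun do rewrite cReD; exact: bmD.
by under eq_fun do rewrite cImD; exact: bmD.
Qed.

Lemma cbmN F : cbm F -> cbm (fun x => - F x).
Proof.
move=> [f1 f2]; split.
  by under eq_fun do rewrite cReN; exact: bmN.
by under eq_fun do rewrite cImN; exact: bmN.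
Qed.

Lemma cbmJ F : cbm F -> cbm (fun x => conjc (F x)).
Proof.
move=> [f1 f2]; split; first by under eq_fun do rewrite cReJ.
by under eq_fun do rewrite cImJ; exact: bmN.
Qed.

Lemma cbm_sum I (r : seq I) (p : pred I) (F : I -> T -> R[i]) :
  (forall i, cbm (F i)) -> cbm (fun x => \sum_(i <- r | p i) F i x).
Proof.
move=> bF; split.
  by under eq_fun do rewrite cRe_sum; apply: bm_sum => i _; case: (bF i).
by under eq_fun do rewrite cIm_sum; apply: bm_sum => i _; case: (bF i).
Qed.

Lemma bm_sqmod F : cbm F -> bm (fun x => sqmod (F x)).
Proof. by move=> [f1 f2]; apply: bmD; exact: bmX. Qed.

Lemma CE_cst a : CE (fun=> a) = a.
Proof. by apply: complex_ext; rewrite /= Rint_cst. Qed.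

Lemma CEZ a F : cbm F -> CE (fun x => a * F x) = a * CE F.
Proof.
move=> [f1 f2]; apply: complex_ext; rewrite /= ?cReM ?cImM /=.
  under eq_Rintegral do rewrite cReM.
  by rewrite RintB; [rewrite !RintZ|exact: bmZ|exact: bmZ].
under eq_Rintegral do rewrite cImM.
by rewrite RintD; [rewrite !RintZ|exact: bmZ|exact: bmZ].
Qed.

Lemma CE_sum I (r : seq I) (p : pred I) (F : I -> T -> R[i]) :
  (forall i, cbm (F i)) ->
  CE (fun x => \sum_(i <- r | p i) F i x) = \sum_(i <- r | p i) CE (F i).
Proof.
move=> bF; apply: complex_ext; rewrite /= ?cRe_sum ?cIm_sum /=.
  under eq_Rintegral do rewrite cRe_sum.
  by rewrite Rint_sum// => i _; case: (bF i).
under eq_Rintegral do rewrite cIm_sum.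
by rewrite Rint_sum// => i _; case: (bF i).
Qed.

Lemma sqmodE (z : R[i]) : sqmod z = complex.Re (z * conjc z).
Proof. by rewrite cReM cReJ cImJ mulrN opprK -!expr2. Qed.

Lemma sqmod_ge0 (z : R[i]) : 0 <= sqmod z.
Proof. by rewrite addr_ge0// sqr_ge0. Qed.

Lemma sqmodN (z : R[i]) : sqmod (- z) = sqmod z.
Proof. by rewrite /sqmod cReN cImN !sqrrN. Qed.

Lemma sqmodM (x y : R[i]) : sqmod (x * y) = sqmod x * sqmod y.
Proof. by rewrite /sqmod cReM cImM; ring. Qed.

Lemma sqmodD_le (x y : R[i]) : sqmod (x + y) <= 2 * sqmod x + 2 * sqmod y.
Proof.
rewrite /sqmod cReD cImD.
have := sqr_ge0 (complex.Re x - complex.Re y).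
by have := sqr_ge0 (complex.Im x - complex.Im y); nra.
Qed.

End complex_expectation.

Section fourier_sums.
Context (R : realType) (d : nat).
Notation Lam := (Lam R d).
Implicit Types (s : seq 'rV[int]_d) (a : 'rV[int]_d -> R[i]) (F : bRV R d -> R[i]).

Lemma cbm_phi (k : 'rV[int]_d) : cbm (phi k : bRV R d -> R[i]).
Proof. by split; [exact: bm_ck|exact: bm_sk]. Qed.

Lemma CE_phiJ (k l : 'rV[int]_d) :
  CE Lam (fun x => phi k x * conjc (phi l x)) = (k == l)%:R.
Proof.
have [cE sE] := Rint_ck_sk R (k - l); apply: complex_ext => /=.
  under eq_Rintegral do rewrite mulrN opprK -cosB -mulrBr -dotkB.
  by rewrite [LHS]cE subr_eq0; case: (k == l).
under eq_Rintegral do rewrite mulrN addrC -sinB -mulrBr -dotkB.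
by rewrite [LHS]sE; case: (k == l).
Qed.

Definition coef F (k : 'rV[int]_d) := CE Lam (fun x => F x * conjc (phi k x)).

Definition TP s a : bRV R d -> R[i] := fun x => \sum_(k <- s) a k * phi k x.

Lemma cbm_TP s a : cbm (TP s a).
Proof. by apply: cbm_sum => k; apply: cbmM; [exact: cbm_cst|exact: cbm_phi]. Qed.

Lemma coef_TP s a k : uniq s -> coef (TP s a) k = if k \in s then a k else 0.
Proof.
move=> us; rewrite /coef /TP.
have b1 l : cbm (fun x : bRV R d => phi l x * conjc (phi k x)).
  by apply: cbmM; [exact: cbm_phi|apply: cbmJ; exact: cbm_phi].
under [X in CE _ X]eq_fun do rewrite mulr_suml.
under [X in CE _ X]eq_fun do under eq_bigr do rewrite -mulrA.
rewrite CE_sum; last by move=> l; apply: cbmM => //; exact: cbm_cst.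
under eq_bigr do rewrite (CEZ _ _ (b1 _)) CE_phiJ.
case: ifPn => ks.
  rewrite (bigD1_seq k)//= eqxx mulr1 big1 ?addr0// => l /negbTE lk.
  by rewrite lk mulr0.
rewrite big_seq big1// => l ls; case: eqP => [lk|]; last by rewrite mulr0.
by move: ks; rewrite -lk ls.
Qed.

(** The coefficients [a] are arbitrary: [a = coef F] gives Bessel's inequality, [F = 0] gives the
    norm of a trigonometric polynomial, and noisy coefficients give the bias-variance split of the
    risk. *)
Lemma L2_pythagoras s a F : cbm F -> uniq s ->
  \int[Lam]_x sqmod (F x - TP s a x) =
  \int[Lam]_x sqmod (F x) - \sum_(k <- s) sqmod (coef F k)
  + \sum_(k <- s) sqmod (coef F k - a k).
Proof.
move=> bF us.
have bT := cbm_TP s a.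
have bFT : cbm (fun x => F x * conjc (TP s a x)) by apply: cbmM => //; exact: cbmJ.
have bTT : cbm (fun x => TP s a x * conjc (TP s a x)) by apply: cbmM => //; exact: cbmJ.
have inner (G : bRV R d -> R[i]) : cbm G ->
    CE Lam (fun x => G x * conjc (TP s a x)) = \sum_(k <- s) conjc (a k) * coef G k.
  move=> bG.
  have E x : G x * conjc (TP s a x) = \sum_(k <- s) conjc (a k) * (G x * conjc (phi k x)).
    rewrite /TP rmorph_sum mulr_sumr; apply: eq_bigr => k _.
    by rewrite rmorphM mulrCA.
  under [X in CE _ X]eq_fun do rewrite E.
  have b1 l : cbm (fun x : bRV R d => G x * conjc (phi l x)).
    by apply: cbmM => //; apply: cbmJ; exact: cbm_phi.
  rewrite CE_sum; last by move=> l; apply: cbmM => //; exact: cbm_cst.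
  by apply: eq_bigr => l _; rewrite CEZ.
have -> : \int[Lam]_x sqmod (F x - TP s a x) = \int[Lam]_x sqmod (F x)
   - 2 * complex.Re (CE Lam (fun x => F x * conjc (TP s a x)))
   + complex.Re (CE Lam (fun x => TP s a x * conjc (TP s a x))).
  rewrite /= -RintZ; last by case: bFT.
  rewrite -RintB; [|exact: bm_sqmod|by apply: bmZ; case: bFT].
  rewrite -RintD; [|apply: bmB; [exact: bm_sqmod|by apply: bmZ; case: bFT]|by case: bTT].
  apply: eq_Rintegral => x _; rewrite -sqmodE /sqmod !cReM !cReJ !cImJ cReD cImD cReN cImN.
  by ring.
rewrite !inner// -addrA -[RHS]addrA; congr (_ + _).
rewrite !cRe_sum mulr_sumr -!sumrN -!big_split/= big_seq [RHS]big_seq.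
apply: eq_bigr => k ks; rewrite coef_TP// ks.
by rewrite /sqmod !cReM !cReJ !cImJ cReD cImD cReN cImN; ring.
Qed.

Lemma bessel s F : cbm F -> uniq s ->
  \sum_(k <- s) sqmod (coef F k) <= \int[Lam]_x sqmod (F x).
Proof.
move=> bF us; have := L2_pythagoras (coef F) bF us.
under [X in _ + X]eq_bigr do rewrite subrr /sqmod /= expr0n addr0.
rewrite big1_eq addr0 -subr_ge0 => <-.
by apply: Rint_ge0 => x; exact: sqmod_ge0.
Qed.

Lemma L2_TP s a : uniq s -> \int[Lam]_x sqmod (TP s a x) = \sum_(k <- s) sqmod (a k).
Proof.
move=> us; have := @L2_pythagoras s a (fun=> 0) (cbm_cst _ 0) us.
under eq_Rintegral do rewrite sub0r sqmodN.
move=> ->.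
have c0 k : coef (fun=> 0) k = 0.
  by rewrite /coef; under [X in CE _ X]eq_fun do rewrite mul0r; rewrite CE_cst.
rewrite (_ : \int[Lam]_x sqmod (0 : R[i]) = 0); last first.
  by rewrite /sqmod /= expr0n addr0 Rint_cst.
under eq_bigr do rewrite c0 /sqmod /= expr0n addr0.
rewrite big1_eq subr0 add0r; apply: eq_bigr => k _.
by rewrite c0 sub0r sqmodN.
Qed.

Lemma coef_real (h : bRV R d -> R) (k : 'rV[int]_d) : bm h ->
  coef (fun x => (h x)%:C%C) k =
  Complex (\int[Lam]_x (h x * ck k x)) (- \int[Lam]_x (h x * sk k x)).
Proof.
move=> bh; apply: complex_ext => /=.
  by apply: eq_Rintegral => x _; rewrite mul0r subr0.
rewrite -mulN1r -RintZ; last by apply: bmM => //; exact: bm_sk.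
by apply: eq_Rintegral => x _; rewrite mul0r addr0 mulN1r mulrN.
Qed.

Lemma cbm_real (h : bRV R d -> R) : bm h -> cbm (fun x => (h x)%:C%C).
Proof. by move=> bh; split => //; exact: bm_cst. Qed.

Lemma L2sqE F : cbm F -> L2sq (F : 'rV[R]_d -> R[i]) = \int[Lam]_x sqmod (F x).
Proof. by move=> bF; rewrite /L2sq cube_intE//; exact: bm_sqmod. Qed.

Lemma L2innerE F k : cbm F -> L2inner (F : 'rV[R]_d -> R[i]) (phi k) = coef F k.
Proof.
move=> bF; have [b1 b2] : cbm (fun x => F x * conjc (phi k x)).
  by apply: cbmM => //; apply: cbmJ; exact: cbm_phi.
by rewrite /L2inner /cube_intC !cube_intE.
Qed.

End fourier_sums.

Section frequencies.
Context (M d : nat).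

(** The index types of [kval] change with [M]; a duplicate-free list of integer vectors allows cubes
    of different sizes to be nested and their sums compared. *)
Definition KS : seq 'rV[int]_d := [seq kval k | k : 'rV['I_(2 * M + 1)]_d].

Lemma kval_inj : injective (@kval M d).
Proof.
move=> k l /rowP kl; apply/rowP => i; apply/val_inj; have := kl i.
by rewrite !mxE => /addIr [].
Qed.

Lemma KS_uniq : uniq KS.
Proof. by rewrite map_inj_uniq ?enum_uniq//; exact: kval_inj. Qed.

Lemma big_KS (V : nmodType) (F : 'rV[int]_d -> V) :
  \sum_(k <- KS) F k = \sum_(k : 'rV['I_(2 * M + 1)]_d) F (kval k).
Proof. by rewrite big_map big_enum. Qed.

Lemma mem_KS (k : 'rV[int]_d) : (k \in KS) = [forall i, (`|k ord0 i|%N <= M)%N].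
Proof.
apply/mapP/forallP => [[l _ ->] i|kM].
  by rewrite mxE; case: (l ord0 i) => a /= aM; lia.
have lt i : (absz (k ord0 i + M%:Z)%R < 2 * M + 1)%N by have := kM i; lia.
exists (\row_i Ordinal (lt i)); first by rewrite mem_enum.
apply/rowP => i; rewrite !mxE /= -[k 0 i]/(k ord0 i).
by have := kM i; lia.
Qed.

End frequencies.

Lemma KS_sub (M N d : nat) : (M <= N)%N -> {subset KS M d <= KS N d}.
Proof.
move=> MN k; rewrite !mem_KS => /forallP kM; apply/forallP => i.
exact: leq_trans (kM i) MN.
Qed.

(** * Pointwise convergence and Parseval's equality in one variable *)

Section dirichlet_kernel.
Context (R : realType).

Fixpoint zs (N : nat) : seq int :=
  if N is n.+1 then n.+1%:Z :: - n.+1%:Z :: zs n else [:: 0].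

Lemma mem_zs N (k : int) : (k \in zs N) = (absz k <= N)%N.
Proof.
elim: N => [|N ih]; first by rewrite /= inE; lia.
by rewrite /= !inE ih; lia.
Qed.

Lemma zs_uniq N : uniq (zs N).
Proof. by elim: N => // N ih; rewrite /= !inE !mem_zs ih; lia. Qed.

Lemma zs_opp N : perm_eq [seq - k | k <- zs N] (zs N).
Proof.
apply: uniq_perm; [|exact: zs_uniq|].
  by rewrite map_inj_uniq ?zs_uniq//; exact: oppr_inj.
move=> k; apply/mapP/idP => [[l]|]; first by rewrite !mem_zs => + ->; lia.
by move=> kN; exists (- k); rewrite ?opprK// mem_zs; move: kN; rewrite mem_zs; lia.
Qed.

Definition DK (N : nat) (u : R) := \sum_(k <- zs N) cos (2 * pi * k%:~R * u).

(** The closed form [sin ((2 N + 1) pi u) / sin (pi u)] of the Dirichlet kernel, with the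
    denominator cleared so that integers [u] are included. *)
Lemma sin_DK N (u : R) : sin (pi * u) * DK N u = sin (pi * u + 2 * pi * N%:~R * u).
Proof.
elim: N => [|N ih]; first by rewrite /DK big_seq1 !(mulr0, mul0r) cos0 mulr1 addr0.
set w := 2 * pi * N.+1%:~R * u; set q := pi * u in ih *.
have -> : DK N.+1 u = 2 * cos w + DK N u.
  rewrite /DK /= !big_cons mulrNz mulrN mulNr cosN addrA.
  by rewrite -/w; ring.
rewrite [LHS]mulrDr ih.
have -> : q + 2 * pi * N%:~R * u = w - q.
  have e : N.+1%:~R = N%:~R + 1 :> R by rewrite -addn1 PoszD intrD.
  by rewrite /w /q e; ring.
by rewrite sinB (sinD q w); ring.
Qed.

Lemma sin_ge_mul_cos (z : R) : 0 <= z <= pi -> z * cos z <= sin z.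
Proof.
move=> /andP[z0 zpi].
have dF (x : R) : is_derive x 1 (fun t => sin t - t * cos t) (x * sin x).
  apply: is_derive_eq; rewrite /GRing.scale /=; ring.
have cF : {within `[0, z], continuous (fun t => sin t - t * cos t)}.
  by apply: derivable_within_continuous => x _; case: (dF x).
have [c] := MVT_segment z0 (fun x _ => dF x) cF.
rewrite in_itv/= => /andP[c0 cz].
rewrite sin0 mul0r !subr0 -subr_ge0 => ->.
by rewrite !mulr_ge0// sin_ge0_pi// c0 (le_trans cz).
Qed.

(** With [z = pi u / 2], the double-angle formula and [z cos z <= sin z] give
    [sin (2 z) >= 2 z (cos z)^2]. The bound [b < 1] keeps [cos z] away from 0, since [sin (pi u)]
    vanishes again at [u = 1]. *)
Lemma sin_pi_lower (b : R) : 0 <= b < 1 ->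
  exists2 c, 0 < c & forall u, `|u| <= b -> c * `|u| <= `|sin (pi * u)|.
Proof.
move=> /andP[b0 b1]; have p0 := pi_gt0 R.
have pb : 0 <= pi / 2 * b < pi / 2.
  by rewrite mulr_ge0 ?divr_ge0 ?(ltW p0)//= gtr_pMr// divr_gt0.
have cb : 0 < cos (pi / 2 * b).
  by apply: cos_gt0_pihalf; case/andP: pb => ? ->; rewrite andbT; lra.
exists (pi * cos (pi / 2 * b) ^+ 2); first by rewrite mulr_gt0// exprn_gt0.
have main u : 0 <= u <= b -> pi * cos (pi / 2 * b) ^+ 2 * u <= sin (pi * u).
  move=> /andP[u0 ub].
  set z := pi / 2 * u.
  have z0 : 0 <= z by rewrite mulr_ge0// divr_ge0// ltW.
  have zb : z <= pi / 2 * b by rewrite ler_wpM2l// divr_ge0// ltW.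
  have cz : cos (pi / 2 * b) <= cos z.
    rewrite leNgt ltr_cos -?leNgt// in_itv/=; move/andP: pb => [? ?]; lra.
  have -> : pi * u = z *+ 2 by rewrite /z; field.
  rewrite sin_mulr2n.
  have zc : z * cos z <= sin z by apply: sin_ge_mul_cos; move/andP: pb => [? ?]; lra.
  have -> : pi * cos (pi / 2 * b) ^+ 2 * u = (z * cos (pi / 2 * b) * cos (pi / 2 * b)) *+ 2.
    by rewrite /z; field.
  rewrite lerMn2r/= mulrC; apply: ler_pM => //; [exact: ltW|exact: mulr_ge0 z0 (ltW cb)|].
  by apply: le_trans zc; rewrite ler_wpM2l.
move=> u ub; have [u0|u0] := leP 0 u.
  have := main u; rewrite ger0_norm// in ub *; rewrite u0 ub => /(_ isT) h.
  exact: le_trans h (ler_norm _).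
have := main (- u); rewrite ltr0_norm// in ub *; rewrite oppr_ge0 ltW// ub => /(_ isT) h.
by rewrite (le_trans h)// mulrN sinN -normrN ler_norm.
Qed.

Lemma measurable_inv : measurable_fun [set: measurableTypeR R] (fun x : R => x^-1).
Proof.
have -> : (fun x : R => x^-1) = (fun x => x * (`|x| `^ (-1)) ^+ 2).
  apply/funext => x; rewrite powR_inv1// exprVn real_normK ?num_real//.
  have [->|x0] := eqVneq x 0; first by rewrite invr0 mul0r.
  by rewrite expr2 invfM mulVKf.
apply: measurable_funM => //; apply: measurable_funX.
by apply: (measurableT_comp (f := fun x : R => x `^ (-1))) => //; exact: measurable_powR.
Qed.

End dirichlet_kernel.

Section one_dimensional_series.
Context (R : realType).
Notation U := (Unif R).
Implicit Types G : measurableTypeR R -> R.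

Definition AF G (k : int) := \int[U]_t (G t * cos (2 * pi * k%:~R * t)).
Definition BF G (k : int) := \int[U]_t (G t * sin (2 * pi * k%:~R * t)).

Lemma bm_cosk (k : int) : bm (fun t : measurableTypeR R => cos (2 * pi * k%:~R * t) : R).
Proof. by apply: bm_cos; exact: measurable_mulr. Qed.

Lemma bm_sink (k : int) : bm (fun t : measurableTypeR R => sin (2 * pi * k%:~R * t) : R).
Proof. by apply: bm_sin; exact: measurable_mulr. Qed.

Lemma AFN G k : AF G (- k) = AF G k.
Proof.
by apply: eq_Rintegral => t _; rewrite mulrNz mulrN mulNr cosN.
Qed.

Lemma BFN G k : bm G -> BF G (- k) = - BF G k.
Proof.
move=> bG; rewrite /BF -[RHS]mulN1r -RintZ; last by apply: bmM => //; exact: bm_sink.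
by apply: eq_Rintegral => t _; rewrite mulrNz mulrN mulNr sinN mulN1r mulrN.
Qed.

(** Moves a function of one real variable to the cube of dimension 1, where Bessel's inequality is
    already proved. *)
Definition lift1 G : bRV R 1 -> R := fun x => G ((x : 'rV[R]_1) ord0 ord0).

Lemma bm_lift1 G : bm G -> bm (lift1 G).
Proof.
move=> bG; apply: (bm_comp (Y := fun x : bRV R 1 => (x : 'rV[R]_1) ord0 ord0 : measurableTypeR R)) => //.
exact: coord_measurable_bRV.
Qed.

Lemma Rint_lift1 G : bm G -> \int[Lam R 1]_x lift1 G x = \int[U]_t G t.
Proof.
move=> bG; rewrite Rint_LamS; last exact: bm_lift1.
apply: eq_Rintegral => t _; rewrite /lift1.
by under eq_Rintegral do rewrite vcons0 /=; rewrite Rint_cst.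
Qed.

Lemma dotk1 (k : int) (x : 'rV[R]_1) :
  dotk (const_mx k) x = k%:~R * x ord0 ord0.
Proof. by rewrite /dotk big_ord1 mxE. Qed.

Lemma coef_lift1 G k : bm G ->
  coef (fun x => (lift1 G x)%:C%C) (const_mx k) = Complex (AF G k) (- BF G k).
Proof.
move=> bG; rewrite coef_real; last exact: bm_lift1.
congr (Complex _ (- _)).
  rewrite /AF -Rint_lift1; last by apply: bmM => //; exact: bm_cosk.
  by apply: eq_Rintegral => x _; rewrite /ck dotk1 mulrA.
rewrite /BF -Rint_lift1; last by apply: bmM => //; exact: bm_sink.
by apply: eq_Rintegral => x _; rewrite /sk dotk1 mulrA.
Qed.

Lemma const_mx_uniq (s : seq int) : uniq s -> uniq [seq const_mx k : 'rV[int]_1 | k <- s].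
Proof.
by move=> us; rewrite map_inj_uniq// => a b /rowP/(_ ord0); rewrite !mxE.
Qed.

Lemma bessel1 G (s : seq int) : bm G -> uniq s ->
  \sum_(k <- s) (AF G k ^+ 2 + BF G k ^+ 2) <= \int[U]_t (G t ^+ 2).
Proof.
move=> bG us.
have := bessel (cbm_real (bm_lift1 bG)) (const_mx_uniq us).
rewrite big_map.
under eq_bigr do rewrite coef_lift1// /sqmod/= sqrrN.
move=> /le_trans; apply; rewrite -Rint_lift1; last exact: bmX.
rewrite le_eqVlt; apply/orP; left; apply/eqP.
by apply: eq_Rintegral => x _; rewrite /sqmod /= expr0n/= addr0.
Qed.

(** The Riemann--Lebesgue lemma for bounded functions: the squares are terms of a nonnegative series
    whose partial sums Bessel's inequality bounds. *)
Lemma AF_BF_cvg0 G : bm G ->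
  AF G n%:Z @[n --> \oo] --> 0 /\ BF G n%:Z @[n --> \oo] --> 0.
Proof.
move=> bG; pose u n := AF G n%:Z ^+ 2 + BF G n%:Z ^+ 2.
have u0 n : 0 <= u n by rewrite addr_ge0// sqr_ge0.
have cu : u @ \oo --> 0.
  apply: cvg_series_cvg_0; apply: nondecreasing_is_cvgn.
    by apply/nondecreasing_seqP => n; rewrite /series/= big_nat_recr//= lerDl.
  exists (\int[U]_t (G t ^+ 2)) => _ [n _ <-]; rewrite /series /=.
  have := @bessel1 G [seq i%:Z | i <- index_iota 0 n] bG.
  rewrite map_inj_uniq ?iota_uniq; last by move=> ? ? [].
  by rewrite big_map => /(_ isT).
have cs : Num.sqrt (u n) @[n --> \oo] --> 0.
  rewrite -[X in _ --> X]sqrtr0.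
  exact: (cvg_comp _ _ cu (@sqrt_continuous R 0)).
have cNs : - Num.sqrt (u n) @[n --> \oo] --> 0.
  by rewrite -[X in _ --> X]oppr0; exact: cvgN.
split.
  apply: (squeeze_cvgr _ cNs cs); near=> n.
  by rewrite -ler_norml -sqrtr_sqr ler_wsqrtr// /u lerDl sqr_ge0.
apply: (squeeze_cvgr _ cNs cs); near=> n.
by rewrite -ler_norml -sqrtr_sqr ler_wsqrtr// /u lerDr sqr_ge0.
Unshelve. all: by end_near. Qed.

Lemma eq_Rint_Unif F G : bm F -> bm G -> (forall t : R, 0 <= t <= 1 -> F t = G t) ->
  \int[U]_t F t = \int[U]_t G t.
Proof.
move=> bF bG FG; rewrite !Rint_Unif//; apply: eq_Rintegral => t.
by rewrite inE/= in_itv/= => /FG.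
Qed.

Definition SF G N x := \sum_(k <- zs N)
  (AF G k * cos (2 * pi * k%:~R * x) + BF G k * sin (2 * pi * k%:~R * x)).

Lemma bm_DK N x : bm (fun t : measurableTypeR R => DK N (t - x)).
Proof.
apply: bm_sum => k _; apply: bm_cos; apply: measurable_funM => //.
exact: measurable_funB.
Qed.

Lemma SFE G N x : bm G -> SF G N x = \int[U]_t (G t * DK N (t - x)).
Proof.
move=> bG; rewrite /SF /DK.
under [RHS]eq_Rintegral do rewrite mulr_sumr.
rewrite Rint_sum; last first.
  move=> k _; apply: bmM => //; apply: bm_cos; apply: measurable_funM => //.
  exact: measurable_funB.
apply: eq_bigr => k _; rewrite /AF /BF mulrC [X in _ + X]mulrC -!RintZ; first last.
- by apply: bmM => //; exact: bm_cosk.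
- by apply: bmM => //; exact: bm_sink.
rewrite -RintD; first last.
- by apply: bmZ; apply: bmM => //; exact: bm_sink.
- by apply: bmZ; apply: bmM => //; exact: bm_cosk.
by apply: eq_Rintegral => t _; rewrite mulrBr cosB; ring.
Qed.

Lemma SF_cst1 N x : \int[U]_t DK N (t - x) = 1.
Proof.
have := @SFE (fun=> 1) N x (bm_cst _ 1); under eq_Rintegral do rewrite mul1r.
move=> <-; rewrite /SF.
have A1 k : AF (fun=> 1) k = (k == 0)%:R.
  by rewrite /AF; under eq_Rintegral do rewrite mul1r; exact: Rint_Unif_cos.
have B1 k : BF (fun=> 1) k = 0.
  by rewrite /BF; under eq_Rintegral do rewrite mul1r; exact: Rint_Unif_sin.
under eq_bigr do rewrite A1 B1 mul0r addr0.
rewrite (bigD1_seq 0) ?zs_uniq ?mem_zs//= mulr0 mul0r cos0 mul1r big1 ?addr0//.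
by move=> k /negbTE ->; rewrite mul0r.
Qed.

(* Chernoff's argument: [h t = (G t - G x) / sin (pi (t - x))] is bounded, and
   [SF G N x - G x] is a combination of the N-th Fourier coefficients of
   [h * cos (pi t)] and [h * sin (pi t)], which vanish by Bessel's inequality *)
Lemma SF_cvg G (C x : R) : bm G -> (forall t t' : R, `|G t - G t'| <= C * `|t - t'|) ->
  0 < x < 1 -> SF G N x @[N --> \oo] --> G x.
Proof.
move=> bG GC /andP[x0 x1].
have C0 : 0 <= C.
  have := GC 1 0; rewrite subr0 normr1 mulr1; exact: le_trans (normr_ge0 _).
(* The largest distance from [x] to a point of [[0, 1]]; it is below 1 because [x] is interior. The
   indicator in [h] discards the other zeros of the sine. *)
pose b := Num.max x (1 - x).
have b01 : 0 <= b < 1 by rewrite /b le_max gt_max (ltW x0)/= x1 /=; lra.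
have [c c0 cP] := sin_pi_lower b01.
pose h t := \1_(`[0, 1]%classic : set R) t * ((G t - G x) * (sin (pi * (t - x)))^-1).
have msin : measurable_fun [set: measurableTypeR R] (fun t => sin (pi * (t - x)) : R).
  by have [] := @bm_sin R _ (measurableTypeR R) (fun t => pi * (t - x))
    (measurable_funM (measurable_cst _) (measurable_funB (@measurable_id _ _ _) (measurable_cst _))).
have bh : bm (h : measurableTypeR R -> R).
  split.
    apply: measurable_funM; first exact: measurable_indic.
    apply: measurable_funM; first by case: (bmB bG (bm_cst _ (G x))).
    exact: (measurableT_comp (@measurable_inv R) msin).
  exists (C / c) => t; rewrite /h indicE; have [|] := boolP (t \in _).
    rewrite inE/= in_itv/= => /andP[t0 t1]; rewrite mul1r.
    have tb : `|t - x| <= b.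
      by rewrite /b le_max !ler_norml; have [?|?] := leP x t; apply/orP; [right|left]; apply/andP; split; lra.
    have [tx|tx] := eqVneq (t - x) 0.
      by rewrite tx mulr0 sin0 invr0 mulr0 normr0 divr_ge0// ltW.
    rewrite normrM normrV ?unitfE; last first.
      rewrite -normr_gt0 (lt_le_trans _ (cP _ tb))// mulr_gt0// normr_gt0//.
    rewrite ler_pdivrMr; last by rewrite (lt_le_trans _ (cP _ tb))// mulr_gt0// normr_gt0.
    rewrite (le_trans (GC t x))// (_ : C * `|t - x| = C / c * (c * `|t - x|)); last first.
      by rewrite mulrA divfK// gt_eqF.
    by rewrite ler_wpM2l ?cP// divr_ge0// ltW.
  by rewrite mul0r normr0 divr_ge0// ltW.
have mpi : measurable_fun [set: measurableTypeR R] (fun t : measurableTypeR R => pi * t).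
  exact: measurable_mulr.
pose hc t := h t * cos (pi * t); pose hs t := h t * sin (pi * t).
have bhc : bm (hc : measurableTypeR R -> R) by apply: bmM => //; exact: bm_cos.
have bhs : bm (hs : measurableTypeR R -> R) by apply: bmM => //; exact: bm_sin.
have key N : SF G N x - G x =
    cos (pi * x + 2 * pi * N%:~R * x) * (BF hc N + AF hs N)
  + sin (pi * x + 2 * pi * N%:~R * x) * (BF hs N - AF hc N).
  set e := pi * x + 2 * pi * N%:~R * x.
  have -> : SF G N x - G x = \int[U]_t ((G t - G x) * DK N (t - x)).
    rewrite SFE// -[X in _ - X = _]mulr1 -(SF_cst1 N x) -RintZ; last exact: bm_DK.
    rewrite -RintB; last 2 first.
    - by apply: bmM => //; exact: bm_DK.
    - by apply: bmZ; exact: bm_DK.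
    by apply: eq_Rintegral => t _; rewrite mulrBl.
  transitivity (\int[U]_t (cos e * (hc t * sin (2 * pi * N%:~R * t) + hs t * cos (2 * pi * N%:~R * t))
     + sin e * (hs t * sin (2 * pi * N%:~R * t) - hc t * cos (2 * pi * N%:~R * t)))).
    have b1 := bmM bhc (bm_sink N); have b2 := bmM bhs (bm_cosk N).
    have b3 := bmM bhs (bm_sink N); have b4 := bmM bhc (bm_cosk N).
    apply: eq_Rint_Unif.
    - by apply: bmM; [apply: bmB => //; exact: bm_cst|exact: bm_DK].
    - by apply: bmD; apply: bmZ; [exact: bmD|exact: bmB].
    move=> t t01; rewrite /hc /hs.
    transitivity (h t * sin (pi * (t - x) + 2 * pi * N%:~R * (t - x))).
      rewrite -sin_DK /h indicE mem_set/= ?in_itv//= mul1r.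
      have [tx|tx] := eqVneq t x; first by rewrite tx !subrr !mul0r.
      rewrite -!mulrA; congr (_ * _); rewrite mulrA mulVf ?mul1r//.
      have tb : `|t - x| <= b.
        move/andP: t01 => [? ?].
        by rewrite /b le_max !ler_norml; have [?|?] := leP x t; apply/orP; [right|left]; apply/andP; split; lra.
      by rewrite -normr_gt0 (lt_le_trans _ (cP _ tb))// mulr_gt0// normr_gt0// subr_eq0.
    rewrite (_ : pi * (t - x) + _ = (pi * t + 2 * pi * N%:~R * t) - e); last first.
      by rewrite /e; ring.
    by rewrite sinB (sinD (pi * t)) (cosD (pi * t)); ring.
  have b1 := bmM bhc (bm_sink N); have b2 := bmM bhs (bm_cosk N).
  have b3 := bmM bhs (bm_sink N); have b4 := bmM bhc (bm_cosk N).
  rewrite RintD; [|exact: (bmZ _ (bmD b1 b2))|exact: (bmZ _ (bmB b3 b4))].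
  rewrite (RintZ _ _ (bmD b1 b2)) (RintZ _ _ (bmB b3 b4)).
  by rewrite (RintD _ b1 b2) (RintB _ b3 b4).
have [Ac Bc] := AF_BF_cvg0 bhc; have [As Bs] := AF_BF_cvg0 bhs.
pose w (n : nat) : R := `|BF hc n%:Z| + `|AF hs n%:Z| + (`|BF hs n%:Z| + `|AF hc n%:Z|).
have cvg1 : w @ \oo --> 0.
  rewrite -[X in _ --> X](addr0 0) -[X in _ --> X + X](addr0 0) -{1 2 3 4}(@normr0 _ R).
  by apply: cvgD; apply: cvgD; exact: cvg_norm.
apply/subr_cvg0.
have cvg2 : - w n @[n --> \oo] --> 0.
  by rewrite -[X in _ --> X]oppr0; exact: cvgN.
apply: (squeeze_cvgr _ cvg2 cvg1); near=> N.
rewrite -ler_norml key (le_trans (ler_normD _ _))// !normrM.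
apply: lerD.
  by rewrite (le_trans _ (ler_normD _ _))// ler_piMl// cos_max.
by rewrite (le_trans _ (ler_normB _ _))// ler_piMl// sin_max.
Unshelve. all: by end_near. Qed.

End one_dimensional_series.

Section parseval_one_dimension.
Context (R : realType).
Notation U := (Unif R).
Implicit Types G : measurableTypeR R -> R.

Lemma bm_SF G N : bm (SF G N : measurableTypeR R -> R).
Proof.
by apply: bm_sum => k _; apply: bmD; apply: bmZ; [exact: bm_cosk|exact: bm_sink].
Qed.

(** [SF G N] is the real part of a trigonometric polynomial whose squared norm is the right-hand
    side, and an inequality is all that the Fatou argument requires. *)
Lemma Rint_SF_sq G N : bm G ->
  \int[U]_t (SF G N t ^+ 2) <= \sum_(k <- zs N) (AF G k ^+ 2 + BF G k ^+ 2).
Proof.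
move=> bG.
have := @L2_TP R 1 [seq const_mx k | k <- zs N] (coef (fun x => (lift1 G x)%:C%C))
  (const_mx_uniq (zs_uniq N)).
rewrite big_map; under [X in _ = X]eq_bigr do rewrite coef_lift1// /sqmod/= sqrrN.
move=> <-; rewrite -Rint_lift1; last exact: (bmX 2 (bm_SF G N)).
apply: le_Rint.
- exact: (bm_lift1 (bmX 2 (bm_SF G N))).
- by apply: bm_sqmod; exact: cbm_TP.
move=> x; rewrite /lift1 /sqmod (_ : SF G N _ = complex.Re (TP [seq const_mx k | k <- zs N]
    (coef (fun x => (lift1 G x)%:C%C)) x)) ?lerDl ?sqr_ge0//.
rewrite /TP big_map cRe_sum; apply: eq_bigr => k _.
by rewrite coef_lift1// cReM /= mulNr opprK dotk1 mulrA.
Qed.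

(** If the energies of all partial sums stayed [e] below that of [G], Fatou's lemma and pointwise
    convergence would contradict this. The opposite inequality is Bessel's. *)
Lemma parseval1_ge G (C : R) : bm G -> (forall t t' : R, `|G t - G t'| <= C * `|t - t'|) ->
  forall e, 0 < e -> exists N,
    \int[U]_t (G t ^+ 2) <= \sum_(k <- zs N) (AF G k ^+ 2 + BF G k ^+ 2) + e.
Proof.
move=> bG GC e e0; apply: contrapT => /forallNP H.
have {}H N : \int[U]_t (SF G N t ^+ 2) <= \int[U]_t (G t ^+ 2) - e.
  apply: le_trans (Rint_SF_sq N bG) _.
  by have /negP := H N; rewrite -ltNge => /ltW; rewrite -lerBrDr.
(* Convergence is known at interior points only; the two endpoints form a null set. *)
pose D := (`]0, 1[%classic : set (measurableTypeR R)).
have toD (F : measurableTypeR R -> R) : bm F -> (forall t, 0 <= F t) ->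
    (\int[lebesgue_measure]_(t in D) (F t)%:E = (\int[U]_t F t)%:E)%E.
  move=> bF F0; rewrite -EFin_Rint// integral_Unif; last 2 first.
  - by apply/measurable_EFinP; case: bF.
  - by move=> x; rewrite lee_fin.
  rewrite -(@integral_itv_bndoo R 0 1 (EFin \o F) true false)//.
  by apply: measurable_funTS; apply/measurable_EFinP; case: bF.
have mSF N : measurable_fun D (fun t => (SF G N t ^+ 2)%:E).
  by apply: measurable_funTS; apply/measurable_EFinP; case: (bmX 2 (bm_SF G N)).
have := @fatou _ _ R lebesgue_measure D (measurable_itv _)
  (fun N t => (SF G N t ^+ 2)%:E) mSF (fun N t _ => sqr_ge0 _).
under eq_integral => t tD.
  have -> : limn_einf (fun N => (SF G N t ^+ 2)%:E) = (G t ^+ 2)%:E.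
    have cS : (SF G N t ^+ 2)%:E @[N --> \oo] --> (G t ^+ 2)%:E.
      apply: cvg_EFin; first by near=> N.
      have ct : SF G N t @[N --> \oo] --> G t.
        by apply: SF_cvg GC _ => //; move: tD; rewrite inE /D/= in_itv.
      rewrite [X in X @ _ --> _](_ : _ = (fun N => SF G N t * SF G N t)).
        by rewrite expr2; exact: cvgM.
      by apply/funext.
    by rewrite is_cvg_limn_einfE; [exact/cvg_lim|apply/cvg_ex; exists (G t ^+ 2)%:E].
  over.
rewrite toD; [|exact: bmX|by move=> t; exact: sqr_ge0].
apply/negP; rewrite -ltNge.
apply: (@le_lt_trans _ _ (\int[U]_t (G t ^+ 2) - e)%:E); last first.
  by rewrite lte_fin ltrBlDr ltrDl.
rewrite limn_einf_lim; apply: lime_le; first exact: is_cvg_einfs.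
near=> n; apply: ereal_inf_le; exists (\int[U]_t (SF G n t ^+ 2))%:E.
  exists n => //=; rewrite toD//; first exact: (bmX 2 (bm_SF G n)).
  by move=> t; exact: sqr_ge0.
by rewrite lee_fin.
Unshelve. all: by end_near. Qed.

End parseval_one_dimension.

(** * Parseval's equality on the cube, by induction on the dimension *)

Section parseval.
Context (R : realType).
Implicit Types d : nat.

Definition lip1 d (C : R) (F : 'rV[R]_d -> R) :=
  forall x y : 'rV[R]_d, `|F x - F y| <= C * \sum_(i < d) `|x ord0 i - y ord0 i|.

Lemma lip1_vcons_l d C F t t' (v : 'rV[R]_d) : lip1 C F ->
  `|F (vcons (t, v)) - F (vcons (t', v))| <= C * `|t - t'|.
Proof.
move=> /(_ (vcons (t, v)) (vcons (t', v))); rewrite big_ord_recl !vcons0 big1 ?addr0// => i _.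
by rewrite !vconsS subrr normr0.
Qed.

Lemma lip1_vcons_r d C F t (v w : 'rV[R]_d) : lip1 C F ->
  `|F (vcons (t, v)) - F (vcons (t, w))| <= C * \sum_(i < d) `|v ord0 i - w ord0 i|.
Proof.
move=> /(_ (vcons (t, v)) (vcons (t, w))).
rewrite big_ord_recl !vcons0 subrr normr0 add0r.
by under eq_bigr do rewrite !vconsS.
Qed.

Lemma ler_sum_uniq (I : eqType) (s t : seq I) (F : I -> R) :
  uniq s -> uniq t -> {subset s <= t} -> (forall i, 0 <= F i) ->
  \sum_(i <- s) F i <= \sum_(i <- t) F i.
Proof.
move=> us ut st F0.
rewrite [leRHS](bigID (mem s) xpredT)/= -[leLHS]addr0; apply: lerD; last exact: sumr_ge0.
rewrite le_eqVlt; apply/orP; left; apply/eqP.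
rewrite -[RHS]big_filter; apply: perm_big; apply: uniq_perm => //.
  exact: filter_uniq.
move=> i; rewrite mem_filter; case: (boolP (i \in s)) => // /st ->.
by rewrite andbT.
Qed.

Definition AK d (F : bRV R d.+1 -> R) (k : int) : bRV R d -> R :=
  fun v => AF (fun t => F (vcons (t, v))) k.
Definition BK d (F : bRV R d.+1 -> R) (k : int) : bRV R d -> R :=
  fun v => BF (fun t => F (vcons (t, v))) k.

Lemma bm_FC d (F : bRV R d.+1 -> R) k : bm F -> bm (fun p : measurableTypeR R * bRV R d =>
  F (vcons p) * cos (2 * pi * k%:~R * p.1)).
Proof.
move=> bF; apply: bmM; first exact: bm_vcons.
by apply: bm_cos; apply: measurable_funM => //; exact: measurable_fst.
Qed.

Lemma bm_FS d (F : bRV R d.+1 -> R) k : bm F -> bm (fun p : measurableTypeR R * bRV R d =>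
  F (vcons p) * sin (2 * pi * k%:~R * p.1)).
Proof.
move=> bF; apply: bmM; first exact: bm_vcons.
by apply: bm_sin; apply: measurable_funM => //; exact: measurable_fst.
Qed.

Lemma bm_AK d (F : bRV R d.+1 -> R) k : bm F -> bm (AK F k).
Proof. by move=> bF; exact: (bm_Rint1 (Unif R) (Lam R d) (bm_FC k bF)). Qed.

Lemma bm_BK d (F : bRV R d.+1 -> R) k : bm F -> bm (BK F k).
Proof. by move=> bF; exact: (bm_Rint1 (Unif R) (Lam R d) (bm_FS k bF)). Qed.

(** Averaging against a kernel bounded by 1 over a probability preserves the Lipschitz constant, so
    the induction hypothesis of Parseval's equality applies to the partial coefficients. *)
Lemma lip1_AK d C (F : bRV R d.+1 -> R) k : bm F -> lip1 C F -> lip1 C (AK F k).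
Proof.
move=> bF lF v w.
rewrite /AK /AF -RintB; [|exact: (bm_slice2 (bm_FC k bF))|exact: (bm_slice2 (bm_FC k bF))].
apply: Rint_bound; first exact: (bmB (bm_slice2 (bm_FC k bF) v) (bm_slice2 (bm_FC k bF) w)).
move=> t; rewrite -mulrBl normrM (le_trans _ (lip1_vcons_r t v w lF))//.
by rewrite ler_piMr// cos_max.
Qed.

Lemma lip1_BK d C (F : bRV R d.+1 -> R) k : bm F -> lip1 C F -> lip1 C (BK F k).
Proof.
move=> bF lF v w.
rewrite /BK /BF -RintB; [|exact: (bm_slice2 (bm_FS k bF))|exact: (bm_slice2 (bm_FS k bF))].
apply: Rint_bound; first exact: (bmB (bm_slice2 (bm_FS k bF) v) (bm_slice2 (bm_FS k bF) w)).
move=> t; rewrite -mulrBl normrM (le_trans _ (lip1_vcons_r t v w lF))//.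
by rewrite ler_piMr// sin_max.
Qed.

Definition kcons d (p : int * 'rV[int]_d) : 'rV[int]_d.+1 :=
  \row_i (if unlift ord0 i is Some j then p.2 ord0 j else p.1).

Lemma kcons0 d (p : int * 'rV[int]_d) : kcons p ord0 ord0 = p.1.
Proof. by rewrite mxE unlift_none. Qed.

Lemma ktail_kcons d (p : int * 'rV[int]_d) : ktail (kcons p) = p.2.
Proof. by apply/rowP => i; rewrite !mxE liftK. Qed.

Lemma kcons_inj d : injective (@kcons d).
Proof.
move=> [k v] [l w] kl; congr (_, _).
  by have := congr1 (fun z : 'rV[int]_d.+1 => z ord0 ord0) kl; rewrite !kcons0.
by have := congr1 (@ktail d) kl; rewrite !ktail_kcons.
Qed.

Definition cf d (F : bRV R d -> R) (k : 'rV[int]_d) : R[i] :=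
  coef (fun x => (F x)%:C%C) k.

(** The parallelogram law: the coefficients of [F] at [(k, l)] and [(- k, l)] are [a - i b] and
    [a + i b], where [a] and [b] are the coefficients at [l] of the partial cosine and sine
    transforms. *)
Lemma cf_kcons d (F : bRV R d.+1 -> R) (k : int) (l : 'rV[int]_d) : bm F ->
  sqmod (cf F (kcons (k, l))) + sqmod (cf F (kcons (- k, l))) =
  2 * (sqmod (cf (AK F k) l) + sqmod (cf (BK F k) l)).
Proof.
move=> bF; rewrite /cf !coef_real//; [|exact: bm_BK|exact: bm_AK].
have bA := bm_AK k bF; have bB := bm_BK k bF.
have cc := @bm_ck R _ l; have ss := @bm_sk R _ l.
have E1 (k' : int) : \int[Lam R d.+1]_x (F x * ck (kcons (k', l)) x) =
    \int[Lam R d]_v (AK F k' v * ck l v) - \int[Lam R d]_v (BK F k' v * sk l v).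
  have bA' := bm_AK k' bF; have bB' := bm_BK k' bF.
  rewrite Rint_LamS'; last by apply: bmM => //; exact: bm_ck.
  rewrite -RintB; [|exact: bmM|exact: bmM].
  apply: eq_Rintegral => v _.
  rewrite !(mulrC (AK F k' v)) !(mulrC (BK F k' v)) /AK /AF /BK /BF.
  have b1 := bm_slice2 (bm_FC k' bF) v; have b2 := bm_slice2 (bm_FS k' bF) v.
  rewrite -(RintZ (Unif R) _ b1) -(RintZ (Unif R) _ b2).
  rewrite -(RintB (Unif R) (bmZ _ b1) (bmZ _ b2)); apply: eq_Rintegral => t _.
  by rewrite ck_vcons kcons0 ktail_kcons /=; ring.
have E2 (k' : int) : \int[Lam R d.+1]_x (F x * sk (kcons (k', l)) x) =
    \int[Lam R d]_v (BK F k' v * ck l v) + \int[Lam R d]_v (AK F k' v * sk l v).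
  have bA' := bm_AK k' bF; have bB' := bm_BK k' bF.
  rewrite Rint_LamS'; last by apply: bmM => //; exact: bm_sk.
  rewrite -RintD; [|exact: bmM|exact: bmM].
  apply: eq_Rintegral => v _.
  rewrite !(mulrC (AK F k' v)) !(mulrC (BK F k' v)) /AK /AF /BK /BF.
  have b1 := bm_slice2 (bm_FC k' bF) v; have b2 := bm_slice2 (bm_FS k' bF) v.
  rewrite -(RintZ (Unif R) _ b1) -(RintZ (Unif R) _ b2).
  rewrite -(RintD (Unif R) (bmZ _ b2) (bmZ _ b1)); apply: eq_Rintegral => t _.
  by rewrite sk_vcons kcons0 ktail_kcons /=; ring.
have AN v : AK F (- k) v = AK F k v by exact: AFN.
have BN v : BK F (- k) v = - BK F k v.
  by apply: BFN; exact: (bm_slice2 (bm_vcons bF)).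
have IA h : bm h -> \int[Lam R d]_v (AK F (- k) v * h v) = \int[Lam R d]_v (AK F k v * h v).
  by move=> _; under eq_Rintegral do rewrite AN.
have IB h : bm h -> \int[Lam R d]_v (BK F (- k) v * h v) = - \int[Lam R d]_v (BK F k v * h v).
  move=> bh; under eq_Rintegral do rewrite BN mulNr -mulN1r.
  by rewrite RintZ ?mulN1r//; exact: bmM.
rewrite /sqmod /= !E1 !E2 !IA// !IB//.
do 4!move: (Rintegral _ _ _) => ?.
by ring.
Qed.

Lemma parseval_ge d (F : bRV R d -> R) C : bm F -> lip1 C F ->
  forall e, 0 < e -> exists N,
    \int[Lam R d]_x (F x ^+ 2) <= \sum_(k <- KS N d) sqmod (cf F k) + e.
Proof.
elim: d F => [|d ih] F bF lF e e0.
  exists 0%N; rewrite Rint_Lam0; last exact: bmX.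
  rewrite (_ : KS 0 0 = [:: 0]); last first.
    apply: perm_small_eq => //; apply: uniq_perm => //; first exact: KS_uniq.
    move=> k; rewrite mem_KS inE (_ : k = 0) ?eqxx; last by apply/rowP => -[].
    by apply/forallP => -[].
  rewrite big_seq1 /cf coef_real// /sqmod /= !Rint_Lam0; first last.
  - by apply: bmM => //; exact: bm_ck.
  - by apply: bmM => //; exact: bm_sk.
  rewrite /ck /sk /dotk big_ord0 mulr0 cos0 sin0 mulr1 mulr0.
  by rewrite oppr0 expr0n addr0 lerDl ltW.
pose Q N v := \sum_(k <- zs N) (AK F k v ^+ 2 + BK F k v ^+ 2).
have bQ N : bm (Q N).
  by apply: bm_sum => k _; apply: bmD; apply: bmX; [exact: bm_AK|exact: bm_BK].
have bF2 : bm (fun p : measurableTypeR R * bRV R d => F (vcons p) ^+ 2).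
  by apply: bmX; exact: bm_vcons.
pose I v := \int[Unif R]_t (F (vcons (t, v)) ^+ 2).
have bI : bm I by exact: (bm_Rint1 (Unif R) (Lam R d) bF2).
have QI N v : Q N v <= I v.
  exact: (bessel1 (bm_slice2 (bm_vcons bF) v) (zs_uniq N)).
have Qnd v : {homo (fun N => Q N v) : m n / (m <= n)%N >-> m <= n}.
  move=> m n mn; apply: ler_sum_uniq; rewrite ?zs_uniq//.
    by move=> k; rewrite !mem_zs => /leq_trans; exact.
  by move=> k; rewrite addr_ge0// sqr_ge0.
have Qcvg v : Q N v @[N --> \oo] --> I v.
  apply/cvgrPdist_le => /= eps eps0.
  have [N0 HN0] := parseval1_ge (bm_slice2 (bm_vcons bF) v)
    (fun t t' => lip1_vcons_l t t' v lF) eps0.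
  near=> N; rewrite ger0_norm ?subr_ge0// lerBlDl (le_trans HN0)// lerD2r.
  by apply: (Qnd v); near: N; exact: nbhs_infty_ge.
(* The one-dimensional level depends on the slice [v]; monotone convergence of [Q N v] to [I v]
   yields a single level for the integral. *)
have [N1 HN1] : exists N1, \int[Lam R d.+1]_x (F x ^+ 2) <= \int[Lam R d]_v Q N1 v + e / 2.
  rewrite Rint_LamS'; last exact: bmX.
  have cI : (\int[Lam R d]_v (Q N v)%:E)%E @[N --> \oo] --> (\int[Lam R d]_v (I v)%:E)%E.
    have -> : (\int[Lam R d]_v (I v)%:E)%E = (\int[Lam R d]_v (limn (fun N => (Q N v)%:E)))%E.
      apply: eq_integral => v _; apply/esym/cvg_lim => //.
      by apply: cvg_EFin; [near=> n|exact: Qcvg].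
    apply: cvg_monotone_convergence => //.
    - by move=> n; apply/measurable_EFinP; case: (bQ n).
    - by move=> n v _; rewrite lee_fin sumr_ge0// => k _; rewrite addr_ge0// sqr_ge0.
    - by move=> v _ m n mn; rewrite lee_fin; exact: Qnd.
  have {}cI : \int[Lam R d]_v Q N v @[N --> \oo] --> \int[Lam R d]_v I v.
    by apply: fine_cvg; rewrite -EFin_Rint.
  have e20 : 0 < e / 2 by rewrite divr_gt0.
  have /cvgrPdist_le /(_ _ e20) [N1 _ /(_ N1 (leqnn _)) H] := cI.
  exists N1; rewrite -lerBlDl; apply: le_trans H; exact: ler_norm.
(* Half of [e] is shared among [2 * size (zs N1)] functions, namely [AK F k] and [BK F k] for each
   [k]. *)
have e'0 : 0 < e / (4 * (size (zs N1))%:R).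
  by rewrite divr_gt0// mulr_gt0// ltr0n; case: (N1).
have /choice[NA HA] k := ih (AK F k) (bm_AK k bF) (lip1_AK k bF lF) _ e'0.
have /choice[NB HB] k := ih (BK F k) (bm_BK k bF) (lip1_BK k bF lF) _ e'0.
pose N2 := (N1 + \sum_(k <- zs N1) (NA k + NB k))%N.
have N2A k : k \in zs N1 -> (NA k <= N2)%N /\ (NB k <= N2)%N.
  by move=> kz; rewrite /N2 (big_rem k)//=; lia.
exists N2; apply: le_trans HN1 _.
rewrite [leRHS](_ : _ = \sum_(k <- KS N2 d.+1) sqmod (cf F k) + e / 2 + e / 2); last by field.
rewrite lerD2r /Q Rint_sum; last first.
  by move=> k _; apply: bmD; apply: bmX; [exact: bm_AK|exact: bm_BK].
pose W k l := sqmod (cf (AK F k) l) + sqmod (cf (BK F k) l).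
apply: (@le_trans _ _ (\sum_(k <- zs N1) (\sum_(l <- KS N2 d) W k l
    + 2 * (e / (4 * (size (zs N1))%:R))))).
  rewrite big_seq [leRHS]big_seq; apply: ler_sum => k kz.
  have [NA2 NB2] := N2A k kz.
  rewrite RintD; [|by apply: bmX; exact: bm_AK|by apply: bmX; exact: bm_BK].
  rewrite /W big_split/= mulr_natl mulr2n addrACA; apply: lerD.
    apply: le_trans (HA k) _; rewrite lerD2r.
    by apply: ler_sum_uniq; rewrite ?KS_uniq//; [exact: KS_sub|move=> *; exact: sqmod_ge0].
  apply: le_trans (HB k) _; rewrite lerD2r.
  by apply: ler_sum_uniq; rewrite ?KS_uniq//; [exact: KS_sub|move=> *; exact: sqmod_ge0].
rewrite big_split/= big_const_seq count_predT iter_addr_0 -[_ *+ size _]mulr_natr.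
have -> : 2 * (e / (4 * (size (zs N1))%:R)) * (size (zs N1))%:R = e / 2.
  have s0 : (size (zs N1))%:R != 0 :> R by rewrite pnatr_eq0; case: (N1).
  by field.
rewrite lerD2r.
pose V k l := sqmod (cf F (kcons (k, l))).
(* [cf_kcons] only controls the pair [k], [- k]; doubling the sum and reflecting [zs N1] creates
   these pairs. *)
have VW : \sum_(k <- zs N1) \sum_(l <- KS N2 d) W k l = \sum_(k <- zs N1) \sum_(l <- KS N2 d) V k l.
  apply: (@mulfI _ 2) => //.
  rewrite [RHS]mulr_natl mulr2n -[X in _ = _ + X](perm_big _ (zs_opp N1)) big_map.
  rewrite -big_split/= mulr_sumr; apply: eq_bigr => k _.
  rewrite -big_split/= mulr_sumr; apply: eq_bigr => l _.
  by rewrite /V cf_kcons.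
rewrite VW.
have -> : \sum_(k <- zs N1) \sum_(l <- KS N2 d) V k l =
    \sum_(z <- [seq kcons p | p <- allpairs pair (zs N1) (KS N2 d)]) sqmod (cf F z).
  by rewrite big_map big_allpairs_dep.
apply: ler_sum_uniq.
- rewrite map_inj_uniq; last exact: kcons_inj.
  by apply: allpairs_uniq; rewrite ?zs_uniq ?KS_uniq// => -[? ?] [? ?].
- exact: KS_uniq.
- move=> _ /mapP[p /allpairsP[[k l] /= [kz lK ->]] ->].
  rewrite mem_KS; apply/forallP => i; case: (unliftP ord0 i) => [j ->|->].
    by move: lK; rewrite mem_KS mxE liftK => /forallP/(_ j).
  by rewrite kcons0/=; move: kz; rewrite mem_zs /N2; lia.
- by move=> *; exact: sqmod_ge0.
Unshelve. all: by end_near. Qed.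

End parseval.

(** * Bias of periodic Sobolev functions *)

Section directional_derivatives.
Context (R : realType).

(** The two difference quotients are the same function. Directional derivatives thus become
    derivatives on the line, where the mean value theorem and the fundamental theorem of calculus
    live. *)
Lemma is_derive_lineP d (F : 'rV[R]_d -> R) (x v : 'rV[R]_d) (s df : R) :
  is_derive s 1 (fun h : R => F (h *: v + x)) df <-> is_derive (s *: v + x) v F df.
Proof.
have E : (fun h : R => h^-1 *: (((fun h : R => F (h *: v + x)) \o shift s) (h *: (1 : R))
      - (fun h : R => F (h *: v + x)) s)) =
    (fun h : R => h^-1 *: ((F \o shift (s *: v + x)) (h *: v) - F (s *: v + x))).
  apply/funext => h; congr (_ *: (F _ - _)) => /=.
  by rewrite scalerDl addrA [(h *: 1)%R]mulr1.
split => -[h1 h2]; split.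
- by move: h1; rewrite /derivable E.
- by move: h2; rewrite /derive E.
- by move: h1; rewrite /derivable E.
- by move: h2; rewrite /derive E.
Qed.

Lemma vcons_line0 d t (w : 'rV[R]_d) :
  vcons (t, w) = t *: delta_mx 0 ord0 + vcons (0, w) :> 'rV[R]_d.+1.
Proof.
apply/rowP => i; rewrite [RHS]mxE; case: (unliftP ord0 i) => [j ->|->].
  by rewrite (vconsS (t, w)) (vconsS (0, w)) !mxE/= mulr0 add0r.
by rewrite (vcons0 (t, w)) (vcons0 (0, w)) !mxE/= mulr1 addr0.
Qed.

Lemma vcons_lineS d t s (w : 'rV[R]_d) (j : 'I_d) :
  vcons (t, s *: delta_mx 0 j + w) = s *: delta_mx 0 (lift ord0 j) + vcons (t, w)
  :> 'rV[R]_d.+1.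
Proof.
apply/rowP => i; rewrite [RHS]mxE; case: (unliftP ord0 i) => [l ->|->].
  by rewrite (vconsS (t, _)) (vconsS (t, w)) !mxE/= (inj_eq lift_inj).
by rewrite (vcons0 (t, _)) (vcons0 (t, w)) !mxE/= mulr0 add0r.
Qed.

Lemma is_derive_vcons0 d (G : 'rV[R]_d.+1 -> R) t (w : 'rV[R]_d) :
  derivable G (vcons (t, w)) 'e_(ord0) ->
  is_derive t 1 (fun s : R => G (vcons (s, w))) (partial ord0 G (vcons (t, w))).
Proof.
move=> dG.
have -> : (fun s : R => G (vcons (s, w))) = (fun s => G (s *: 'e_(ord0) + vcons (0, w))).
  by apply/funext => s; rewrite vcons_line0.
apply/is_derive_lineP; rewrite -vcons_line0; split => //.
Qed.

Lemma is_derive_vconsS d (G : 'rV[R]_d.+1 -> R) t (w : 'rV[R]_d) j :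
  derivable G (vcons (t, w)) 'e_(lift ord0 j) ->
  is_derive w 'e_j (fun v => G (vcons (t, v))) (partial (lift ord0 j) G (vcons (t, w))).
Proof.
move=> dG; rewrite -[w in is_derive w](add0r w) -[X in X + w](scale0r 'e_j).
apply/is_derive_lineP.
have -> : (fun h : R => G (vcons (t, h *: 'e_j + w))) =
    (fun h => G (h *: 'e_(lift ord0 j) + vcons (t, w))).
  by apply/funext => s; rewrite vcons_lineS.
by apply/is_derive_lineP; rewrite scale0r add0r; split.
Qed.

Lemma vcons_continuous0 d (w : 'rV[R]_d) :
  continuous (fun t : R => vcons (t, w) : 'rV[R]_d.+1).
Proof.
move=> t A /nbhs_ballP[e /= e0 eA]; apply/nbhs_ballP; exists e => // s ts.
apply: eA; split => // i j; rewrite ord1; case: (unliftP ord0 j) => [l ->|->].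
  by rewrite (vconsS (t, w)) (vconsS (s, w)); exact: ballxx.
by rewrite (vcons0 (t, w)) (vcons0 (s, w)).
Qed.

Lemma vcons_continuousS d t : continuous (fun w : 'rV[R]_d => vcons (t, w) : 'rV[R]_d.+1).
Proof.
move=> w A /nbhs_ballP[e /= e0 eA]; apply/nbhs_ballP; exists e => // v [_ wv].
apply: eA; split => // i j; rewrite ord1; case: (unliftP ord0 j) => [l ->|->].
  by rewrite (vconsS (t, w)) (vconsS (t, v)); exact: wv.
by rewrite (vcons0 (t, w)) (vcons0 (t, v)); exact: ballxx.
Qed.

Lemma continuous_comp_fun (S T V : topologicalType) (f : S -> T) (g : T -> V) :
  continuous f -> continuous g -> continuous (fun x => g (f x)).
Proof. by move=> cf cg x; apply: continuous_comp; [exact: cf|exact: cg]. Qed.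

End directional_derivatives.

Section clamping.
Context (R : realType).

Definition clampR (t : R) : R := Num.max 0 (Num.min t 1).

Lemma clampR_01 t : 0 <= clampR t <= 1.
Proof. by rewrite /clampR le_max lexx/= ge_max ler01 ge_min lexx orbT. Qed.

Lemma clampR_id t : 0 <= t <= 1 -> clampR t = t.
Proof. by move=> /andP[t0 t1]; rewrite /clampR (min_l t1) (max_r t0). Qed.

Lemma clampR_lip s t : `|clampR s - clampR t| <= `|s - t|.
Proof.
have cR (x : R) : [\/ x <= 0 /\ clampR x = 0, 0 <= x <= 1 /\ clampR x = x | 1 <= x /\ clampR x = 1].
  have [x0|/ltW x0] := leP x 0.
    by apply: Or31; split=> //; rewrite /clampR max_l// ge_min x0.
  have [x1|/ltW x1] := leP x 1; first by apply: Or32; rewrite clampR_id ?x0.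
  by apply: Or33; split=> //; rewrite /clampR min_r// max_r.
have h1 := ler_norm (s - t); have h2 := ler_norm (t - s).
rewrite (distrC t s) in h2; have h3 := normr_ge0 (s - t); rewrite ler_norml.
case: (cR s) => [[? ->]|[/andP[? ?] ->]|[? ->]];
case: (cR t) => [[? ->]|[/andP[? ?] ->]|[? ->]]; apply/andP; split; lra.
Qed.

Definition clampv d (x : bRV R d) : bRV R d := \row_i clampR ((x : 'rV[R]_d) ord0 i).

Lemma clampv_cube d x : unit_cube (@clampv d x : 'rV[R]_d).
Proof. by move=> i; rewrite mxE; exact: clampR_01. Qed.

Lemma clampv_id d (x : 'rV[R]_d) : unit_cube x -> clampv x = x.
Proof. by move=> cx; apply/rowP => i; rewrite mxE clampR_id. Qed.

Lemma measurable_clampR : measurable_fun [set: measurableTypeR R] (clampR : measurableTypeR R -> R).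
Proof. by apply: measurable_maxr => //; exact: measurable_minr. Qed.

Lemma measurable_clampv d : measurable_fun [set: bRV R d] (@clampv d).
Proof.
apply: measurable_bRV => i.
rewrite [X in measurable_fun _ X](_ : _ =
  (clampR : measurableTypeR R -> R) \o (fun x : bRV R d => (x : 'rV[R]_d) ord0 i)).
  by apply: measurableT_comp; [exact: measurable_clampR|exact: coord_measurable_bRV].
by apply/funext => x; rewrite mxE.
Qed.

Lemma clampv_vcons d t (v : 'rV[R]_d) : clampv (vcons (t, v)) = vcons (clampR t, clampv v).
Proof.
apply/rowP => i; rewrite mxE; case: (unliftP ord0 i) => [j ->|->].
  by rewrite [in LHS](vconsS (t, v)) [RHS](vconsS (clampR t, clampv v)) mxE.
by rewrite [in LHS](vcons0 (t, v)) [RHS](vcons0 (clampR t, clampv v)).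
Qed.

Lemma unit_cube_compact d : compact (@unit_cube R d).
Proof.
have -> : @unit_cube R d = [set v : 'rV[R]_d | forall i, `[0, 1]%classic (v ord0 i)].
  by apply/seteqP; split => x /= H i; have := H i; rewrite /= in_itv/=.
exact: (@rV_compact R d (fun=> `[0, 1]%classic) (fun=> @segment_compact R 0 1)).
Qed.

Lemma cube_bounded d (h : 'rV[R]_d -> R) : continuous h ->
  exists C, forall x, unit_cube x -> `|h x| <= C.
Proof.
move=> ch.
have /compact_bounded[M [_ HM]] : compact (h @` @unit_cube R d).
  by apply: continuous_compact; [exact: continuous_subspaceT|exact: unit_cube_compact].
exists (M + 1) => x cx; apply: HM; first by rewrite ltrDl.
by exists x.
Qed.

(* clamping makes a continuous function globally bounded without changing it on the cube *)
Definition rc d (h : 'rV[R]_d -> R) : bRV R d -> R := fun x => h (clampv x).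

Lemma bm_rc d (h : 'rV[R]_d -> R) : continuous h -> bm (rc h).
Proof.
move=> ch; split.
  apply: (measurableT_comp (f := (h : bRV R d -> R))); last exact: measurable_clampv.
  exact: continuous_measurable_bRV.
have [C hC] := cube_bounded ch; exists C => x; apply: hC; exact: clampv_cube.
Qed.

Lemma rc_cube d (h : 'rV[R]_d -> R) x : unit_cube x -> rc h x = h x.
Proof. by move=> cx; rewrite /rc clampv_id. Qed.

Lemma eq_Rint_Lam d (F G : bRV R d -> R) : bm F -> bm G ->
  (forall x : 'rV[R]_d, unit_cube x -> F x = G x) ->
  \int[Lam R d]_x F x = \int[Lam R d]_x G x.
Proof. by move=> bF bG FG; rewrite -!cube_intE//; exact: eq_cube_int. Qed.

Lemma flip_coord_vconsS d t (v : 'rV[R]_d) j :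
  flip_coord (lift ord0 j) (vcons (t, v)) = vcons (t, flip_coord j v) :> 'rV[R]_d.+1.
Proof.
apply/rowP => i; rewrite [LHS]mxE; case: (unliftP ord0 i) => [l ->|->].
  rewrite (vconsS (t, flip_coord j v)) [RHS]mxE/= (inj_eq lift_inj).
  by rewrite (vconsS (t, v)) (vconsS (t, v)).
by rewrite (vcons0 (t, flip_coord j v))/= (vcons0 (t, v)).
Qed.

Lemma flip_coord_vcons0 d t (v : 'rV[R]_d) :
  flip_coord ord0 (vcons (t, v)) = vcons (1 - t, v) :> 'rV[R]_d.+1.
Proof.
apply/rowP => i; rewrite [LHS]mxE; case: (unliftP ord0 i) => [l ->|->].
  by rewrite (vconsS (1 - t, v)) /= (vconsS (t, v)).
by rewrite eqxx (vcons0 (1 - t, v))/= (vcons0 (t, v)).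
Qed.

Lemma unit_cube_vcons d t (v : 'rV[R]_d) : 0 <= t <= 1 -> unit_cube v ->
  unit_cube (vcons (t, v) : 'rV[R]_d.+1).
Proof. exact: unit_cube_row_mx. Qed.

(** Induction on the dimension: if the direction is not the first one, the first coordinate is
    frozen; if it is, the others are frozen and the integral is the difference between opposite
    faces, which [flip_coord] identifies. *)
Lemma Rint_partial_periodic d (i : 'I_d) (G : 'rV[R]_d -> R) :
  continuous G -> (forall x, derivable G x 'e_i) -> continuous (partial i G) ->
  (forall x, unit_cube x -> x ord0 i = 0 -> G x = G (flip_coord i x)) ->
  \int[Lam R d]_x rc (partial i G) x = 0.
Proof.
elim: d i G => [[]//|d ih] i G cG dG cdG pG.
case: (unliftP ord0 i) => [j ij|i0]; subst i.
  rewrite Rint_LamS; last exact: bm_rc.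
  rewrite -[RHS](Rint_cst (Unif R)); apply: eq_Rintegral => t _.
  (* Freezing at the clamped value keeps the slice inside the cube, where periodicity is assumed. *)
  pose Gt v := G (vcons (clampR t, v)).
  have dGt w : is_derive w 'e_j Gt (partial (lift ord0 j) G (vcons (clampR t, w))).
    by apply: is_derive_vconsS; exact: dG.
  have pE : partial j Gt = fun w => partial (lift ord0 j) G (vcons (clampR t, w)).
    by apply/funext => w; exact: derive_val.
  rewrite -[RHS](ih j Gt).
  - by apply: eq_Rintegral => v _; rewrite /rc clampv_vcons pE.
  - by apply: continuous_comp_fun cG; exact: vcons_continuousS.
  - by move=> w; case: (dGt w).
  - by rewrite pE; apply: continuous_comp_fun cdG; exact: vcons_continuousS.
  - move=> x cx x0; rewrite /Gt -flip_coord_vconsS; apply: pG.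
      by apply: unit_cube_vcons => //; exact: clampR_01.
    by rewrite (vconsS (clampR t, x)).
rewrite Rint_LamS'; last exact: bm_rc.
rewrite -[RHS](Rint_cst (Lam R d)); apply: eq_Rintegral => v _.
apply: (@Rint_Unif_derive R (fun t => G (vcons (t, clampv v)))
  (fun t => partial ord0 G (vcons (t, clampv v)))
  (fun t => rc (partial ord0 G) (vcons (t, v)))).
- by apply: (continuous_comp_fun (@vcons_continuous0 _ _ _) cdG).
- by move=> t; apply: is_derive_vcons0; exact: dG.
- exact: (bm_slice2 (bm_vcons (bm_rc cdG))).
- by move=> t t01; rewrite /rc clampv_vcons clampR_id.
- rewrite pG; first by rewrite flip_coord_vcons0 subr0.
    by apply: unit_cube_vcons; [rewrite lexx ler01|exact: clampv_cube].
  by rewrite (vcons0 (0, clampv v)).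
Qed.

(** The coordinates are changed one after the other, with the mean value theorem for each; the cube
    contains all the segments used, so bounds on the cube suffice. *)
Lemma lip_cube d (G : 'rV[R]_d -> R) (C : R) :
  (forall i x, derivable G x 'e_i) ->
  (forall i x, unit_cube x -> `|partial i G x| <= C) ->
  forall a b, unit_cube a -> unit_cube b ->
  `|G a - G b| <= C * \sum_(i < d) `|a ord0 i - b ord0 i|.
Proof.
elim: d G => [|d ih] G dG GC a b ca cb.
  by rewrite big_ord0 mulr0 (_ : a = b) ?subrr ?normr0//; apply/rowP => -[].
have dec (x : 'rV[R]_d.+1) : unit_cube x -> exists (t : R) (v : 'rV[R]_d),
    [/\ x = vcons (t, v), 0 <= t <= 1 & unit_cube (v : 'rV[R]_d)].
  move=> cx; exists (x ord0 ord0), (\row_i x ord0 (lift ord0 i)); split=> //.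
    apply/rowP => i; case: (unliftP ord0 i) => [l ->|->].
      by rewrite [RHS](vconsS (_, \row_i x ord0 (lift ord0 i))) mxE.
    by rewrite [RHS](vcons0 (_, \row_i x ord0 (lift ord0 i))).
  by move=> i; rewrite mxE.
have [s [v [-> s01 cv]]] := dec _ ca; have [t [w [-> t01 cw]]] := dec _ cb.
rewrite big_ord_recl !(vcons0 (_, _)) /=.
under eq_bigr do rewrite (vconsS (s, v)) (vconsS (t, w)) /=.
rewrite mulrDr.
have -> : G (vcons (s, v)) - G (vcons (t, w)) = (G (vcons (s, v)) - G (vcons (t, v)))
   + (G (vcons (t, v)) - G (vcons (t, w))) by ring.
rewrite (le_trans (ler_normD _ _))// lerD//.
  wlog st : s t s01 t01 {ca cb dec} / s <= t.
    move=> H; have [st|/ltW ts] := leP s t; first exact: H.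
    by rewrite distrC (distrC s); exact: H.
  have dg (r : R) : is_derive r 1 (fun s : R => G (vcons (s, v))) (partial ord0 G (vcons (r, v))).
    by apply: is_derive_vcons0; exact: dG.
  have cg : {within `[s, t], continuous (fun s : R => G (vcons (s, v)))}.
    by apply: derivable_within_continuous => x _; case: (dg x).
  have [r] := MVT_segment st (fun x _ => dg x) cg.
  rewrite in_itv/= => /andP[sr rt] E; rewrite distrC E normrM distrC.
  rewrite ler_wpM2r// GC//; apply: unit_cube_vcons => //.
  by move: s01 t01 => /andP[? ?] /andP[? ?]; apply/andP; split; lra.
pose Gt v := G (vcons (t, v)).
have dGt w' j : is_derive w' 'e_j Gt (partial (lift ord0 j) G (vcons (t, w'))).
  by apply: is_derive_vconsS; exact: dG.
apply: (ih Gt) => // i x cx.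
rewrite /partial (@derive_val _ _ _ _ _ _ _ (dGt x i)); apply: GC.
exact: unit_cube_vcons.
Qed.

(** Compactness bounds the derivatives on the cube and clamping contracts each coordinate, so the
    extension is Lipschitz on the whole space, as [parseval_ge] requires. *)
Lemma lip1_rc d (G : 'rV[R]_d -> R) :
  (forall i x, derivable G x 'e_i) -> (forall i, continuous (partial i G)) ->
  exists C, lip1 C (rc G).
Proof.
move=> dG cG.
have /choice[C HC] i := cube_bounded (cG i).
exists (\sum_i `|C i|) => x y.
apply: le_trans (lip_cube (C := \sum_i `|C i|) dG _ (clampv_cube x) (clampv_cube y)) _.
  move=> i z cz; rewrite (le_trans (HC i z cz))// (le_trans (ler_norm _))//.
  by rewrite (bigD1 i)//= lerDl sumr_ge0.
apply: ler_wpM2l; first exact: sumr_ge0.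
by apply: ler_sum => i _; rewrite !mxE; exact: clampR_lip.
Qed.

End clamping.

(** * Decay of the Fourier coefficients of periodic functions *)

Section sobolev_bias.
Context (R : realType).

Lemma dotk_line d (k : 'rV[int]_d) (h : R) i (x : 'rV[R]_d) :
  dotk k (h *: 'e_i + x) = (k ord0 i)%:~R * h + dotk k x.
Proof.
rewrite /dotk; under eq_bigr do rewrite !mxE mulrDr; rewrite big_split/=; congr (_ + _).
rewrite (bigD1 i)//= eqxx mulr1 big1 ?addr0// => j /negbTE ->.
by rewrite !mulr0.
Qed.

Lemma is_derive_affine (c c0 x : R) : is_derive x 1 (cst c * id + cst c0 : R -> R) c.
Proof. by apply: is_derive_eq; rewrite scaler0 !addr0 [LHS]mulr1. Qed.

Lemma is_derive_ck d (k : 'rV[int]_d) i (x : 'rV[R]_d) :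
  is_derive x 'e_i (ck k) (- (2 * pi * (k ord0 i)%:~R * sk k x)).
Proof.
rewrite -[x in is_derive x](add0r x) -[X in X + x](scale0r 'e_i).
apply/is_derive_lineP.
have := @is_derive1_comp R cos (cst (2 * pi * (k ord0 i)%:~R) * id + cst (2 * pi * dotk k x))
  0 _ _ (is_derive_cos _) (is_derive_affine _ _ _).
rewrite (_ : (_ \o _) = (fun h => ck k (h *: 'e_i + x))); last first.
  apply/funext => h /=; rewrite /ck dotk_line; congr cos.
  by rewrite !fctE; ring.
by rewrite !fctE mulr0 add0r mulNr (mulrC _ (2 * pi * _)).
Qed.

Lemma is_derive_sk d (k : 'rV[int]_d) i (x : 'rV[R]_d) :
  is_derive x 'e_i (sk k) (2 * pi * (k ord0 i)%:~R * ck k x).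
Proof.
rewrite -[x in is_derive x](add0r x) -[X in X + x](scale0r 'e_i).
apply/is_derive_lineP.
have := @is_derive1_comp R sin (cst (2 * pi * (k ord0 i)%:~R) * id + cst (2 * pi * dotk k x))
  0 _ _ (is_derive_sin _) (is_derive_affine _ _ _).
rewrite (_ : (_ \o _) = (fun h => sk k (h *: 'e_i + x))); last first.
  apply/funext => h /=; rewrite /sk dotk_line; congr sin.
  by rewrite !fctE; ring.
by rewrite !fctE mulr0 add0r (mulrC _ (2 * pi * _)).
Qed.

Lemma continuous_addf (T : topologicalType) (f h : T -> R) :
  continuous f -> continuous h -> continuous (fun x => f x + h x).
Proof. by move=> cf ch x; exact: (continuousD (cf x) (ch x)). Qed.

Lemma continuous_mulf (T : topologicalType) (f h : T -> R) :
  continuous f -> continuous h -> continuous (fun x => f x * h x).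
Proof. by move=> cf ch x; exact: (continuousM (cf x) (ch x)). Qed.

Lemma continuous_oppf (T : topologicalType) (f : T -> R) :
  continuous f -> continuous (fun x => - f x).
Proof. by move=> cf x; exact: (continuousN (cf x)). Qed.

Lemma continuous_dotk d (k : 'rV[int]_d) : continuous (fun x : 'rV[R]_d => 2 * pi * dotk k x).
Proof.
have H (r : seq 'I_d) : continuous (fun x : 'rV[R]_d => \sum_(i <- r) (k ord0 i)%:~R * x ord0 i).
  elim: r => [|i r ih].
    have -> : (fun x : 'rV[R]_d => \sum_(i <- [::]) (k ord0 i)%:~R * x ord0 i) = cst 0.
      by apply/funext => x; rewrite big_nil.
    exact: cst_continuous.
  have -> : (fun x : 'rV[R]_d => \sum_(j <- i :: r) (k ord0 j)%:~R * x ord0 j) =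
      (fun x : 'rV[R]_d => (k ord0 i)%:~R * x ord0 i + \sum_(j <- r) (k ord0 j)%:~R * x ord0 j).
    by apply/funext => x; rewrite big_cons.
  apply: continuous_addf ih.
  exact: (continuous_comp_fun (@coord_continuous R 1 d ord0 i) (@mulrl_continuous R (k ord0 i)%:~R)).
exact: (continuous_comp_fun (H (index_enum _)) (@mulrl_continuous R (2 * pi))).
Qed.

Lemma continuous_ck d (k : 'rV[int]_d) : continuous (ck k : 'rV[R]_d -> R).
Proof. exact: (continuous_comp_fun (@continuous_dotk d k) (@continuous_cos R)). Qed.

Lemma continuous_sk d (k : 'rV[int]_d) : continuous (sk k : 'rV[R]_d -> R).
Proof. exact: (continuous_comp_fun (@continuous_dotk d k) (@continuous_sin R)). Qed.

Lemma dotk_flip d (k : 'rV[int]_d) i (x : 'rV[R]_d) : x ord0 i = 0 ->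
  2 * pi * dotk k (flip_coord i x) = 2 * pi * dotk k x + 2 * pi * (k ord0 i)%:~R.
Proof.
move=> x0; rewrite -mulrDr; congr (_ * _).
rewrite /dotk (bigD1 i)//= [in RHS](bigD1 i)//= x0 mulr0 add0r addrC mxE eqxx x0 subr0 mulr1.
by congr (_ + _); apply: eq_bigr => j /negbTE ji; rewrite mxE ji.
Qed.

Lemma ck_flip d (k : 'rV[int]_d) i (x : 'rV[R]_d) : x ord0 i = 0 ->
  ck k (flip_coord i x) = ck k x.
Proof.
by move=> x0; rewrite /ck dotk_flip// cosD cos_2pi_int sin_2pi_int mulr1 mulr0 subr0.
Qed.

Lemma sk_flip d (k : 'rV[int]_d) i (x : 'rV[R]_d) : x ord0 i = 0 ->
  sk k (flip_coord i x) = sk k x.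
Proof.
by move=> x0; rewrite /sk dotk_flip// sinD cos_2pi_int sin_2pi_int mulr1 mulr0 addr0.
Qed.

(** The product [h * e] inherits the periodicity of its factors, so its derivative has integral
    0. *)
Lemma Rint_partial_by_parts d i (h e e' : 'rV[R]_d -> R) :
  continuous h -> (forall x, derivable h x 'e_i) -> continuous (partial i h) ->
  (forall x, unit_cube x -> x ord0 i = 0 -> h x = h (flip_coord i x)) ->
  continuous e -> continuous e' -> (forall x, is_derive x 'e_i e (e' x)) ->
  (forall x, unit_cube x -> x ord0 i = 0 -> e x = e (flip_coord i x)) ->
  \int[Lam R d]_x (rc (partial i h) x * rc e x) = - \int[Lam R d]_x (rc h x * rc e' x).
Proof.
move=> ch dh cdh ph ce ce' de pe.
have pE : partial i (h * e) = fun x => h x * e' x + e x * partial i h x.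
  apply/funext => x; rewrite /partial deriveM//.
  by rewrite (@derive_val _ _ _ _ _ _ _ (de x)).
have cD : continuous (fun x => h x * e' x + e x * partial i h x).
  by apply: continuous_addf; apply: continuous_mulf.
have := @Rint_partial_periodic R d i (h * e).
rewrite pE => /(_ _ _ cD).
have b1 := bm_rc ch; have b2 := bm_rc cdh; have b3 := bm_rc ce; have b4 := bm_rc ce'.
rewrite (_ : rc (fun x => h x * e' x + e x * partial i h x) =
  fun x => rc h x * rc e' x + rc (partial i h) x * rc e x); last first.
  by apply/funext => x; rewrite /rc [X in _ + X]mulrC.
rewrite RintD; [|exact: bmM|exact: bmM].
move=> H; apply/eqP; rewrite -addr_eq0 addrC; apply/eqP; apply: H.
- exact: (continuous_mulf ch ce).
- by move=> x; apply: derivableM => //; case: (de x).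
- by move=> x cx x0; rewrite /= !fctE -ph// -pe.
Qed.

Lemma cf_partial d i (h : 'rV[R]_d -> R) k :
  continuous h -> (forall x, derivable h x 'e_i) -> continuous (partial i h) ->
  (forall x, unit_cube x -> x ord0 i = 0 -> h x = h (flip_coord i x)) ->
  sqmod (cf (rc (partial i h)) k) = (2 * pi * (k ord0 i)%:~R) ^+ 2 * sqmod (cf (rc h) k).
Proof.
move=> ch dh cdh ph; set c := 2 * pi * _.
have rcI (F G : 'rV[R]_d -> R) : continuous F -> continuous G ->
    bm (G : bRV R d -> R) ->
    \int[Lam R d]_x (rc F x * G x) = \int[Lam R d]_x (rc F x * rc G x).
  move=> cF cG bG; apply: eq_Rint_Lam; [exact: bmM (bm_rc cF) bG|exact: bmM (bm_rc cF) (bm_rc cG)|].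
  by move=> x cx; rewrite (rc_cube G cx).
have cck := @continuous_ck d k; have csk := @continuous_sk d k.
have bc := @bm_ck R d k; have bs := @bm_sk R d k.
have bh := bm_rc ch; have bdh := bm_rc cdh.
have ccs : continuous (fun x : 'rV[R]_d => - (c * sk k x)).
  exact: continuous_oppf (continuous_comp_fun csk (@mulrl_continuous R c)).
have ccc : continuous (fun x : 'rV[R]_d => c * ck k x).
  exact: (continuous_comp_fun cck (@mulrl_continuous R c)).
have fc (x : 'rV[R]_d) : unit_cube x -> x ord0 i = 0 -> ck k x = ck k (flip_coord i x).
  by move=> _ x0; rewrite ck_flip.
have fs (x : 'rV[R]_d) : unit_cube x -> x ord0 i = 0 -> sk k x = sk k (flip_coord i x).
  by move=> _ x0; rewrite sk_flip.
have E1 : \int[Lam R d]_x (rc (partial i h) x * ck k x) = c * \int[Lam R d]_x (rc h x * sk k x).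
  rewrite rcI// (Rint_partial_by_parts ch dh cdh ph cck ccs (is_derive_ck k i) fc).
  rewrite -RintZ; last exact: bmM.
  rewrite -[LHS]mulN1r -RintZ; last by apply: bmM => //; exact: bm_rc.
  apply: eq_Rint_Lam; [by apply: bmZ; apply: bmM => //; exact: bm_rc|by apply: bmZ; exact: bmM|].
  by move=> x cx; rewrite (rc_cube (fun x => - (c * sk k x)) cx); ring.
have E2 : \int[Lam R d]_x (rc (partial i h) x * sk k x) = - (c * \int[Lam R d]_x (rc h x * ck k x)).
  rewrite rcI// (Rint_partial_by_parts ch dh cdh ph csk ccc (is_derive_sk k i) fs).
  congr (- _); rewrite -RintZ; last exact: bmM.
  apply: eq_Rint_Lam; [by apply: bmM => //; exact: bm_rc|by apply: bmZ; exact: bmM|].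
  by move=> x cx; rewrite (rc_cube (fun x => c * ck k x) cx); ring.
by rewrite /cf !coef_real// /sqmod /= E1 E2; ring.
Qed.

Lemma flatten_pure (I : eqType) (s : seq I) (i : I) (b : nat) : uniq s -> i \in s ->
  flatten [seq nseq (if j == i then b else 0%N) j | j <- s] = nseq b i.
Proof.
elim: s => // j s ih /= /andP[js us]; rewrite inE => /orP[/eqP ij|is_].
  subst j; rewrite eqxx (_ : flatten _ = [::]) ?cats0//.
  elim: s js {ih us} => // l s ih; rewrite inE negb_or => /andP[il js] /=.
  by rewrite eq_sym (negbTE il) ih.
by rewrite ih//; case: eqP => // ji; move: js; rewrite ji is_.
Qed.

(** The multi-index [b e_i]. Among the derivatives of order [beta] only these enter the bias, so no
    multinomial coefficient appears. *)
Definition pure d (i : 'I_d) (b : nat) (j : 'I_d) : nat := if j == i then b else 0%N.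

Lemma dalpha_pure d (i : 'I_d) b (g : 'rV[R]_d -> R) :
  dalpha (pure i b) g = Dseq (nseq b i) g.
Proof. by rewrite /dalpha /pure flatten_pure ?enum_uniq ?mem_enum. Qed.

Lemma sum_pure d (i : 'I_d) b : (\sum_(j < d) pure i b j)%N = b.
Proof.
rewrite (bigD1 i)//= [X in (_ + X)%N]big1 ?addn0; first by rewrite /pure eqxx.
by move=> j /negbTE ji; rewrite /pure ji.
Qed.

Lemma cube_int_ge0 d (h : 'rV[R]_d -> R) : (forall x, 0 <= h x) -> 0 <= cube_int h.
Proof.
elim: d h => [|d ih] h h0 /=; first exact: h0.
by apply: Rintegral_ge0 => t _; exact: ih.
Qed.

Variables (d beta : nat) (L : R) (g : 'rV[R]_d -> R).
Hypothesis beta1 : (1 <= beta)%N.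
Hypothesis cg : Cbeta beta g.
Hypothesis gL : \sum_(a : {ffun 'I_d -> 'I_beta.+1} | (\sum_(i < d) (a i : nat) == beta)%N)
  cube_int (fun x => (dalpha (fun i => a i : nat) g x) ^+ 2) <= L ^+ 2.
Hypothesis pg : forall a : 'I_d -> nat, (\sum_(i < d) a i < beta)%N ->
  forall x i, unit_cube x -> (x ord0 i = 0 \/ x ord0 i = 1) ->
  dalpha a g x = dalpha a g (flip_coord i x).

Lemma Dseq_continuous i m : (m <= beta)%N -> continuous (Dseq (nseq m i) g).
Proof. by move=> mb; have [] := cg (s := nseq m i); rewrite ?size_nseq. Qed.

(** Each integration by parts uses periodicity of the function before differentiation, hence of
    orders below [beta]; of the derivative of order [beta] only continuity is asked. *)
Lemma cf_Dseq i m k : (m <= beta)%N ->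
  sqmod (cf (rc (Dseq (nseq m i) g)) k) =
  (2 * pi * (k ord0 i)%:~R) ^+ (2 * m) * sqmod (cf (rc g) k).
Proof.
elim: m => [|m ih] mb; first by rewrite muln0 expr0 mul1r.
rewrite /= -/(Dseq (nseq m i) g) cf_partial.
- by rewrite ih 1?ltnW// mulrA -exprD; congr (_ ^+ _ * _); lia.
- by apply: Dseq_continuous; exact: ltnW.
- have sm : (size (nseq m i) <= beta)%N by rewrite size_nseq ltnW.
  by have [_ H] := cg sm; move=> x; apply: H; rewrite size_nseq.
- exact: (@Dseq_continuous i m.+1 mb).
- move=> x cx x0; rewrite -dalpha_pure; apply: pg => //; last by left.
  by rewrite sum_pure.
Qed.

(** The pure multi-indices are distinct, because [1 <= beta], and the other terms of the seminorm
    are nonnegative. *)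
Lemma sum_pure_derivatives :
  \sum_(i < d) \int[Lam R d]_x (rc (Dseq (nseq beta i) g) x ^+ 2) <= L ^+ 2.
Proof.
apply: le_trans gL.
have cI (s : seq 'I_d) : (size s <= beta)%N ->
    cube_int (fun x => Dseq s g x ^+ 2) = \int[Lam R d]_x (rc (Dseq s g) x ^+ 2).
  move=> sb; have [cs _] := cg sb.
  rewrite -cube_intE; last by apply: bmX; exact: bm_rc.
  by apply: eq_cube_int => x cx; rewrite rc_cube.
pose a_ (i : 'I_d) : {ffun 'I_d -> 'I_beta.+1} := [ffun j => inord (pure i beta j)].
have aE i : (fun j => a_ i j : nat) = pure i beta.
  apply/funext => j; rewrite ffunE inordK// /pure; case: ifP => _; lia.
pose F (a : {ffun 'I_d -> 'I_beta.+1}) := cube_int (fun x => (dalpha (fun i => a i : nat) g x) ^+ 2).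
have -> : \sum_(i < d) \int[Lam R d]_x (rc (Dseq (nseq beta i) g) x ^+ 2) =
    \sum_(a <- [seq a_ i | i <- enum 'I_d]) F a.
  rewrite big_map big_enum /=; apply: eq_bigr => i _.
  by rewrite /F aE dalpha_pure cI// size_nseq.
rewrite -[leRHS]big_filter; apply: (@ler_sum_uniq R _ _ _ F).
- rewrite map_inj_uniq ?enum_uniq// => i j ij.
  have : pure i beta i = pure j beta i by rewrite -!aE ij.
  by rewrite /pure eqxx; case: eqP => // _; lia.
- by apply: filter_uniq; exact: index_enum_uniq.
- move=> _ /mapP[i _ ->]; rewrite mem_filter mem_index_enum andbT.
  apply/eqP; rewrite -[RHS](sum_pure i beta); apply: eq_bigr => j _.
  by rewrite -aE.
- by move=> a; apply: cube_int_ge0 => x; exact: sqr_ge0.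
Qed.

(** A frequency outside the cube has a coordinate of absolute value at least [M + 1], and the pure
    derivative in that direction pays the factor [(2 pi (M + 1))^(2 beta)]. Summing over all
    directions and applying Bessel's inequality in each costs no constant depending on [d]. *)
Lemma sum_tail_bias M N :
  \sum_(k <- KS N d | k \notin KS M d) sqmod (cf (rc g) k) <=
  L ^+ 2 / (2 * pi * M.+1%:R) ^+ (2 * beta).
Proof.
set q := (2 * pi * M.+1%:R : R).
have q0 : 0 < q ^+ (2 * beta) by rewrite exprn_gt0// mulr_gt0// mulr_gt0// pi_gt0.
rewrite ler_pdivlMr//; apply: le_trans sum_pure_derivatives.
apply: (@le_trans _ _ (\sum_(i < d) \sum_(k <- KS N d) sqmod (cf (rc (Dseq (nseq beta i) g)) k))).
  rewrite exchange_big/= mulr_suml [leRHS](bigID (fun k => k \notin KS M d))/=.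
  rewrite -[leLHS]addr0; apply: lerD; last first.
    by apply: sumr_ge0 => k _; apply: sumr_ge0 => i _; exact: sqmod_ge0.
  apply: ler_sum => k; rewrite mem_KS => /forallPn[ i ]; rewrite -ltnNge => Mk.
  rewrite (bigD1 i)//= -[leLHS]addr0; apply: lerD; last first.
    by apply: sumr_ge0 => j _; exact: sqmod_ge0.
  rewrite cf_Dseq// mulrC ler_wpM2r ?sqmod_ge0//.
  rewrite !exprM lerXn2r ?nnegrE ?sqr_ge0//.
  rewrite /q !exprMn ler_wpM2l ?mulr_ge0 ?sqr_ge0 ?pi_ge0//.
  rewrite -[leRHS]real_normK ?num_real// lerXn2r ?nnegrE//.
  by rewrite -intr_norm (_ : M.+1%:R = (M.+1%:Z)%:~R)// ler_int; lia.
apply: ler_sum => i _.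
have ci : continuous (Dseq (nseq beta i) g) by exact: Dseq_continuous.
apply: le_trans (bessel (cbm_real (bm_rc ci)) (KS_uniq N d)) _.
rewrite le_eqVlt; apply/orP; left; apply/eqP.
by apply: eq_Rintegral => x _; rewrite /sqmod /= expr0n/= addr0.
Qed.

(** Since [1 <= beta], [g] has continuous first derivatives, so its extension is Lipschitz and
    Parseval's equality holds for [g] itself. The tail bound is uniform in [N], which lets [e] tend
    to 0. *)
Lemma fourier_bias M :
  \int[Lam R d]_x (rc g x ^+ 2) - \sum_(k <- KS M d) sqmod (cf (rc g) k) <=
  L ^+ 2 / (2 * pi * M.+1%:R) ^+ (2 * beta).
Proof.
have c0 : continuous g by have [] := cg (s := [::]) isT.
have dg i x : derivable g x 'e_i by have [_] := cg (s := [::]) isT; apply.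
have cdg i : continuous (partial i g) by exact: (@Dseq_continuous i 1 beta1).
have [C lC] := lip1_rc dg cdg.
apply/ler_addgt0Pr => e e0; have [N HN] := parseval_ge (bm_rc c0) lC e0.
rewrite lerBlDr (le_trans HN)// -addrA (addrC e) addrA lerD2r.
rewrite (bigID (fun k => k \notin KS M d))/=; apply: lerD; first exact: sum_tail_bias.
rewrite -big_filter; apply: ler_sum_uniq.
- by apply: filter_uniq; exact: KS_uniq.
- exact: KS_uniq.
- by move=> k; rewrite mem_filter negbK => /andP[].
- by move=> k; exact: sqmod_ge0.
Qed.

End sobolev_bias.

(** * Empirical coefficients and Gaussian noise *)

Section empirical_coefficients.
Context (R : realType) dT (T : measurableType dT) (P : probability T R).
Context dS (S : measurableType dS) (lam : probability S R).
Variables (n : nat) (X : 'I_n -> T -> S) (f : S -> R) (b : R).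
Hypothesis mX : forall j, measurable_fun [set: T] (X j).
Hypothesis indX : indep_family P X.
Hypotheses (bf : bm f) (f0 : forall s, 0 <= f s) (fb : forall s, f s <= b).
Hypothesis f1 : \int[lam]_s f s = 1.
Hypothesis lawX : forall j h, bm h -> \int[P]_t h (X j t) = \int[lam]_s (h s * f s).
Variables (A : finType) (e : A -> S -> R) (Q : R).
Hypothesis be : forall a, bm (e a).
Hypothesis besselA : forall h, bm h ->
  \sum_a (\int[lam]_s (h s * e a s)) ^+ 2 <= \int[lam]_s (h s ^+ 2).

Definition centered a s : R := e a s - \int[lam]_s (e a s * f s).

Hypothesis uQ : forall s, \sum_a centered a s ^+ 2 <= Q.
Local Notation u := centered.

Let bu a : bm (u a).
Proof. by apply: bmB => //; exact: bm_cst. Qed.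

Let bX j (h : S -> R) : bm h -> bm (fun t => h (X j t)).
Proof. by move=> bh; exact: (bm_comp (mX j) bh). Qed.

Lemma centered_mean a : \int[lam]_s (u a s * f s) = 0.
Proof.
under eq_Rintegral do rewrite mulrBl.
rewrite RintB; [|exact: bmM|by apply: bmZ].
by rewrite RintZ// f1 mulr1 subrr.
Qed.

(** The covariance matrix of the system [e] under the density [f]. *)
Definition gram a c := \int[lam]_s (u a s * u c s * f s).

Lemma prod_if (I : finType) (j : I) (F : I -> R) :
  \prod_i (if i == j then F i else 1) = F j.
Proof. by rewrite -big_mkcond big_pred1_eq. Qed.

(* a factor whose index occurs only once among j, l, j', l' integrates to 0 *)
Lemma fourth_moment a c j l j' l' : j != l -> j' != l' ->
  \int[P]_t (u a (X j t) * u a (X l t) * (u c (X j' t) * u c (X l' t))) =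
  if ((j', l') == (j, l)) || ((j', l') == (l, j)) then gram a c ^+ 2 else 0.
Proof.
move=> jl jl'.
pose h i s := (if i == j then u a s else 1) * (if i == l then u a s else 1) *
  ((if i == j' then u c s else 1) * (if i == l' then u c s else 1)).
have bif (k : bool) g : bm g -> bm (fun s : S => if k then g s else 1).
  by move=> bg; case: k => //; exact: bm_cst.
have bh i : bm (h i) by apply: bmM; apply: bmM; apply: bif.
under eq_Rintegral => t _.
  rewrite (_ : _ * _ = \prod_i h i (X i t)); last first.
    by rewrite !big_split/= !(prod_if _ (fun i => u _ (X i t))).
  over.
rewrite (indep_prod mX indX bh).
have hE i : \int[P]_t h i (X i t) = \int[lam]_s (h i s * f s) by exact: lawX.
have zero i v : (forall s, h i s = u v s) -> \prod_i \int[P]_t h i (X i t) = 0.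
  move=> hv; rewrite (bigD1 i)//= hE; under eq_Rintegral do rewrite hv.
  by rewrite centered_mean mul0r.
have two i k : i != k -> (forall s, h i s = u a s * u c s) ->
    (forall s, h k s = u a s * u c s) ->
    (forall m, m != i -> m != k -> forall s, h m s = 1) ->
    \prod_i \int[P]_t h i (X i t) = gram a c ^+ 2.
  move=> ik hi hk h1; rewrite (bigD1 i)//= (bigD1 k) 1?eq_sym//= big1.
    by rewrite !hE mulr1 expr2; congr (_ * _); apply: eq_Rintegral => s _; rewrite ?hi ?hk.
  by move=> m /andP[mi mk]; under eq_Rintegral do rewrite h1//; rewrite Rint_cst.
rewrite !xpair_eqE.
have [jj'|jj'] := eqVneq j' j; have [ll'|ll'] := eqVneq l' l => /=.
- subst j' l'; apply: (two j l) => //.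
  + by move=> s; rewrite /h eqxx (negbTE jl) !mulr1.
  + by move=> s; rewrite /h eqxx eq_sym (negbTE jl) !mul1r.
  + by move=> m /negbTE mi /negbTE mk s; rewrite /h mi mk !mulr1.
- subst j'; rewrite (negbTE jl)/=; apply: (zero l a) => s.
  by rewrite /h eqxx (eq_sym l j) (negbTE jl) (eq_sym l l') (negbTE ll') mul1r !mulr1.
- subst l'; rewrite (eq_sym l j) (negbTE jl) andbF; apply: (zero j a) => s.
  by rewrite /h eqxx (negbTE jl) (eq_sym j j') (negbTE jj') !mulr1.
- have [jl1|jl1] := eqVneq j' l; have [lj1|lj1] := eqVneq l' j => /=.
  + subst j' l'; apply: (two j l) => //.
    * by move=> s; rewrite /h eqxx (negbTE jl) mulr1 mul1r.
    * by move=> s; rewrite /h eqxx eq_sym (negbTE jl) mulr1 mul1r.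
    * by move=> m /negbTE mi /negbTE mk s; rewrite /h mi mk !mulr1.
  + apply: (zero j a) => s.
    by rewrite /h eqxx (negbTE jl) (eq_sym j j') (negbTE jj') (eq_sym j l') (negbTE lj1) !mulr1.
  + apply: (zero l a) => s.
    by rewrite /h eqxx (eq_sym l j) (negbTE jl) (eq_sym l j') (negbTE jl1) (eq_sym l l') (negbTE ll') !mulr1 mul1r.
  + apply: (zero j a) => s.
    by rewrite /h eqxx (negbTE jl) (eq_sym j j') (negbTE jj') (eq_sym j l') (negbTE lj1) !mulr1.
Qed.

(** Since [u a] has mean zero, the centring of [u c] drops out and [gram a c] is the integral of
    [u a * f] against [e c]. Bessel's inequality in [c] then gives a bound linear in [Q], where
    Cauchy--Schwarz would give [Q^2]. *)
Lemma sum_gram : 0 <= b -> \sum_a \sum_c gram a c ^+ 2 <= b * Q.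
Proof.
move=> b0; apply: (@le_trans _ _ (\sum_a b * \int[lam]_s (u a s ^+ 2 * f s))).
  apply: ler_sum => a _.
  have gE c : gram a c = \int[lam]_s ((u a s * f s) * e c s).
    rewrite /gram; under eq_Rintegral => s _.
      rewrite (_ : _ * _ = u a s * f s * e c s - \int[lam]_s (e c s * f s) * (u a s * f s)); last first.
        by rewrite /u; ring.
      over.
    rewrite RintB; [|by do !apply: bmM|by apply: bmZ; apply: bmM].
    by rewrite RintZ ?centered_mean ?mulr0 ?subr0//; exact: bmM.
  under eq_bigr do rewrite gE.
  apply: le_trans (besselA (bmM (bu a) bf)) _.
  rewrite -RintZ; last by apply: bmM => //; exact: bmX.
  apply: le_Rint; [by apply: bmX; exact: bmM|by apply: bmZ; apply: bmM => //; exact: bmX|].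
  move=> s; rewrite (_ : (u a s * f s) ^+ 2 = u a s ^+ 2 * (f s * f s)); last by ring.
  by rewrite (_ : b * _ = u a s ^+ 2 * (b * f s)) ?ler_wpM2l ?sqr_ge0 ?ler_wpM2r//; ring.
rewrite -mulr_sumr ler_wpM2l// -Rint_sum; last by move=> a _; apply: bmM => //; exact: bmX.
rewrite -[leRHS]mulr1 -f1 -RintZ//; apply: le_Rint.
- by apply: bm_sum => a _; apply: bmM => //; exact: bmX.
- exact: bmZ.
- by move=> s; rewrite -mulr_suml ler_wpM2r.
Qed.

(** The off-diagonal part of the squared norm of the sum of the centred vectors. It is a degenerate
    U-statistic: fixing one of the two observations leaves mean zero. *)
Definition ustat t : R :=
  \sum_(p : 'I_n * 'I_n | p.1 != p.2) \sum_a u a (X p.1 t) * u a (X p.2 t).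

Lemma bm_ustat : bm ustat.
Proof. by apply: bm_sum => p _; apply: bm_sum => a _; apply: bmM; exact: bX. Qed.

(** By [fourth_moment] a pair of indices is correlated only with itself and its transpose, so each
    of the at most [n^2] pairs contributes at most twice the sum of the squared covariances. *)
Lemma ustat_second_moment : 0 <= b -> \int[P]_t ustat t ^+ 2 <= 2 * n%:R ^+ 2 * (b * Q).
Proof.
move=> b0; pose G := \sum_a \sum_c gram a c ^+ 2.
have G0 : 0 <= G by apply: sumr_ge0 => a _; apply: sumr_ge0 => c _; exact: sqr_ge0.
pose w (p q : 'I_n * 'I_n) a c t :=
  u a (X p.1 t) * u a (X p.2 t) * (u c (X q.1 t) * u c (X q.2 t)).
have bw p q a c : bm (w p q a c) by apply: bmM; apply: bmM; exact: bX.
have E t : ustat t ^+ 2 = \sum_(p : 'I_n * 'I_n | p.1 != p.2)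
    \sum_(q : 'I_n * 'I_n | q.1 != q.2) \sum_a \sum_c w p q a c t.
  rewrite expr2 mulr_suml; apply: eq_bigr => p _.
  rewrite mulr_sumr; apply: eq_bigr => q _.
  rewrite mulr_suml; apply: eq_bigr => a _.
  by rewrite mulr_sumr; apply: eq_bigr.
under eq_Rintegral do rewrite E.
rewrite Rint_sum; last by move=> p _; do 3!(apply: bm_sum => ? _).
apply: (@le_trans _ _ (\sum_(p : 'I_n * 'I_n | p.1 != p.2) (G + G))); last first.
  rewrite sumr_const -[leLHS]mulr_natl.
  apply: (@le_trans _ _ (n%:R ^+ 2 * (2 * (b * Q)))); last by rewrite mulrCA mulrA mulrA.
  apply: ler_pM => //; first exact: addr_ge0.
    rewrite -natrX ler_nat (leq_trans (max_card _))// card_prod card_ord.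
    by rewrite expnS expn1.
  by have := sum_gram b0; rewrite -/G; lra.
apply: ler_sum => -[j l] /= jl.
rewrite Rint_sum; last by move=> q _; do 2!(apply: bm_sum => ? _).
apply: (@le_trans _ _ (\sum_(q : 'I_n * 'I_n) ((if q == (j, l) then G else 0) +
    (if q == (l, j) then G else 0)))); last first.
  by rewrite big_split/= -!big_mkcond !big_pred1_eq.
rewrite big_mkcond; apply: ler_sum => -[j' l'] _ /=.
case: ifPn => [jl'|_]; last by rewrite addr_ge0//; case: ifP.
rewrite Rint_sum; last by move=> a _; apply: bm_sum => ? _.
under eq_bigr => a _.
  rewrite Rint_sum//; under eq_bigr do rewrite (fourth_moment _ _ jl jl').
  over.
case: (boolP (_ || _)) => [/orP[->|->]|_].
- by rewrite -/G lerDl; case: ifP.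
- by rewrite -/G lerDr; case: ifP.
- rewrite big1 => [|a _]; last by rewrite big1.
  by rewrite addr_ge0//; case: ifP.
Qed.

Lemma sum_sqr_mean t : (0 < n)%N ->
  \sum_a (n%:R^-1 * \sum_j u a (X j t)) ^+ 2 <= Q / n%:R + ustat t / n%:R ^+ 2.
Proof.
move=> n0; have nR : 0 < n%:R :> R by rewrite ltr0n.
have E : \sum_a (n%:R^-1 * \sum_j u a (X j t)) ^+ 2 =
    (\sum_j \sum_a u a (X j t) ^+ 2 + ustat t) / n%:R ^+ 2.
  under eq_bigr do rewrite exprMn; rewrite -mulr_sumr mulrC exprVn; congr (_ / _).
  rewrite /ustat exchange_big/= [X in _ + X]exchange_big/= -big_split/=.
  apply: eq_bigr => a _; rewrite expr2 big_distrlr/=.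
  rewrite pair_bigA/= (bigID (fun p => p.1 == p.2))/=; congr (_ + _).
  rewrite -(pair_big_dep xpredT (fun j l => j == l) (fun j l => u a (X j t) * u a (X l t)))/=.
  by apply: eq_bigr => j _; under eq_bigl do rewrite eq_sym; rewrite big_pred1_eq.
rewrite E mulrDl lerD2r ler_pdivrMr ?exprn_gt0//.
rewrite (_ : _ * n%:R ^+ 2 = n%:R * Q); last by field; rewrite gt_eqF.
apply: (le_trans (ler_sum _ (fun j _ => uQ (X j t)))).
by rewrite sumr_const card_ord mulr_natl.
Qed.

(** From [(U - 10 Q n)^2 >= 0] follows [U - 5 Q n <= U^2 / (20 Q n)], which turns the positive part
    into a second moment. In the mean [Q] cancels, leaving [b / (10 n)] whatever the number of
    coefficients. *)
Lemma empirical_deviation : (0 < n)%N -> 0 < Q -> 0 <= b ->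
  \int[P]_t Num.max 0 (\sum_a (n%:R^-1 * \sum_j u a (X j t)) ^+ 2 - 6 * Q / n%:R) <=
  b / (10 * n%:R).
Proof.
move=> n0 Q0 b0; have nR : 0 < n%:R :> R by rewrite ltr0n.
apply: (@le_trans _ _ ((20 * Q * n%:R ^+ 3)^-1 * \int[P]_t ustat t ^+ 2)).
  rewrite -RintZ; last by apply: bmX; exact: bm_ustat.
  apply: le_Rint.
  - apply: bm_max; first exact: bm_cst.
    apply: bmB; last exact: bm_cst.
    by apply: bm_sum => a _; apply: bmX; apply: bmZ; apply: bm_sum => j _; exact: bX.
  - by apply: bmZ; apply: bmX; exact: bm_ustat.
  move=> t; rewrite ge_max; apply/andP; split.
    by rewrite mulr_ge0 ?sqr_ge0// invr_ge0 !mulr_ge0 ?exprn_ge0 ?(ltW Q0)// ltW.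
  rewrite lerBlDr; apply: le_trans (sum_sqr_mean t n0) _.
  rewrite -subr_ge0.
  have -> : (20 * Q * n%:R ^+ 3)^-1 * ustat t ^+ 2 + 6 * Q / n%:R -
     (Q / n%:R + ustat t / n%:R ^+ 2) =
     (20 * Q * n%:R ^+ 3)^-1 * (ustat t - 10 * Q * n%:R) ^+ 2.
    by field; rewrite !gt_eqF//.
  by rewrite mulr_ge0 ?sqr_ge0// invr_ge0 !mulr_ge0 ?exprn_ge0 ?(ltW Q0)// ltW.
apply: (@le_trans _ _ ((20 * Q * n%:R ^+ 3)^-1 * (2 * n%:R ^+ 2 * (b * Q)))).
  apply: ler_wpM2l; last exact: ustat_second_moment.
  by rewrite invr_ge0 !mulr_ge0 ?exprn_ge0 ?(ltW Q0)// ltW.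
rewrite le_eqVlt; apply/orP; left; apply/eqP.
by field; rewrite !gt_eqF.
Qed.

End empirical_coefficients.

Section gaussian_noise.
Context (R : realType) dT (T : measurableType dT) (P : probability T R).
Variables (J : finType) (Z : J -> T -> measurableTypeR R) (D : nat).
Hypothesis mZ : forall j, measurable_fun [set: T] (Z j).
Hypothesis indZ : indep_family P Z.
Hypothesis lawZ : forall j A, measurable A -> P (Z j @^-1` A) = N01 R A.

Lemma ge0_integral_lawZ j (h : measurableTypeR R -> \bar R) :
  measurable_fun [set: measurableTypeR R] h -> (forall x, 0 <= h x)%E ->
  (\int[P]_t h (Z j t) = \int[N01 R]_x h x)%E.
Proof.
move=> mh h0; rewrite -(ge0_integral_law P (mZ j))//.
by apply: eq_measure_integral => A mA _; exact: lawZ.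
Qed.

(** [expR (3 / 20) >= 1.15] and [1.15^10 > 4]. In the Chernoff bound it gives
    [2 * expR (- 3 / 2) <= 1 / 2], where 2 is the contribution of the two Gaussian coordinates of
    one frequency. *)
Lemma expR_3_2 : 4 <= expR (3 / 2) :> R.
Proof.
have -> : 3 / 2 = 3 / 20 * 10%:R :> R by field.
rewrite expRM_natr; apply: (@le_trans _ _ ((1 + 3 / 20) ^+ 10)); first by lra.
by rewrite lerXn2r ?nnegrE ?expR_ge0 ?expR_ge1Dx//; lra.
Qed.

Lemma measurable_sumZ2 : measurable_fun [set: T] (fun t => \sum_j (Z j t : R) ^+ 2).
Proof. by apply: measurable_sum => j; apply: measurable_funX; exact: mZ. Qed.

Hypothesis cardJ : #|J| = (2 * D)%N.

(* Chernoff: y_+ <= 4 expR (y / 4) and E expR (Z^2 / 4) = sqrt 2 *)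
Lemma chi_square_deviation :
  (\int[P]_t (Num.max 0 (\sum_j (Z j t : R) ^+ 2 - 6 * D%:R))%:E <=
   (4 * 2^-1 ^+ D)%:E)%E.
Proof.
have m4 : measurable_fun [set: measurableTypeR R]
    (fun x : measurableTypeR R => expR ((x : R) ^+ 2 / 4)).
  by apply: measurableT_comp => //; apply: measurable_funM => //; exact: measurable_funX.
have cE j : (\int[P]_t (expR ((Z j t : R) ^+ 2 / 4))%:E = (Num.sqrt 2)%:E)%E.
  rewrite -integral_N01_expR_sq.
  apply: (@ge0_integral_lawZ j (fun x => (expR ((x : R) ^+ 2 / 4))%:E)).
    exact/measurable_EFinP.
  by move=> x; rewrite lee_fin expR_ge0.
have prodE := indep_prod_ge0 mZ indZ (fun=> m4) (fun _ _ => expR_ge0 _) cE.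
set c := 4 * expR (- (3 / 2) * D%:R) : R.
have c0 : 0 <= c by rewrite mulr_ge0// expR_ge0.
have mprod : measurable_fun [set: T] (fun t => \prod_j expR ((Z j t : R) ^+ 2 / 4)).
  apply: measurable_prod => j _.
  exact: (measurableT_comp m4 (mZ j)).
apply: (@le_trans _ _ (\int[P]_t (c%:E * (\prod_j expR ((Z j t : R) ^+ 2 / 4))%:E))%E).
  apply: ge0_le_integral => //.
  - by move=> t _; rewrite lee_fin le_max lexx.
  - apply/measurable_EFinP; apply: measurable_maxr => //.
    by apply: measurable_funB => //; exact: measurable_sumZ2.
  - by apply: measurable_funeM; exact/measurable_EFinP.
  move=> t _; rewrite -EFinM lee_fin -expR_sum /c -mulrA -expRD.
  set y := \sum_j _; set z := \sum_j _.
  have -> : z = y / 4 by rewrite /z -mulr_suml.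
  have -> : - (3 / 2) * D%:R + y / 4 = (y - 6 * D%:R) / 4 by field.
  rewrite ge_max mulr_ge0 ?expR_ge0//=.
  have := expR_ge1Dx ((y - 6 * D%:R) / 4); lra.
rewrite ge0_integralZl//; last 2 first.
- exact/measurable_EFinP.
- by move=> t _; rewrite lee_fin prodr_ge0// => j _; exact: expR_ge0.
rewrite prodE -EFinM lee_fin prodr_const cardJ exprM sqr_sqrtr// /c -mulrA ler_wpM2l//.
rewrite mulNr expRN expRM_natr -exprVn -exprMn lerXn2r ?nnegrE//.
by rewrite mulrC ler_pdivrMr ?expR_gt0//; have := expR_3_2; lra.
Qed.

End gaussian_noise.

(** * From the statistical model to the abstract deviation bounds *)

Section cube_density_model.
Context (R : realType) (d : nat).

Lemma eq_cube_eint m (f g : 'rV[R]_m -> \bar R) :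
  (forall x, unit_cube x -> f x = g x) -> cube_eint f = cube_eint g.
Proof.
elim: m f g => [|m ih] f g fg /=; first by apply: fg => -[].
apply: eq_integral => t /[!inE]/=; rewrite in_itv/= => t01.
by apply: ih => v v01; apply: fg; exact: unit_cube_row_mx.
Qed.

Variables (f g : 'rV[R]_d -> R).
Hypothesis cg : continuous g.
Hypothesis gf : forall x, unit_cube x -> g x = f x.
Hypothesis df : cube_density f.

Lemma rc_density_ge0 x : 0 <= rc g x.
Proof. by rewrite /rc gf; [apply: df.1|]; exact: clampv_cube. Qed.

(** The supremum is genuine: on the cube [f] coincides with a continuous function, so the set of its
    values is bounded. *)
Lemma rc_density_le x : rc g x <= sup_norm f.
Proof.
have [C gC] := cube_bounded cg.
have fC : ubound [set `|f x| | x in @unit_cube R d] C.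
  by move=> _ [y cy <-]; rewrite -gf//; exact: gC.
rewrite /rc gf; last exact: clampv_cube.
apply: (le_trans (ler_norm _)); apply: (@ub_le_sup _ [set `|f x| | x in @unit_cube R d]).
  by exists C.
by exists (clampv x : 'rV[R]_d) => //; exact: clampv_cube.
Qed.

Lemma sup_norm_ge0 : 0 <= sup_norm f.
Proof. exact: le_trans (rc_density_ge0 0) (rc_density_le 0). Qed.

Lemma cube_eint_density B : borel_rV B ->
  (cube_eint (fun y => (\1_B y)%:E * (f y)%:E) =
   \int[Lam R d]_y ((\1_B y)%:E * (rc g y)%:E))%E.
Proof.
move=> mB; have mB' : measurable (B : set (bRV R d)) by [].
rewrite (@eq_cube_eint _ _ (fun y => (\1_B y)%:E * (rc g y)%:E)%E); last first.
  by move=> x cx; rewrite rc_cube// gf.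
apply: cube_eintE.
  apply: emeasurable_funM; apply/measurable_EFinP.
    exact: (bm_indic R mB').1.
  by case: (bm_rc cg).
by move=> x; rewrite mule_ge0// lee_fin ?rc_density_ge0// indicE; case: (_ \in _).
Qed.

Lemma Rint_rc_density : \int[Lam R d]_y rc g y = 1.
Proof.
have := @cube_eint_density setT (@measurableT _ (bRV R d)).
rewrite (_ : cube_eint _ = 1%E); last first.
  by rewrite -df.2; apply: eq_cube_eint => x _; rewrite indicE in_setT mul1e.
under eq_integral do rewrite indicE in_setT mul1e.
by rewrite EFin_Rint; [move=> -[]|exact: bm_rc].
Qed.

Context dT (T : measurableType dT) (P : probability T R) (n : nat) (I : finType).
Variables (X : 'I_n -> T -> 'rV[R]_d) (Z : (I * bool)%type -> T -> R).
Hypothesis sm : sample_model P f X Z.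

Lemma sample_measurable j : measurable_fun [set: T] (X j : T -> bRV R d).
Proof. by case: sm => mX _ _ _ _ _ B mB; rewrite setTI; exact: mX. Qed.

(** Taking the whole line for every noise event reduces the joint product rule to the
    observations. *)
Lemma sample_indep : @indep_family R _ _ P _ (bRV R d) _ X.
Proof.
case: sm => _ _ _ _ ind B mB; have := ind B (fun=> setT) mB (fun=> measurableT).
rewrite [X in _ `&` X](_ : _ = setT); last first.
  by apply/seteqP; split => // t _ i _.
rewrite setIT => ->; rewrite [X in (_ * X)%E]big1 ?mule1// => i _.
by rewrite preimage_setT probability_setT.
Qed.

Lemma sample_law j (h : bRV R d -> R) : bm h ->
  \int[P]_t h (X j t) = \int[Lam R d]_s (h s * rc g s).
Proof.
move=> bh; rewrite -(Rint_law P (sample_measurable j) bh).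
apply: (Rint_change_of_density (Y := idfun)) => //.
- exact: measurable_id.
- exact: bm_rc.
- exact: rc_density_ge0.
- move=> A mA; rewrite -cube_eint_density//.
  by case: sm => _ _ lawX _ _; rewrite -(lawX j).
Qed.

Lemma noise_measurable i : measurable_fun [set: T] (Z i : T -> measurableTypeR R).
Proof. by case: sm => _ mZ _ _ _; exact: mZ. Qed.

Lemma noise_indep : @indep_family R _ _ P _ (measurableTypeR R) _ Z.
Proof.
case: sm => _ _ _ _ ind A mA.
have := ind (fun=> setT) A (fun=> @measurableT _ (bRV R d)) mA.
rewrite [X in X `&` _](_ : _ = setT); last first.
  by apply/seteqP; split => // t _ i _.
rewrite setTI => ->; rewrite [X in (X * _)%E]big1 ?mul1e// => i _.
by rewrite preimage_setT probability_setT.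
Qed.

Lemma noise_law i (A : set (measurableTypeR R)) : measurable A ->
  P (Z i @^-1` A) = N01 R A.
Proof. by case: sm => _ _ _ + _; exact. Qed.

End cube_density_model.

Section empirical_fourier.
Context (R : realType) (d : nat).

Lemma natr_complexV (n : nat) : (n%:R : R[i])^-1 = ((n%:R^-1 : R)%:C)%C.
Proof. by rewrite fmorphV rmorph_nat. Qed.

Lemma theta_tildeE n (x : 'I_n -> 'rV[R]_d) k : theta_tilde x k =
  Complex (n%:R^-1 * \sum_j ck k (x j)) (- (n%:R^-1 * \sum_j sk k (x j))).
Proof.
rewrite /theta_tilde natr_complexV; apply: complex_ext.
  rewrite cReM /= mul0r subr0 cRe_sum; congr (_ * _).
rewrite cImM /= mul0r addr0 cIm_sum -mulrN -sumrN; congr (_ * _).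
Qed.

Variables (f g : 'rV[R]_d -> R).
Hypothesis cg : continuous g.
Hypothesis gf : forall x, unit_cube x -> g x = f x.
Hypothesis df : cube_density f.
Context dT (T : measurableType dT) (P : probability T R) (n : nat) (I : finType).
Variables (X : 'I_n -> T -> 'rV[R]_d) (Z : (I * bool)%type -> T -> R).
Hypothesis sm : sample_model P f X Z.

Definition emp_err M t : R :=
  \sum_(k <- KS M d) sqmod (theta_tilde (fun j => X j t) k - cf (rc g) k).

(** Both [k] and [- k] are listed, so this real system is not orthonormal; it still satisfies
    Bessel's inequality, because the two real integrals at [k] are, up to sign, the real and
    imaginary parts of one complex coefficient. *)
Definition trig M (a : 'rV['I_(2 * M + 1)]_d * bool) : bRV R d -> R :=
  if a.2 then ck (kval a.1) else sk (kval a.1).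

Lemma bm_trig M a : bm (@trig M a).
Proof. by rewrite /trig; case: a.2; [exact: bm_ck|exact: bm_sk]. Qed.

Lemma trig_bessel M (h : bRV R d -> R) : bm h ->
  \sum_a (\int[Lam R d]_s (h s * @trig M a s)) ^+ 2 <= \int[Lam R d]_s (h s ^+ 2).
Proof.
move=> bh; have := bessel (cbm_real bh) (KS_uniq M d).
rewrite big_KS; under [X in X <= _ -> _]eq_bigr do rewrite coef_real// /sqmod/= sqrrN.
under [X in _ <= X -> _]eq_Rintegral do rewrite /sqmod /= expr0n/= addr0.
apply: le_trans.
rewrite -(pair_bigA _ (fun k c => (\int[Lam R d]_s (h s * @trig M (k, c) s)) ^+ 2))/=.
by apply: ler_sum => k _; rewrite big_bool.
Qed.

Lemma cf_rc_density k : cf (rc g) k =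
  Complex (\int[Lam R d]_s (ck k s * rc g s)) (- \int[Lam R d]_s (sk k s * rc g s)).
Proof.
rewrite /cf coef_real; last exact: bm_rc.
by congr (Complex _ (- _)); apply: eq_Rintegral => s _; rewrite mulrC.
Qed.

Lemma ck2Dsk2 (k : 'rV[int]_d) (x : 'rV[R]_d) : ck k x ^+ 2 + sk k x ^+ 2 = 1.
Proof. exact: cos2Dsin2. Qed.

(** Nonnegativity of a variance: the mean under the density of the squared distance between the
    exponential and its mean [(p, q)] is [1 - p^2 - q^2]. *)
Lemma sqmod_cf_le1 k : sqmod (cf (rc g) k) <= 1.
Proof.
rewrite cf_rc_density /sqmod /= sqrrN; set p := \int[_]_s _; set q := \int[_]_s _.
have bg := bm_rc cg; have bc := @bm_ck R d k; have bs := @bm_sk R d k.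
have bcg : bm (fun s : bRV R d => ck k s * rc g s) by exact: bmM.
have bsg : bm (fun s : bRV R d => sk k s * rc g s) by exact: bmM.
have alg c s r : c ^+ 2 + s ^+ 2 = 1 -> ((c - p) ^+ 2 + (s - q) ^+ 2) * r =
    (1 + p ^+ 2 + q ^+ 2) * r - (2 * p * (c * r) + 2 * q * (s * r)).
  by move=> E; rewrite -[X in (X + _ + _) * r]E; ring.
have : 0 <= \int[Lam R d]_s (((ck k s - p) ^+ 2 + (sk k s - q) ^+ 2) * rc g s).
  apply: Rint_ge0 => s; apply: mulr_ge0; first by rewrite addr_ge0 ?sqr_ge0.
  exact: (rc_density_ge0 gf df).
under eq_Rintegral => s _.
  rewrite (_ : _ * rc g s = (1 + p ^+ 2 + q ^+ 2) * rc g s -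
    (2 * p * (ck k s * rc g s) + 2 * q * (sk k s * rc g s))); last first.
    exact: (alg _ _ _ (ck2Dsk2 k s)).
  over.
rewrite RintB; [|exact: bmZ|by apply: bmD; exact: bmZ].
rewrite RintZ// RintD; [|exact: bmZ|exact: bmZ]; rewrite !RintZ//.
by rewrite (Rint_rc_density cg gf df) -/p -/q; lra.
Qed.

Lemma emp_errE M t : (0 < n)%N -> emp_err M t =
  \sum_a (n%:R^-1 * \sum_j centered (Lam R d) (rc g) (@trig M) a (X j t)) ^+ 2.
Proof.
move=> n0; have nR : n%:R != 0 :> R by rewrite pnatr_eq0 -lt0n.
rewrite -(pair_bigA _ (fun k c => (n%:R^-1 * \sum_j
  centered (Lam R d) (rc g) (@trig M) (k, c) (X j t)) ^+ 2))/=.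
rewrite /emp_err big_KS; apply: eq_bigr => k _; rewrite big_bool.
have avg (F : 'I_n -> R) p : n%:R^-1 * \sum_j (F j - p) = n%:R^-1 * \sum_j F j - p.
  rewrite sumrB mulrBr; congr (_ - _).
  by rewrite sumr_const card_ord -[p *+ n]mulr_natl mulKf.
rewrite theta_tildeE cf_rc_density /centered /trig /= !avg /sqmod /=.
by congr (_ + _); rewrite opprK -sqrrN opprD opprK.
Qed.

Lemma emp_err_deviation M : (0 < n)%N ->
  \int[P]_t Num.max 0 (emp_err M t - 24 * (expn (2 * M + 1) d)%:R / n%:R) <=
  sup_norm f / (10 * n%:R).
Proof.
move=> n0; set D := (expn _ d)%:R.
have D0 : 0 < D by rewrite ltr0n expn_gt0 addn1.
under eq_Rintegral => t _.
  (* [Q = 4 D], since a centred exponential has squared modulus at most [2 + 2] at each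
     frequency. *)
  rewrite emp_errE// (_ : 24 * D = 6 * (4 * D)); last by ring.
  over.
apply: (@empirical_deviation R _ _ P _ _ (Lam R d) n _ (rc g)) => //.
- exact: (sample_measurable sm).
- exact: (sample_indep sm).
- exact: bm_rc.
- exact: (rc_density_ge0 gf df).
- exact: (rc_density_le cg gf).
- exact: (Rint_rc_density cg gf df).
- by move=> j h bh; exact: (sample_law cg gf df sm).
- exact: bm_trig.
- exact: trig_bessel.
- move=> s.
  rewrite -(pair_bigA _ (fun k c => (centered (Lam R d) (rc g) (@trig M) (k, c) s) ^+ 2))/=.
  apply: (@le_trans _ _ (\sum_(k : 'rV['I_(2 * M + 1)]_d) 4)); last first.
    by rewrite sumr_const card_mx mul1n card_ord /D -natrM mulnC natrM mulr_natr.
  apply: ler_sum => k _; rewrite big_bool /centered /trig /=.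
  have := sqmod_cf_le1 (kval k); rewrite cf_rc_density /sqmod /= sqrrN.
  have := ck2Dsk2 (kval k) s; set p := \int[_]_s _; set q := \int[_]_s _.
  set c := ck _ _; set s' := sk _ _.
  by have := sqr_ge0 (c + p); have := sqr_ge0 (s' + q); nra.
- exact: mulr_gt0.
- exact: (sup_norm_ge0 cg gf df).
Qed.

End empirical_fourier.

(** * Oracle inequality and risk bound *)

(* the deterministic part of the Goldenshluger--Lepski comparison, in coefficient space *)
Section oracle_inequality.
Context (R : realType) (K : eqType) (J : nat).
Variables (s : 'I_J.+1 -> seq K) (theta th : K -> R[i]) (z : 'I_J.+1 -> K -> R[i]).
Variables (l1 l2 L1 L2 : 'I_J.+1 -> R) (R0 : R).
Hypothesis s_uniq : forall m, uniq (s m).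
Hypothesis s_sub : forall m m' : 'I_J.+1, (m <= m')%N -> {subset s m <= s m'}.
Hypothesis besselR0 : \sum_(k <- s ord_max) sqmod (theta k) <= R0.
Hypothesis L1E : forall m, L1 m = 4 * l1 m + 4 * l2 m.
Hypothesis L12 : forall m, L1 m <= L2 m.
Hypothesis L1_0 : forall m, L1 ord0 <= L2 m.
Hypothesis L2_ge0 : forall m, 0 <= L2 m.

Definition ncoef m k := th k + z m k.
Definition xcoef m k := if k \in s m then ncoef m k else 0.
Definition gap m m' := \sum_(k <- s m') sqmod (xcoef m k - ncoef m' k).
Definition crit m := \big[Num.max/gap m ord0 - L1 ord0]_(m' < J.+1) (gap m m' - L1 m').
Definition remt m := R0 - \sum_(k <- s m) sqmod (theta k).
Definition serr m := \sum_(k <- s m) sqmod (th k - theta k).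
Definition nerr m := \sum_(k <- s m) sqmod (z m k).
(** The value of the squared distance given by [L2_pythagoras] over the largest frequency set, with
    [R0] in the place of the squared norm of the target. *)
Definition risk m := R0 - \sum_(k <- s ord_max) sqmod (theta k)
  + \sum_(k <- s ord_max) sqmod (theta k - xcoef m k).

Lemma sqmod0 : sqmod (0 : R[i]) = 0.
Proof. by rewrite /sqmod/= expr0n addr0. Qed.

Lemma sum_sub (m m' : 'I_J.+1) (F : K -> R) : (m <= m')%N -> (forall k, k \notin s m -> F k = 0) ->
  \sum_(k <- s m') F k = \sum_(k <- s m) F k.
Proof.
move=> mm' F0; rewrite (bigID (fun k => k \in s m))/= [X in _ + X]big1 ?addr0//.
rewrite -big_filter; apply: perm_big; apply: uniq_perm => //; first exact: filter_uniq.
move=> k; rewrite mem_filter; case: (boolP (k \in s m)) => //= km.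
by rewrite (s_sub mm').
Qed.

Lemma s_max m : {subset s m <= s ord_max}.
Proof. by apply: s_sub; rewrite -ltnS. Qed.

Lemma tail_le m m' : \sum_(k <- s m' | k \notin s m) sqmod (theta k) <= remt m.
Proof.
rewrite lerBrDr; apply: le_trans besselR0.
rewrite -big_filter -big_cat; apply: ler_sum_uniq => [|//|k|k]; last exact: sqmod_ge0.
  rewrite cat_uniq filter_uniq// s_uniq andbT/=; apply/hasPn => k km.
  by rewrite mem_filter negb_and negbK km.
rewrite mem_cat mem_filter => /orP[/andP[_ +]|]; exact: s_max.
Qed.

Lemma remt_ge0 m : 0 <= remt m.
Proof.
apply: le_trans (tail_le m m); apply: sumr_ge0 => k _; exact: sqmod_ge0.
Qed.

(** On the frequencies common to both levels the empirical coefficients cancel and only the two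
    noises remain. On the others [xcoef] is 0, so the noisy coefficient itself appears and splits
    into signal tail, sampling error and noise. *)
Lemma gap_le m m' : gap m m' <= 4 * remt m + 4 * nerr m + 4 * serr m' + 4 * nerr m'.
Proof.
have s0 (x : R[i]) := sqmod_ge0 x.
apply: (@le_trans _ _ (2 * \sum_(k <- s m' | k \notin s m) sqmod (theta k) +
   2 * \sum_(k <- s m' | k \in s m) sqmod (z m k) + 4 * serr m' + 4 * nerr m')).
  rewrite /gap /serr /nerr !mulr_sumr (bigID (fun k => k \in s m))/=.
  rewrite [X in _ + X + _](bigID (fun k => k \in s m))/=.
  rewrite [X in _ + _ + X](bigID (fun k => k \in s m))/=.
  set A := \sum_(k <- s m' | k \in s m) _; set B := \sum_(k <- s m' | _) _.
  set C := \sum_(k <- s m' | _) _; set D := \sum_(k <- s m' | _) _.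
  set E1 := \sum_(k <- s m' | _) _; set E2 := \sum_(k <- s m' | _) _.
  set E3 := \sum_(k <- s m' | _) _; set E4 := \sum_(k <- s m' | _) _.
  have h1 : A <= D + E3.
    rewrite /A /D /E3 -big_split/=; apply: ler_sum => k km; rewrite /xcoef km /ncoef.
    rewrite (_ : th k + z m k - (th k + z m' k) = z m k + - z m' k); last by ring.
    apply: (le_trans (sqmodD_le _ _)); rewrite sqmodN.
    by have := s0 (z m' k); lra.
  have h2 : B <= C + E2 + E4.
    rewrite /B /C /E2 /E4 -!big_split/=; apply: ler_sum => k km.
    rewrite /xcoef (negbTE km) /ncoef sub0r sqmodN.
    rewrite (_ : th k + z m' k = theta k + ((th k - theta k) + z m' k)); last by ring.
    apply: (le_trans (sqmodD_le _ _)).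
    by have := sqmodD_le (th k - theta k) (z m' k); lra.
  have h3 : 0 <= E1 by apply: sumr_ge0 => k _; rewrite mulr_ge0.
  lra.
have t1 := tail_le m m'; have r0 := remt_ge0 m.
have t2 : \sum_(k <- s m' | k \in s m) sqmod (z m k) <= nerr m.
  rewrite -big_filter; apply: ler_sum_uniq => //; first exact: filter_uniq.
  by move=> k; rewrite mem_filter => /andP[].
have n0 : 0 <= nerr m by apply: sumr_ge0.
lra.
Qed.

Definition excess m := Num.max 0 (serr m - l1 m) + Num.max 0 (nerr m - l2 m).

Lemma excess_ge0 m : 0 <= excess m.
Proof. by rewrite addr_ge0// le_max lexx. Qed.

(** The penalty [L1 m'] equals [4 * l1 m' + 4 * l2 m'], which matches the factor 4 of the errors of
    level [m'] in [gap_le] and leaves only positive parts. *)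
Lemma crit_le m : crit m <= 4 * remt m + 4 * nerr m + 4 * \sum_m' excess m'.
Proof.
have H m' : gap m m' - L1 m' <= 4 * remt m + 4 * nerr m + 4 * \sum_m' excess m'.
  have h1 := gap_le m m'; rewrite L1E.
  have h2 : excess m' <= \sum_m' excess m'.
    by rewrite (bigD1 m')//= lerDl; apply: sumr_ge0 => i _; exact: excess_ge0.
  have : serr m' - l1 m' <= Num.max 0 (serr m' - l1 m') by rewrite le_max lexx orbT.
  have : nerr m' - l2 m' <= Num.max 0 (nerr m' - l2 m') by rewrite le_max lexx orbT.
  by move: h2; rewrite /excess; lra.
by apply: bigmax_le => [|m' _]; exact: H.
Qed.

Lemma gap_crit m m' : gap m m' <= crit m + L1 m'.
Proof. by rewrite -lerBlDr /crit; apply: le_bigmax. Qed.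

(** The criterion may be negative because penalties are subtracted inside the maximum; the
    competitor [ord0] limits how far it can fall. *)
Lemma crit_lower m : - L1 ord0 <= crit m.
Proof.
have := gap_crit m ord0; have : 0 <= gap m ord0 by apply: sumr_ge0 => k _; exact: sqmod_ge0.
lra.
Qed.

Lemma xdist_gap (m m' : 'I_J.+1) : (m <= m')%N ->
  \sum_(k <- s ord_max) sqmod (xcoef m k - xcoef m' k) = gap m m'.
Proof.
move=> mm'; rewrite (@sum_sub m' ord_max); first last.
- by move=> k km'; rewrite /xcoef (negbTE km') (contraNF (s_sub mm' (x := k)) km') subrr sqmod0.
- by rewrite -ltnS.
by rewrite /gap big_seq [RHS]big_seq; apply: eq_bigr => k km'; rewrite {2}/xcoef km'.
Qed.

Lemma risk_le m : risk m <= remt m + 2 * serr m + 2 * nerr m.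
Proof.
have H : \sum_(k <- s ord_max) (sqmod (theta k - xcoef m k) - sqmod (theta k)) =
    \sum_(k <- s m) (sqmod (theta k - xcoef m k) - sqmod (theta k)).
  apply: sum_sub; first by rewrite -ltnS.
  by move=> k km; rewrite /xcoef (negbTE km) subr0 subrr.
move: H; rewrite !sumrB => H.
have : \sum_(k <- s m) sqmod (theta k - xcoef m k) <= 2 * serr m + 2 * nerr m.
  rewrite /serr /nerr !mulr_sumr -big_split/= big_seq [leRHS]big_seq.
  apply: ler_sum => k km; rewrite /xcoef km /ncoef -sqmodN.
  rewrite (_ : - _ = (th k - theta k) + z m k); last by ring.
  exact: sqmodD_le.
rewrite /risk /remt; lra.
Qed.

Lemma risk_triangle m m' :
  risk m <= 2 * risk m' + 2 * \sum_(k <- s ord_max) sqmod (xcoef m' k - xcoef m k).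
Proof.
have : \sum_(k <- s ord_max) sqmod (theta k - xcoef m k) <=
    2 * \sum_(k <- s ord_max) sqmod (theta k - xcoef m' k) +
    2 * \sum_(k <- s ord_max) sqmod (xcoef m' k - xcoef m k).
  rewrite !mulr_sumr -big_split/=; apply: ler_sum => k _.
  rewrite (_ : theta k - xcoef m k = (theta k - xcoef m' k) + (xcoef m' k - xcoef m k));
    last by ring.
  exact: sqmodD_le.
rewrite /risk; have := besselR0; lra.
Qed.

(** Levels are nested, so the distance between levels [m] and [mh] is a [gap] seen from the coarser
    one. If [m] is coarser, [gap_crit] leaves [L1 mh], which minimality bounds after using
    [crit_lower mh]; if [mh] is coarser, minimality bounds [crit mh] directly. *)
Lemma oracle mh m : crit mh + L2 mh <= crit m + L2 m ->
  risk mh <= 18 * remt m + 9 * L2 m + 36 * \sum_m' excess m'.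
Proof.
move=> hmh.
have xs : \sum_(k <- s ord_max) sqmod (xcoef m k - xcoef mh k) <=
    2 * Num.max 0 (crit m) + 2 * L2 m.
  have c0 : crit m <= Num.max 0 (crit m) by rewrite le_max lexx orbT.
  have c1 : 0 <= Num.max 0 (crit m) by rewrite le_max lexx.
  have [mm|/ltnW mm] := leqP m mh.
    rewrite xdist_gap//; have := gap_crit m mh; have := crit_lower mh.
    by have := L12 mh; have := L1_0 m; lra.
  under eq_bigr do rewrite -sqmodN opprB.
  rewrite xdist_gap//; have := gap_crit mh m; have := L12 mh.
  by have := L12 m; have := L2_ge0 mh; lra.
(* Accounting: bias [2 + 4 * 4 = 18]; penalty 4 from the distance and 5 from
   [4 * l1 m + 20 * l2 m <= 5 * L1 m]; excess [16 + 20 = 36]. *)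
have rt := risk_triangle mh m; have rl := risk_le m.
have ex := excess_ge0.
have cm : Num.max 0 (crit m) <= 4 * remt m + 4 * nerr m + 4 * \sum_m' excess m'.
  rewrite ge_max crit_le andbT.
  have : 0 <= nerr m by apply: sumr_ge0 => k _; exact: sqmod_ge0.
  have : 0 <= \sum_m' excess m' by apply: sumr_ge0.
  by have := remt_ge0 m; lra.
have h2 : excess m <= \sum_m' excess m'.
  by rewrite (bigD1 m)//= lerDl; apply: sumr_ge0 => i _.
have h3 : serr m - l1 m <= Num.max 0 (serr m - l1 m) by rewrite le_max lexx orbT.
have h4 : nerr m - l2 m <= Num.max 0 (nerr m - l2 m) by rewrite le_max lexx orbT.
have h5 : 0 <= Num.max 0 (serr m - l1 m) by rewrite le_max lexx.
have h6 : 0 <= Num.max 0 (nerr m - l2 m) by rewrite le_max lexx.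
have : 0 <= serr m by apply: sumr_ge0 => k _; exact: sqmod_ge0.
have := L12 m; have := L1E m; move: h2; rewrite {1}/excess; lra.
Qed.

End oracle_inequality.

(** * The selection procedure in Fourier coefficients *)

Section procedure_in_coefficients.
Context (R : realType) (n d : nat) (rho : R).
Local Notation J := (Jmax R n d).
Implicit Types (m : 'I_J.+1) (x : 'I_n -> 'rV[R]_d) (xi : noise_idx J d -> R[i]).

Definition freq m : seq 'rV[int]_d := KS (expn 2 m) d.
Definition dimS m : R := (expn (2 * expn 2 m + 1) d)%:R.
Definition sig m : R := sigmaM n d rho J.+1 (expn 2 m).

(** Extends the noise of level [m] by 0 to all integer frequencies, so that the levels, whose index
    types differ, share one coefficient space. The picked index is unique as [kval] is injective. *)
Definition noise_coef xi m (k : 'rV[int]_d) : R[i] :=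
  if [pick l : 'rV['I_(2 * expn 2 m + 1)]_d | kval l == k] is Some l
  then ((sig m)%:C)%C * xi (existT _ m l) else 0.

Lemma noise_coef_kval xi m l : noise_coef xi m (kval l) = ((sig m)%:C)%C * xi (existT _ m l).
Proof.
rewrite /noise_coef; case: pickP => [l' /eqP/kval_inj -> //|/(_ l)].
by rewrite eqxx.
Qed.

Lemma fhatE x xi m :
  fhat rho x xi m = TP (freq m) (ncoef (theta_tilde x) (noise_coef xi) m).
Proof.
apply/funext => y; rewrite /TP /freq big_KS; apply: eq_bigr => k _.
by rewrite /ncoef noise_coef_kval.
Qed.

Lemma projSE M (F : bRV R d -> R[i]) : cbm F -> projS M F = TP (KS M d) (coef F).
Proof.
move=> bF; apply/funext => y; rewrite /projS /TP big_KS; apply: eq_bigr => k _.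
by rewrite L2innerE.
Qed.

Lemma coef_fhat x xi m k :
  coef (fhat rho x xi m) k = xcoef freq (theta_tilde x) (noise_coef xi) m k.
Proof. by rewrite fhatE coef_TP ?KS_uniq. Qed.

Lemma cbm_fhat x xi m : cbm (fhat rho x xi m : bRV R d -> R[i]).
Proof. by rewrite fhatE; exact: cbm_TP. Qed.

Lemma B2E x xi m : B2 rho x xi m =
  crit freq (theta_tilde x) (noise_coef xi) (fun m => Lambda1 n d rho J.+1 (expn 2 m)) m.
Proof.
suff E m' : L2sq (fun y => projS (expn 2 m') (fhat rho x xi m) y - fhat rho x xi m' y) =
    gap freq (theta_tilde x) (noise_coef xi) m m'.
  by rewrite /B2 /crit E; apply: eq_bigr => i _; rewrite E.
rewrite projSE; last exact: cbm_fhat.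
rewrite [fhat rho x xi m']fhatE.
rewrite (_ : (fun y => _) = TP (freq m') (fun k =>
   xcoef freq (theta_tilde x) (noise_coef xi) m k - ncoef (theta_tilde x) (noise_coef xi) m' k)).
  by rewrite L2sqE ?L2_TP ?KS_uniq//; exact: cbm_TP.
apply/funext => y; rewrite /TP -sumrB; apply: eq_bigr => k _.
by rewrite coef_fhat mulrBl.
Qed.

(** Zero padding writes every [fhat] over the largest frequency set, so that one application of
    [L2_pythagoras] serves all levels. *)
Lemma risk_fhatE (f g : 'rV[R]_d -> R) x xi m :
  continuous g -> (forall y, unit_cube y -> g y = f y) ->
  L2sq (fun y => ((f y)%:C)%C - fhat rho x xi m y) =
  risk freq (cf (rc g)) (theta_tilde x) (noise_coef xi)
    (\int[Lam R d]_y (rc g y ^+ 2)) m.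
Proof.
move=> cg gf; have bg := cbm_real (bm_rc cg).
have sub : {subset freq m <= freq ord_max}.
  by apply: KS_sub; rewrite leq_exp2l// -ltnS.
have -> : fhat rho x xi m = TP (freq ord_max) (xcoef freq (theta_tilde x) (noise_coef xi) m).
  rewrite fhatE; apply/funext => y; apply/esym.
  rewrite /TP (bigID (fun k => k \in freq m))/= [X in _ + X]big1 ?addr0; last first.
    by move=> k /negbTE km; rewrite /xcoef km mul0r.
  rewrite -big_filter (perm_big (freq m)); last first.
    apply: uniq_perm; [by rewrite filter_uniq// KS_uniq|exact: KS_uniq|].
    by move=> k; rewrite mem_filter andb_idr//; exact: sub.
  by rewrite big_seq [RHS]big_seq; apply: eq_bigr => k km; rewrite /xcoef km.
rewrite /L2sq (@eq_cube_int _ _ _ (fun y => sqmod ((rc g y)%:C%C -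
  TP (freq ord_max) (xcoef freq (theta_tilde x) (noise_coef xi) m) y))); last first.
  by move=> y cy; rewrite rc_cube// gf.
rewrite cube_intE; last first.
  by apply: bm_sqmod; apply: cbmD => //; apply: cbmN; exact: cbm_TP.
rewrite L2_pythagoras ?KS_uniq//; congr (_ - _ + _).
by apply: eq_Rintegral => y _; rewrite /sqmod /= expr0n/= addr0.
Qed.

(** The deviation thresholds with their factor 6: [24 * dimS m] is 6 times [Q = 4 * dimS m], and
    [lam_noise m] is [6 * dimS m] times the noise variance. Four times their sum is [Lambda1]. *)
Definition lam_emp m : R := 24 * dimS m / n%:R.
Definition lam_noise m : R := 24 * dimS m ^+ 2 / (n%:R ^+ 2 * (rho / J.+1%:R)).

Lemma dim2E m : (expn (2 * expn 2 m + 1) (2 * d))%:R = dimS m ^+ 2 :> R.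
Proof. by rewrite /dimS -natrX (mulnC 2%N d) expnM. Qed.

Lemma Lambda1E m : Lambda1 n d rho J.+1 (expn 2 m) = 4 * lam_emp m + 4 * lam_noise m.
Proof.
rewrite /Lambda1 /lam_emp /lam_noise dim2E -/(dimS m).
by move: (n%:R^-1) ((n%:R ^+ 2 * _)^-1) (dimS m) => a b D; ring.
Qed.

Lemma Lambda2E m : Lambda2 n d rho J.+1 (expn 2 m) =
  96 * dimS m / n%:R + 112 * dimS m ^+ 2 / (n%:R ^+ 2 * (rho / J.+1%:R)).
Proof.
rewrite /Lambda2 Lambda1E /lam_emp /lam_noise dim2E.
by move: (n%:R^-1) ((n%:R ^+ 2 * _)^-1) (dimS m) => a b D; ring.
Qed.

Lemma dimS_ge0 m : 0 <= dimS m. Proof. exact: ler0n. Qed.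

Lemma dimS_ord0 m : dimS ord0 <= dimS m.
Proof.
have H e (a b : nat) : (a <= b)%N -> (expn a e <= expn b e)%N.
  by case: e => // e ab; rewrite leq_exp2r.
by rewrite ler_nat H// leq_add2r leq_mul2l expn0 expn_gt0.
Qed.

Hypothesis rho0 : 0 < rho.

Let den_ge0 : 0 <= (n%:R ^+ 2 * (rho / J.+1%:R))^-1 :> R.
Proof. by rewrite invr_ge0 mulr_ge0 ?exprn_ge0 ?divr_ge0// ltW. Qed.

Lemma Mhat_argmin x xi m :
  B2 rho x xi (Mhat rho x xi) + Lambda2 n d rho J.+1 (expn 2 (Mhat rho x xi)) <=
  B2 rho x xi m + Lambda2 n d rho J.+1 (expn 2 m).
Proof. by rewrite /Mhat; case: arg_minP => // i _; apply. Qed.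

Lemma fhat_sel_oracle (f g : 'rV[R]_d -> R) x xi m :
  continuous g -> (forall y, unit_cube y -> g y = f y) ->
  L2sq (fun y => ((f y)%:C)%C - fhat_sel rho x xi y) <=
  18 * remt freq (cf (rc g)) (\int[Lam R d]_y (rc g y ^+ 2)) m +
  9 * Lambda2 n d rho J.+1 (expn 2 m) +
  36 * \sum_m' excess freq (cf (rc g)) (theta_tilde x) (noise_coef xi) lam_emp lam_noise m'.
Proof.
move=> cg gf; rewrite /fhat_sel (risk_fhatE _ _ _ cg gf).
apply: (@oracle R _ _ freq _ _ _ lam_emp lam_noise
  (fun m => Lambda1 n d rho J.+1 (expn 2 m)) (fun m => Lambda2 n d rho J.+1 (expn 2 m))).
- by move=> i; exact: KS_uniq.
- by move=> i j ij; apply: KS_sub; rewrite leq_exp2l.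
- apply: le_trans (bessel (cbm_real (bm_rc cg)) (KS_uniq _ _)) _.
  rewrite le_eqVlt; apply/orP; left; apply/eqP.
  by apply: eq_Rintegral => y _; rewrite /sqmod /= expr0n/= addr0.
- exact: Lambda1E.
- by move=> i; rewrite /Lambda2 lerDl mulr_ge0// mulr_ge0.
- move=> i; rewrite Lambda1E Lambda2E /lam_emp /lam_noise.
  have h1 : dimS ord0 / n%:R <= dimS i / n%:R by rewrite ler_wpM2r ?dimS_ord0// invr_ge0.
  have h2 : dimS ord0 ^+ 2 * (n%:R ^+ 2 * (rho / J.+1%:R))^-1 <=
      dimS i ^+ 2 * (n%:R ^+ 2 * (rho / J.+1%:R))^-1.
    by rewrite ler_wpM2r// lerXn2r ?nnegrE ?dimS_ge0 ?dimS_ord0.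
  have h3 : 0 <= dimS i ^+ 2 * (n%:R ^+ 2 * (rho / J.+1%:R))^-1 by rewrite mulr_ge0// sqr_ge0.
  move: h1 h2 h3; rewrite -!(mulrA 24) -!(mulrA 96) -!(mulrA 112).
  by move: (_ / _) (_ / _) (_ / _) (_ / _) => ? ? ? ?; lra.
- by move=> i; rewrite Lambda2E addr_ge0// mulr_ge0// mulr_ge0// ?invr_ge0 ?sqr_ge0 ?dimS_ge0.
- by have := Mhat_argmin x xi m; rewrite !B2E.
Qed.

End procedure_in_coefficients.

(** Immediate from the integral as a supremum over simple functions. Without measurability
    conditions it bounds the mean loss of the selected estimator through its oracle bound alone. *)
Lemma le_ge0_integral (R : realType) dT (T : measurableType dT) (mu : {measure set T -> \bar R})
    (f1 f2 : T -> \bar R) :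
  (forall x, 0 <= f1 x)%E -> (forall x, f1 x <= f2 x)%E ->
  (\int[mu]_x f1 x <= \int[mu]_x f2 x)%E.
Proof.
move=> f10 f12; have f20 x : (0 <= f2 x)%E by exact: le_trans (f10 x) (f12 x).
rewrite !ge0_integralTE//; apply: le_ereal_sup => _ [h hf <-]; exists h => // x.
exact: le_trans (hf x) (f12 x).
Qed.

(** Indices outside the image receive the whole space, whose probability is 1. *)
Lemma indep_family_inj (R : realType) dT (T : measurableType dT) (P : probability T R)
    dS (S : measurableType dS) (K K' : finType) (h : K' -> K) (Y : K -> T -> S) :
  injective h -> indep_family P Y -> indep_family P (fun i => Y (h i)).
Proof.
move=> hI indY A mA.
pose B i := if [pick j | h j == i] is Some j then A j else setT.
have BE j : B (h j) = A j.
  by rewrite /B; case: pickP => [j' /eqP/hI ->//|/(_ j)]; rewrite eqxx.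
have BN i : i \notin h @: K' -> B i = setT.
  move=> iN; rewrite /B; case: pickP => // j /eqP hj.
  by move: iN; rewrite -hj imset_f.
have mB i : measurable (B i) by rewrite /B; case: pickP.
have -> : \bigcap_j (Y (h j) @^-1` A j) = \bigcap_i (Y i @^-1` B i).
  apply/seteqP; split => t H i _; last by have := H (h i) I; rewrite /= BE.
  rewrite /= /B; case: pickP => [j /eqP <-|//]; exact: H.
rewrite indY// (bigID (fun i => i \in h @: K'))/= [X in (_ * X)%E]big1 ?mule1.
  rewrite big_imset/=; last by move=> i j _ _; exact: hI.
  by apply: eq_big => // j _; rewrite BE.
by move=> i iN; rewrite BN// preimage_setT probability_setT.
Qed.

Section risk_bound.
Context (R : realType) (n d beta : nat) (rho L : R).
Local Notation J := (Jmax R n d).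
Variables (f g : 'rV[R]_d -> R).
Hypothesis n0 : (0 < n)%N.
Hypothesis rho0 : 0 < rho.
Hypothesis beta1 : (1 <= beta)%N.
Hypothesis cg : Cbeta beta g.
Hypothesis gf : forall x, unit_cube x -> g x = f x.
Hypothesis gL : \sum_(a : {ffun 'I_d -> 'I_beta.+1} | (\sum_(i < d) (a i : nat) == beta)%N)
  cube_int (fun x => (dalpha (fun i => a i : nat) g x) ^+ 2) <= L ^+ 2.
Hypothesis pg : forall a : 'I_d -> nat, (\sum_(i < d) a i < beta)%N ->
  forall x i, unit_cube x -> (x ord0 i = 0 \/ x ord0 i = 1) ->
  dalpha a g x = dalpha a g (flip_coord i x).
Hypothesis df : cube_density f.
Context dT (T : measurableType dT) (P : probability T R).
Variables (X : 'I_n -> T -> 'rV[R]_d) (Z : (noise_idx J d * bool)%type -> T -> R).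
Hypothesis sm : sample_model P f X Z.
Implicit Types m : 'I_J.+1.

Let cg0 : continuous g. Proof. by have [] := cg (s := [::]) isT. Qed.

Definition nidx m (a : 'rV['I_(2 * expn 2 m + 1)]_d * bool) : noise_idx J d * bool :=
  (existT _ m a.1, a.2).

Lemma nidx_inj m : injective (@nidx m).
Proof.
move=> [k c] [l e] H; have -> : c = e by have := congr1 snd H.
by congr (_, _); apply: (eq_from_Tagged (congr1 fst H)).
Qed.

Definition noise_sq m t : R := \sum_a Z (@nidx m a) t ^+ 2.

Definition sig2 m : R := 4 * dimS m / (n%:R ^+ 2 * (rho / J.+1%:R)).

Lemma sig_sqr m : sig rho m ^+ 2 = sig2 m.
Proof.
rewrite /sig /sigmaM expr_div_n !exprMn !sqr_sqrtr ?ler0n ?divr_ge0 ?(ltW rho0)//.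
by rewrite /sig2; congr (_ * _ / _); ring.
Qed.

Lemma sig2_ge0 m : 0 <= sig2 m.
Proof. by rewrite -sig_sqr sqr_ge0. Qed.

Lemma nerrE m t :
  nerr (@freq R n d) (noise_coef rho (noise_of Z t)) m = sig2 m * noise_sq m t.
Proof.
rewrite /nerr /freq big_KS /noise_sq.
rewrite -(pair_bigA _ (fun l c => Z (@nidx m (l, c)) t ^+ 2))/= mulr_sumr.
apply: eq_bigr => l _; rewrite noise_coef_kval sqmodM big_bool; congr (_ * _).
by rewrite /sqmod/= expr0n/= addr0 sig_sqr.
Qed.

(** The noise error is [sig2 m] times a chi-square variable with two degrees of freedom per
    frequency, and [lam_noise] sits at three times its mean. *)
Lemma noise_excess m :
  (\int[P]_t (Num.max 0 (nerr (@freq R n d) (noise_coef rho (noise_of Z t)) m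
     - lam_noise rho m))%:E <= (sig2 m * (4 * 2^-1 ^+ (expn (2 * expn 2 m + 1) d)))%:E)%E.
Proof.
have lamE : lam_noise rho m = sig2 m * (6 * dimS m).
  by rewrite /lam_noise /sig2; move: (_^-1) (dimS m) => a D; ring.
under eq_integral => t _.
  rewrite nerrE lamE -mulrBr (_ : Num.max 0 _ = sig2 m * Num.max 0 (noise_sq m t - 6 * dimS m));
    last by rewrite maxr_pMr ?sig2_ge0// mulr0.
  rewrite EFinM; over.
have mZ := noise_measurable sm.
have mN : measurable_fun [set: T] (noise_sq m).
  by apply: (measurable_sumZ2 (Z := fun a => Z (@nidx m a))) => a; exact: mZ.
rewrite ge0_integralZl ?lee_fin ?sig2_ge0//; last 2 first.
- apply/measurable_EFinP; apply: measurable_maxr => //.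
  by apply: measurable_funB.
- by move=> t _; rewrite lee_fin le_max lexx.
rewrite [leRHS]EFinM; apply: lee_wpmul2l; first by rewrite lee_fin sig2_ge0.
apply: (@chi_square_deviation R _ T P _ (fun a => Z (@nidx m a))).
- by move=> a; exact: mZ.
- exact: (indep_family_inj (@nidx_inj m) (noise_indep sm)).
- by move=> a A mA; exact: (noise_law sm).
- by rewrite card_prod card_bool card_mx mul1n card_ord mulnC.
Qed.

Lemma bm_emp_err M : bm (fun t => emp_err g X M t).
Proof.
have mX := sample_measurable sm.
rewrite (_ : (fun t => _) = fun t => \sum_a (n%:R^-1 * \sum_j
   centered (Lam R d) (rc g) (@trig R d M) a (X j t)) ^+ 2); last first.
  by apply/funext => t; rewrite emp_errE.
apply: bm_sum => a _; apply: bmX; apply: bmZ; apply: bm_sum => j _.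
apply: (bm_comp (mX j)); apply: bmB; [exact: bm_trig|exact: bm_cst].
Qed.

Lemma emp_excess m :
  (\int[P]_t (Num.max 0 (serr (@freq R n d) (cf (rc g)) (theta_tilde (fun j => X j t)) m
     - lam_emp m))%:E <= (sup_norm f / (10 * n%:R))%:E)%E.
Proof.
rewrite [leLHS](@EFin_Rint R _ T P (fun t => Num.max 0 (emp_err g X (expn 2 m) t
  - 24 * (expn (2 * expn 2 m + 1) d)%:R / n%:R))).
  by rewrite lee_fin; exact: (emp_err_deviation cg0 gf df sm).
by apply: bm_max; [exact: bm_cst|apply: bmB; [exact: bm_emp_err|exact: bm_cst]].
Qed.

Lemma remt_le m : remt (@freq R n d) (cf (rc g)) (\int[Lam R d]_y (rc g y ^+ 2)) m <=
  L ^+ 2 / (2 * pi * (expn 2 m).+1%:R) ^+ (2 * beta).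
Proof. exact: fourier_bias. Qed.

Lemma risk_bound m :
  (\int[P]_w (L2sq (fun y => ((f y)%:C)%C -
      fhat_sel rho (fun j => X j w) (noise_of Z w) y))%:E <=
   (18 * (L ^+ 2 / (2 * pi * (expn 2 m).+1%:R) ^+ (2 * beta)) +
    9 * Lambda2 n d rho J.+1 (expn 2 m) +
    36 * \sum_(m' < J.+1) (sup_norm f / (10 * n%:R) +
      sig2 m' * (4 * 2^-1 ^+ (expn (2 * expn 2 m' + 1) d))))%:E)%E.
Proof.
set c := 18 * _ + 9 * _.
pose E t m' := excess (@freq R n d) (cf (rc g)) (theta_tilde (fun j => X j t))
   (noise_coef rho (noise_of Z t)) (@lam_emp R n d) (lam_noise rho) m'.
have E0 t m' : 0 <= E t m' by exact: excess_ge0.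
have c0 : 0 <= c.
  apply: addr_ge0; rewrite mulr_ge0//.
    by rewrite divr_ge0 ?sqr_ge0// exprn_ge0// !mulr_ge0// pi_ge0.
  rewrite Lambda2E addr_ge0// mulr_ge0// ?mulr_ge0// ?invr_ge0 ?sqr_ge0 ?dimS_ge0//.
  by rewrite mulr_ge0 ?sqr_ge0// divr_ge0// ltW.
have mserr m' : measurable_fun [set: T] (fun t => Num.max 0 (serr (@freq R n d) (cf (rc g))
    (theta_tilde (fun j => X j t)) m' - lam_emp m')).
  apply: measurable_maxr => //; apply: measurable_funB => //.
  exact: (bm_emp_err _).1.
have mnerr m' : measurable_fun [set: T] (fun t => Num.max 0 (nerr (@freq R n d)
    (noise_coef rho (noise_of Z t)) m' - lam_noise rho m')).
  apply: measurable_maxr => //; apply: measurable_funB => //.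
  under eq_fun do rewrite nerrE.
  apply: measurable_funM => //.
  apply: (measurable_sumZ2 (Z := fun a => Z (@nidx m' a))) => a; exact: (noise_measurable sm).
have mE m' : measurable_fun [set: T] (E^~ m') by exact: measurable_funD.
apply: (@le_trans _ _ (\int[P]_t (c + 36 * \sum_m' E t m')%:E)%E).
  apply: le_ge0_integral => t; rewrite lee_fin.
    rewrite /L2sq; apply: cube_int_ge0 => x; exact: sqmod_ge0.
  apply: le_trans (fhat_sel_oracle rho0 _ _ m cg0 gf) _.
  by rewrite /c lerD2r lerD2r ler_wpM2l//; exact: remt_le.
under eq_integral do rewrite EFinD EFinM.
rewrite ge0_integralD//; last 2 first.
- by move=> t _; rewrite mule_ge0// lee_fin sumr_ge0.
- by apply: measurable_funeM; apply/measurable_EFinP; exact: measurable_sum.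
have -> : (\int[P]_(_ in setT) c%:E = c%:E)%E.
  by rewrite integral_cst// [X in (_ * X)%E](probability_setT P) mule1.
rewrite [leRHS]EFinD leeD2l//.
rewrite ge0_integralZl//; last 2 first.
- by apply/measurable_EFinP; exact: measurable_sum.
- by move=> t _; rewrite lee_fin sumr_ge0.
rewrite [leRHS]EFinM; apply: lee_wpmul2l => //.
under eq_integral do rewrite -sumEFin.
rewrite ge0_integral_sum//; last 2 first.
- by move=> m'; exact/measurable_EFinP.
- by move=> m' t _; rewrite lee_fin.
rewrite -sumEFin; apply: lee_sum => m' _.
under eq_integral do rewrite /E /excess EFinD.
rewrite ge0_integralD//; last 4 first.
- by move=> t _; rewrite lee_fin le_max lexx.
- exact/measurable_EFinP.
- by move=> t _; rewrite lee_fin le_max lexx.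
- exact/measurable_EFinP.
by rewrite EFinD leeD// ?emp_excess ?noise_excess.
Qed.

End risk_bound.

(** * Rates *)

Section rates.
Context (R : realType).

Lemma ln2_ge : 1 / 2 <= ln (2 : R).
Proof.
have -> : (2 : R) = (1 + - (1 / 2))^-1 by field.
rewrite lnV; last by rewrite posrE; lra.
have := @le_ln1Dx R (- (1 / 2)); lra.
Qed.

Lemma log2_pow k (y : R) : 0 < y -> (k%:R <= log2 y) = (2 ^+ k <= y).
Proof.
move=> y0; rewrite /log2 ler_pdivlMr; last by have := ln2_ge; lra.
by rewrite mulr_natl -lnXn// ler_ln ?posrE ?exprn_gt0.
Qed.

Lemma trunc_log2_le (y : R) : 1 <= y -> 2 ^+ Num.truncn (log2 y) <= y.
Proof.
move=> y1; have y0 : 0 < y by lra.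
rewrite -log2_pow//; have : (0%:R <= log2 y) by rewrite log2_pow.
by move=> /truncn_itv/andP[].
Qed.

Lemma trunc_log2_gt (y : R) : 1 <= y -> y < 2 ^+ (Num.truncn (log2 y)).+1.
Proof.
move=> y1; have y0 : 0 < y by lra.
rewrite ltNge -log2_pow// -ltNge; have : (0%:R <= log2 y) by rewrite log2_pow.
by move=> /truncn_itv/andP[].
Qed.

Lemma root_exp (a : R) k : 0 < a -> (0 < k)%N -> (a `^ k%:R^-1) ^+ k = a.
Proof.
move=> a0 k0; rewrite -powR_mulrn ?powR_ge0// -powRrM mulVf ?pnatr_eq0 -?lt0n//.
by rewrite powRr1// ltW.
Qed.

Lemma root_expN (a : R) k p : a `^ (- p%:R / k%:R) = ((a `^ k%:R^-1) ^+ p)^-1.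
Proof. by rewrite mulrC mulrN powRN powRrM powR_mulrn// powR_ge0. Qed.

Lemma le_root (a c : R) k : 0 <= c -> 0 < a -> (0 < k)%N -> c ^+ k <= a -> c <= a `^ k%:R^-1.
Proof.
move=> c0 a0 k0 ca; rewrite -(@ler_pXn2r _ k)// ?nnegrE ?powR_ge0//.
by rewrite root_exp.
Qed.

(** The same rounding as in [Jmax]. The condition [3 <= x] makes the logarithm nonnegative, so that
    [truncn] is the floor. *)
Lemma dyadic_level (x : R) (m := Num.truncn (log2 ((x - 1) / 2))) : 3 <= x ->
  (2 * expn 2 m + 1)%:R <= x /\ x <= 4 * (expn 2 m).+1%:R.
Proof.
move=> x3; rewrite /m {m}.
have y1 : 1 <= (x - 1) / 2 by lra.
have := trunc_log2_le y1; have := trunc_log2_gt y1; move: (Num.truncn _) => m h1 h2.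
split=> //; first by rewrite natrD natrM natrX; lra.
rewrite -[(expn 2 m).+1%:R]natr1 (natrX R 2); move: h1; rewrite exprS; lra.
Qed.

(** Reduces to [1 + D / 2 <= (3 / 2)^D]. It makes the noise excess, of order [D * 2^(- D)] at
    dimension [D], summable over the levels. *)
Lemma mul_half_pow D : D%:R * 2^-1 ^+ D <= 2 * (3 / 4) ^+ D :> R.
Proof.
suff H : D%:R <= 2 * (3 / 2) ^+ D :> R.
  have -> : (3 / 4) = (3 / 2) * 2^-1 :> R by field.
  rewrite exprMn mulrA ler_wpM2r// exprn_ge0// invr_ge0//.
suff : 1 + D%:R / 2 <= (3 / 2) ^+ D :> R by lra.
elim: D => [|D ih]; first by rewrite mul0r addr0 expr0.
rewrite exprS -natr1; have : 0 <= D%:R :> R by []. nra.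
Qed.

Lemma sum_geom34 J : \sum_(m < J) (3 / 4) ^+ m <= 4 :> R.
Proof.
suff : \sum_(m < J) (3 / 4) ^+ m = 4 - 4 * (3 / 4) ^+ J :> R.
  move=> ->; have : 0 <= (3 / 4 : R) ^+ J by rewrite exprn_ge0//; lra.
  lra.
elim: J => [|J ih]; first by rewrite big_ord0 expr0; lra.
by rewrite big_ord_recr/= ih exprS; field.
Qed.

Lemma sqrt_div (a c : R) : 0 < a -> 1 <= c -> Num.sqrt (a / c) = Num.sqrt a / Num.sqrt c.
Proof. by move=> a0 c1; rewrite sqrtrM ?(ltW a0)// sqrtrV//; lra. Qed.

(** The power of 3 makes the balancing scale at least 3, so that a dyadic level exists below it; the
    second summand lets a power of [n] dominate [b * log n] in [log_term]. *)
Definition threshold (beta d : nat) (b : R) : R :=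
  3 ^+ (2 * beta + d) + ((4 * `|b| * (2 * beta + d)%:R) ^+ 2) ^+ (2 * beta + d).

Definition rate (beta d : nat) (N s : R) : R :=
  Num.max (N `^ (- (2 * beta%:R) / (2 * beta%:R + d%:R)))
          (s `^ (- (2 * beta%:R) / (beta%:R + d%:R))).

Lemma rateE beta d (N s : R) : rate beta d N s =
  Num.max ((N `^ (2 * beta + d)%:R^-1) ^+ (2 * beta))^-1
          ((s `^ (beta + d)%:R^-1) ^+ (2 * beta))^-1.
Proof. by rewrite /rate -!natrM -!natrD !root_expN. Qed.

(** [x] is the smaller of [N^(1 / (2 beta + d))] and [s^(1 / (beta + d))], the largest scale at
    which both the sampling variance [x^d / N] and the noise variance [x^(2 d) / s^2] stay below the
    squared bias [x^(- 2 beta)]. *)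
Lemma exists_scale beta d (N s : R) : (0 < d)%N ->
  3 ^+ (2 * beta + d) <= N -> 3 ^+ (2 * beta + d) <= s ->
  exists x : R, [/\ 3 <= x, x ^+ (2 * beta + d) <= N, x ^+ (beta + d) <= s &
    (x ^+ (2 * beta))^-1 <= rate beta d N s].
Proof.
move=> d0 hN hs.
have k1 : (0 < 2 * beta + d)%N by rewrite addn_gt0 d0 orbT.
have k2 : (0 < beta + d)%N by rewrite addn_gt0 d0 orbT.
have p0 : 0 < 3 ^+ (2 * beta + d) :> R by rewrite exprn_gt0//; lra.
have N0 : 0 < N by lra.
have s0 : 0 < s by lra.
rewrite rateE; have := root_exp N0 k1; have := root_exp s0 k2.
have : 3 <= N `^ (2 * beta + d)%:R^-1 by apply: le_root => //; lra.
have : 3 <= s `^ (beta + d)%:R^-1.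
  apply: le_root => //.
  by apply: le_trans hs; rewrite ler_eXn2l//; [lia|lra].
move: (s `^ _) (N `^ _) => ys yN ys3 yN3 ysE yNE.
exists (Num.min yN ys); split.
- by rewrite le_min yN3.
- rewrite -yNE lerXn2r ?nnegrE ?ge_min ?lexx//; last by lra.
  by rewrite le_min; apply/andP; split; lra.
- rewrite -ysE lerXn2r ?nnegrE ?ge_min ?lexx ?orbT//; last by lra.
  by rewrite le_min; apply/andP; split; lra.
- by rewrite /Num.min; case: ifP => _; rewrite le_max lexx ?orbT.
Qed.

(** With [v = x^(- 2 beta)], every term except the logarithmic one is a multiple of [v]. The
    constant is [6516 = 9 * (96 + 112) + 36 * (1 + 128)], the 1 being the logarithmic term. *)
Lemma numeric_core (beta d J m : nat) (N s rho l x b L r : R) (D : nat -> nat) :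
  3 <= N -> 1 <= l -> 0 < rho -> J.+1%:R <= l -> 0 < s -> s ^+ 2 = N ^+ 2 * rho / l ->
  3 <= x -> x ^+ (2 * beta + d) <= N -> x ^+ (beta + d) <= s ->
  (x ^+ (2 * beta))^-1 <= r -> l * (`|b| / (10 * N)) <= r ->
  x <= 4 * (expn 2 m).+1%:R -> (D m)%:R <= x ^+ d -> (forall i, i <= D i)%N ->
  18 * (L ^+ 2 / (2 * pi * (expn 2 m).+1%:R) ^+ (2 * beta)) +
    9 * (96 * (D m)%:R / N + 112 * (D m)%:R ^+ 2 / (N ^+ 2 * (rho / J.+1%:R))) +
    36 * \sum_(i < J.+1) (b / (10 * N) +
      4 * (D i)%:R / (N ^+ 2 * (rho / J.+1%:R)) * (4 * 2^-1 ^+ D i)) <=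
  (18 * L ^+ 2 + 6516) * r.
Proof.
move=> N3 l1 rho0 Jl sp s2 x3 xN xs xr lt xm2 Dx mD.
have e1 : (2 * beta <= (beta + d) * 2)%N by clear; lia.
have e2 : (d * 2 + 2 * beta <= (beta + d) * 2)%N by clear; lia.
have xp : 0 < x by lra.
have x1 : 1 < x by lra.
have Np : 0 < N by lra.
have lp : 0 < l by lra.
(* Compensates the factor 4 of dyadic rounding in [x <= 4 * (2^m + 1)], so no power [4^(2 beta)]
   enters the bias. *)
have pi4 : 4 <= 2 * pi :> R by have := @pi_ge2 R; lra.
have x0 p : 0 < x ^+ p by rewrite exprn_gt0.
have J0 : 0 < J.+1%:R :> R by [].
have xs2 : (x ^+ (beta + d)) ^+ 2 <= s ^+ 2 by rewrite lerXn2r ?nnegrE// ltW.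
have [v vE] : {v | v = (x ^+ (2 * beta))^-1} by exists (x ^+ (2 * beta))^-1.
have [q qE] : {q | q = (N ^+ 2 * (rho / J.+1%:R))^-1} by exists (N ^+ 2 * (rho / J.+1%:R))^-1.
have v0 : 0 < v by rewrite vE invr_gt0.
have q0 : 0 <= q by rewrite qE invr_ge0 mulr_ge0 ?sqr_ge0// divr_ge0// ltW.
have den : q <= (s ^+ 2)^-1.
  rewrite qE lef_pV2 ?posrE ?exprn_gt0// ?mulr_gt0 ?divr_gt0 ?exprn_gt0//.
  by rewrite s2 -mulrA ler_wpM2l ?sqr_ge0// ler_wpM2l ?(ltW rho0)// lef_pV2 ?posrE.
have s2v : (s ^+ 2)^-1 <= v.
  rewrite vE lef_pV2 ?posrE ?exprn_gt0//; apply: le_trans xs2.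
  by rewrite -exprM ler_eXn2l.
have t1 : L ^+ 2 / (2 * pi * (expn 2 m).+1%:R) ^+ (2 * beta) <= L ^+ 2 * v.
  have px : x <= 2 * pi * (expn 2 m).+1%:R by apply: (le_trans xm2); rewrite ler_wpM2r.
  have px0 : 0 < 2 * pi * (expn 2 m).+1%:R :> R by exact: lt_le_trans xp px.
  rewrite vE ler_wpM2l ?sqr_ge0// lef_pV2 ?posrE ?exprn_gt0//.
  by apply: lerXn2r => //; rewrite nnegrE ltW.
have t2 : (D m)%:R / N <= v.
  apply: (@le_trans _ _ (x ^+ d / N)); first by rewrite ler_wpM2r// invr_ge0 ltW.
  by rewrite ler_pdivrMr// mulrC vE ler_pdivlMr// -exprD addnC.
have t3 : (D m)%:R ^+ 2 * q <= v.
  apply: (@le_trans _ _ ((x ^+ d) ^+ 2 * (s ^+ 2)^-1)).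
    by apply: ler_pM => //; rewrite lerXn2r ?nnegrE// ltW.
  rewrite ler_pdivrMr ?exprn_gt0// mulrC vE ler_pdivlMr//; apply: le_trans xs2.
  by rewrite -!exprM -exprD ler_eXn2l.
(* [128 = 16 * 2 * 4]: the product of the two factors 4, the 2 of [mul_half_pow], and the geometric
   series, which converges since [i <= D i]. *)
have t4 : \sum_(i < J.+1) 4 * (D i)%:R * q * (4 * 2^-1 ^+ D i) <= 128 * v.
  apply: (@le_trans _ _ (\sum_(i < J.+1) (32 * (s ^+ 2)^-1) * (3 / 4) ^+ i)).
    apply: ler_sum => i _; have h1 := mul_half_pow (D i).
    have h2 : (3 / 4) ^+ D i <= (3 / 4) ^+ i :> R.
      by apply: ler_wiXn2l; [lra|lra|exact: mD].
    have h3 : (D i)%:R * 2^-1 ^+ D i <= 2 * (3 / 4) ^+ i :> R.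
      by apply: (le_trans h1); rewrite ler_wpM2l.
    have h5 : 0 <= (D i)%:R * 2^-1 ^+ D i :> R by rewrite mulr_ge0// exprn_ge0// invr_ge0.
    rewrite (_ : 4 * (D i)%:R * q * _ = 16 * (q * ((D i)%:R * 2^-1 ^+ D i))); last by ring.
    rewrite (_ : 32 * _ * _ = 16 * ((s ^+ 2)^-1 * (2 * (3 / 4) ^+ i))); last first.
      by move: (_^-1) ((3 / 4) ^+ i) => ? ?; ring.
    by rewrite ler_wpM2l// ler_pM.
  rewrite -mulr_sumr; apply: (@le_trans _ _ (32 * (s ^+ 2)^-1 * 4)).
    by rewrite ler_wpM2l ?sum_geom34// mulr_ge0// invr_ge0 sqr_ge0.
  by move: s2v; clear; move: (_^-1) => ?; lra.
have t5 : \sum_(i < J.+1) b / (10 * N) <= r.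
  rewrite sumr_const card_ord -[leLHS]mulr_natl; apply: le_trans lt.
  have den0 : 0 <= (10 * N)^-1 by rewrite invr_ge0 mulr_ge0// ltW.
  apply: (@le_trans _ _ (J.+1%:R * (`|b| / (10 * N)))).
    by apply: ler_wpM2l => //; apply: ler_wpM2r => //; exact: ler_norm.
  by apply: ler_wpM2r => //; rewrite mulr_ge0.
rewrite -vE in xr.
have t6 : L ^+ 2 * v <= L ^+ 2 * r by rewrite ler_wpM2l ?sqr_ge0.
rewrite big_split/= -!(mulrA 96) -!(mulrA 112) -qE.
move: t1 t2 t3 t4 t5 t6 xr; clear.
move: (L ^+ 2 / _) ((D m)%:R / _) ((D m)%:R ^+ 2 * _) (\sum_(_ < _) _) (\sum_(_ < _) _).
move=> a1 a2 a3 a4 a5; rewrite (_ : (18 * L ^+ 2 + 6516) * r = 18 * (L ^+ 2 * r) + 6516 * r);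
  last by ring.
move: (L ^+ 2 * v) (L ^+ 2 * r) => z1 z2.
lra.
Qed.

Section bound.
Variables (beta d n : nat) (rho b : R).
Hypothesis d0 : (0 < d)%N.
Hypothesis rho0 : 0 < rho.
Local Notation N := (n%:R : R).
Local Notation l := (log2 N).
Local Notation s := (N * Num.sqrt rho / Num.sqrt l).
Hypothesis hN : threshold beta d b <= N.
Hypothesis hs : threshold beta d b <= N * Num.sqrt (rho / l).

Lemma threshold_pow3 : 3 ^+ (2 * beta + d) <= threshold beta d b.
Proof. by rewrite lerDl exprn_ge0// sqr_ge0. Qed.

Lemma N_ge3 : 3 <= N.
Proof.
apply: le_trans hN; apply: le_trans threshold_pow3.
by rewrite -[leLHS]expr1 ler_eXn2l//; [lia|lra].
Qed.

Lemma l_ge1 : 1 <= l.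
Proof. by rewrite (log2_pow 1) ?expr1; have := N_ge3; lra. Qed.

Lemma s_ge : 3 ^+ (2 * beta + d) <= s.
Proof.
rewrite -mulrA -sqrt_div ?l_ge1//; apply: le_trans hs; exact: threshold_pow3.
Qed.

(** [2 * 2^J <= n^(1 / d) - 1] gives [2^(J + 1) <= n], so the number of levels is at most
    [log2 n]. *)
Lemma Jmax_le : (Jmax R n d).+1%:R <= l.
Proof.
have N3 := N_ge3; have N0 : 0 < N by lra.
have y3 : 3 <= N `^ d%:R^-1.
  apply: le_root => //; apply: le_trans hN; apply: le_trans threshold_pow3.
  by rewrite ler_eXn2l//; [lia|lra].
have y1 : 1 <= (N `^ d%:R^-1 - 1) / 2 by lra.
rewrite log2_pow// exprS; have := trunc_log2_le y1; rewrite -/(Jmax R n d).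
move: (Jmax R n d) => J h; apply: (@le_trans _ _ (N `^ d%:R^-1)); first by lra.
by rewrite -[leRHS](root_exp N0 d0) -[leLHS]expr1 ler_eXn2l//; lra.
Qed.

(** [x^d <= x^(2 beta + d) <= n], so the level of scale [x] is among those of the procedure. *)
Lemma scale_level (x : R) : 3 <= x -> x ^+ (2 * beta + d) <= N ->
  (Num.truncn (log2 ((x - 1) / 2)) < (Jmax R n d).+1)%N.
Proof.
move=> x3 xN; have N3 := N_ge3.
have xd : x <= N `^ d%:R^-1.
  apply: le_root => //; [by lra|by lra|].
  by apply: le_trans xN; rewrite ler_eXn2l//; [lia|lra].
rewrite ltnS /Jmax; apply: le_truncn; rewrite /log2 ler_wpM2r//.
  by rewrite invr_ge0; have := ln2_ge; lra.
by rewrite ler_ln ?posrE; lra.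
Qed.

(** Put [y = n^(1 / k)] with [k = 2 beta + d]. Sublinearity of [ln] at [sqrt y] gives
    [log2 n <= 4 k sqrt y], and the threshold gives [4 |b| k <= sqrt y]; so
    [|b| log2 n <= y <= y^d], the margin between [1 / n] and the rate. *)
Lemma log_term : l * (`|b| / (10 * N)) <= rate beta d N s.
Proof.
have N3 := N_ge3; have N0 : 0 < N by lra.
have k1 : (0 < 2 * beta + d)%N by rewrite addn_gt0 d0 orbT.
rewrite rateE le_max; apply/orP; left.
have c0 : 0 <= (4 * `|b| * (2 * beta + d)%:R) ^+ 2 by exact: sqr_ge0.
have : (4 * `|b| * (2 * beta + d)%:R) ^+ 2 <= N `^ (2 * beta + d)%:R^-1.
  apply: le_root => //; apply: le_trans hN; rewrite lerDr exprn_ge0//; lra.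
have : 3 <= N `^ (2 * beta + d)%:R^-1.
  by apply: le_root => //; apply: le_trans hN; exact: threshold_pow3.
have := root_exp N0 k1; move: (N `^ _) => y yN y3 yb.
have y0 : 0 < y by lra.
have yp0 p : 0 < y ^+ p by rewrite exprn_gt0.
have lE : l = (2 * beta + d)%:R * (ln y / ln 2).
  by rewrite /log2 -yN lnXn// -[ln y *+ _]mulr_natl mulrA.
set k := (2 * beta + d)%:R in lE yb *.
have lny : ln y <= 2 * Num.sqrt y.
  rewrite -{1}(@sqr_sqrtr _ y) ?(ltW y0)// lnXn ?sqrtr_gt0// -[leLHS]mulr_natl.
  by rewrite ler_wpM2l// ltW// ln_sublinear// sqrtr_gt0.
have ll : l <= 4 * k * Num.sqrt y.
  rewrite lE (_ : 4 * k * _ = k * (4 * Num.sqrt y)); last by ring.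
  apply: ler_wpM2l; first exact: ler0n.
  rewrite ler_pdivrMr; last by have := ln2_ge; lra.
  have := ln2_ge; have := sqrtr_ge0 y; nra.
have k0 : 0 <= k by exact: ler0n.
have lb : l * `|b| <= y.
  apply: (@le_trans _ _ (4 * k * Num.sqrt y * `|b|)); first by rewrite ler_wpM2r.
  rewrite -[leRHS](@sqr_sqrtr _ y) ?(ltW y0)// expr2 (_ : _ * `|b| = (4 * `|b| * k) * Num.sqrt y);
    last by ring.
  rewrite ler_wpM2r ?sqrtr_ge0// -(@ler_pXn2r _ 2)// ?nnegrE ?sqrtr_ge0//.
    by rewrite sqr_sqrtr// ltW.
  by rewrite !mulr_ge0.
move: lb; move: (log2 _) => lv lb.
rewrite -yN exprD [leLHS]mulrA ler_pdivrMr; last by rewrite !mulr_gt0.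
rewrite (_ : _ * (10 * _) = 10 * y ^+ d); last by field; rewrite gt_eqF.
apply: (le_trans lb); have : y <= y ^+ d by rewrite -[leLHS]expr1 ler_eXn2l//; lra.
by lra.
Qed.

Lemma numeric_bound (L : R) : exists m : 'I_(Jmax R n d).+1,
  18 * (L ^+ 2 / (2 * pi * (expn 2 m).+1%:R) ^+ (2 * beta)) +
    9 * Lambda2 n d rho (Jmax R n d).+1 (expn 2 m) +
    36 * \sum_(m' < (Jmax R n d).+1) (b / (10 * N) +
      sig2 rho m' * (4 * 2^-1 ^+ (expn (2 * expn 2 m' + 1) d))) <=
  (18 * L ^+ 2 + 6516) * rate beta d N s.
Proof.
have [x [x3 xN xs xr]] := exists_scale d0 (le_trans threshold_pow3 hN) s_ge.
have l1 := l_ge1; have l0 : 0 <= l by lra.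
have xp : 0 <= x by lra.
have [xm1 xm2] := dyadic_level x3.
exists (Ordinal (scale_level x3 xN)); rewrite Lambda2E.
have sp : 0 < s by apply: lt_le_trans s_ge; rewrite exprn_gt0.
apply: (@numeric_core beta d _ _ N s rho l x b L _ (fun m => expn (2 * expn 2 m + 1) d)) => //.
- exact: N_ge3.
- exact: Jmax_le.
- by rewrite !expr_div_n exprMn !sqr_sqrtr ?(ltW rho0).
- exact: log_term.
- by rewrite natrX lerXn2r ?nnegrE.
- move=> i; apply: (@leq_trans (2 * expn 2 i + 1)).
    by have := ltn_expl i (ltnSn 1); clear; lia.
  by rewrite -[leqLHS]expn1 leq_pexp2l// addn1.
Qed.

End bound.
End rates.

(** * Privacy *)

Section renyi_divergence_bound.
Context (R : realType) dS (S : measurableType dS) (mu nu : probability S R).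
Context dT (T : measurableType dT) (P : probability T R).
Variables (Y : T -> S) (W : T -> R) (alpha K : R).
Hypotheses (mY : measurable_fun [set: T] Y) (mW : measurable_fun [set: T] W).
Hypothesis W0 : forall t, 0 <= W t.
Hypothesis muE : forall A, measurable A ->
  mu A = (\int[P]_t ((\1_A (Y t))%:E * (W t)%:E))%E.
Hypothesis nuE : forall A, measurable A -> nu A = P (Y @^-1` A).
Hypothesis alpha1 : 1 < alpha.
Hypothesis WK : (\int[P]_t (W t `^ alpha)%:E <= K%:E)%E.

(** This version of the derivative is nonnegative and finite at every point, not just almost
    everywhere; [renyi_le] returns to the version used in [renyi_div]. *)
Let RN := Radon_Nikodym_SigmaFinite.f mu nu.
Let h s : R := fine (RN s).

Lemma density_dominates : mu `<< nu.
Proof.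
apply/null_content_dominatesP => A mA nuA0; rewrite muE//.
have mYA : measurable (Y @^-1` A) by rewrite -[_ @^-1` _]setTI; exact: mY.
have -> : (\int[P]_t ((\1_A (Y t))%:E * (W t)%:E) = \int[P]_(t in Y @^-1` A) (W t)%:E)%E.
  rewrite [RHS]integral_mkcond; apply: eq_integral => t _; rewrite patchE indicE.
  have -> : (t \in Y @^-1` A) = (Y t \in A) by apply/idP/idP; rewrite !inE.
  by case: ifP => _; rewrite ?mul1e ?mul0e.
have P0 : P (Y @^-1` A) = 0 by rewrite -[LHS]nuE.
apply: (null_set_integral mYA _ P0).
by apply/measurable_EFinP; exact: measurable_funTS.
Qed.

Let dom := density_dominates.

Let RN0 s : (0 <= RN s)%E. Proof. exact: (Radon_Nikodym_SigmaFinite.f_ge0 dom). Qed.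

Let hE s : (h s)%:E = RN s.
Proof. by rewrite fineK//; exact: (Radon_Nikodym_SigmaFinite.f_fin_num dom). Qed.

Let h0 s : 0 <= h s. Proof. by rewrite -lee_fin hE. Qed.

Let mRN : measurable_fun [set: S] RN.
Proof. exact: measurable_int (Radon_Nikodym_SigmaFinite.f_integrable dom). Qed.

Let mh : measurable_fun [set: S] h.
Proof. by apply/measurable_EFinP; rewrite (_ : EFin \o h = RN)//; apply/funext => s /=. Qed.

Let u (n : nat) s : R := Num.min (h s) n%:R.

Let u0 n s : 0 <= u n s. Proof. by rewrite /u le_min h0/=. Qed.

Let bu n (a : R) : 0 <= a -> bm (fun s => u n s `^ a).
Proof.
move=> a0; split.
  by apply: (measurableT_comp (measurable_powR _)); exact: measurable_minr.
exists (n%:R `^ a) => s; rewrite ger0_norm ?powR_ge0//.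
by apply: ge0_ler_powR; rewrite ?nnegrE// /u ge_min lexx orbT.
Qed.

Let ge0_integral_nu (k : S -> \bar R) : measurable_fun [set: S] k -> (forall s, 0 <= k s)%E ->
  (\int[nu]_s k s = \int[P]_t k (Y t))%E.
Proof.
move=> mk k0; rewrite -(ge0_integral_law P mY)//.
by apply: eq_measure_integral => A mA _; exact: nuE.
Qed.

(* Young's inequality replaces Hoelder's: the truncated moment satisfies
   A <= (1 - alpha^-1) A + K / alpha *)
Let truncated_moment n : (\int[nu]_s (u n s `^ alpha)%:E <= K%:E)%E.
Proof.
have a0 : 0 < alpha by exact: lt_trans alpha1.
have b1 : 0 < alpha - 1 by rewrite subr_gt0.
have b0 := ltW b1.
set q := alpha / (alpha - 1).
have q0 : 0 < q by exact: divr_gt0.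
have bu1 := bu n (ltW a0); have bu2 := bu n b0.
set A := \int[nu]_s (u n s `^ alpha).
have AE : (\int[nu]_s (u n s `^ alpha)%:E = A%:E)%E by exact: EFin_Rint.
have step1 : (\int[nu]_s (u n s `^ alpha)%:E <= \int[mu]_s (u n s `^ (alpha - 1))%:E)%E.
  have mu2 : measurable_fun [set: S] (fun s => (u n s `^ (alpha - 1))%:E).
    by apply/measurable_EFinP; exact: bu2.1.
  rewrite -(Radon_Nikodym_SigmaFinite.change_of_variables dom _ measurableT mu2); last first.
    by move=> s; rewrite lee_fin powR_ge0.
  apply: ge0_le_integral => //.
  - by move=> s _; rewrite lee_fin powR_ge0.
  - by apply/measurable_EFinP; exact: bu1.1.
  - by apply: emeasurable_funM.
  move=> s _; rewrite -/RN -hE -EFinM lee_fin.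
  have [->|un0] := eqVneq (u n s) 0.
    by rewrite powR0 ?gt_eqF// mulr_ge0// powR_ge0.
  have -> : u n s `^ alpha = u n s `^ (alpha - 1) * u n s.
    transitivity (u n s `^ (alpha - 1) * u n s `^ 1); last by rewrite powRr1.
    by rewrite -powRD ?subrK// un0 implybT.
  by rewrite ler_wpM2l ?powR_ge0// /u ge_min lexx.
have step2 : (\int[mu]_s (u n s `^ (alpha - 1))%:E =
    \int[P]_t (u n (Y t) `^ (alpha - 1) * W t)%:E)%E.
  rewrite (integral_change_of_density mY mW W0 muE)//.
    by apply/measurable_EFinP; exact: bu2.1.
  by move=> s; rewrite lee_fin powR_ge0.
have step3 : (\int[P]_t (u n (Y t) `^ (alpha - 1) * W t)%:E <=
    \int[P]_t ((alpha^-1)%:E * (W t `^ alpha)%:E + (q^-1)%:E * (u n (Y t) `^ alpha)%:E))%E.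
  apply: le_ge0_integral => t; first by rewrite lee_fin mulr_ge0// powR_ge0.
  rewrite -!EFinM -EFinD lee_fin mulrC.
  apply: le_trans (conjugate_powR (W0 t) (powR_ge0 _ _) a0 q0 _) _.
    by rewrite /q invf_div; field; rewrite gt_eqF.
  rewrite mulrC lerD2l mulrC ler_wpM2l ?invr_ge0 ?(ltW q0)//.
  by rewrite -powRrM /q mulrCA divff ?mulr1// gt_eqF.
have mWa : measurable_fun [set: T] (fun t => (W t `^ alpha)%:E).
  by apply/measurable_EFinP; exact: (measurableT_comp (measurable_powR _)).
have mua : measurable_fun [set: T] (fun t => (u n (Y t) `^ alpha)%:E).
  by apply/measurable_EFinP; exact: (measurableT_comp bu1.1 mY).
have step4 : (\int[P]_t ((alpha^-1)%:E * (W t `^ alpha)%:E + (q^-1)%:E * (u n (Y t) `^ alpha)%:E)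
    <= (alpha^-1 * K + q^-1 * A)%:E)%E.
  rewrite ge0_integralD//; last 4 first.
  - by move=> t _; rewrite mule_ge0// lee_fin ?powR_ge0// invr_ge0 ltW.
  - exact: measurable_funeM.
  - by move=> t _; rewrite mule_ge0// lee_fin ?powR_ge0// invr_ge0 ltW.
  - exact: measurable_funeM.
  rewrite !ge0_integralZl ?lee_fin ?invr_ge0 ?(ltW a0) ?(ltW q0)//; last 2 first.
  - by move=> t _; rewrite lee_fin powR_ge0.
  - by move=> t _; rewrite lee_fin powR_ge0.
  rewrite EFinD !EFinM; apply: leeD.
    by apply: lee_wpmul2l => //; rewrite lee_fin invr_ge0 ltW.
  rewrite -AE (@ge0_integral_nu (fun s => (u n s `^ alpha)%:E))//.
    by apply/measurable_EFinP; exact: bu1.1.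
  by move=> s; rewrite lee_fin powR_ge0.
rewrite step2 in step1; have := le_trans step1 (le_trans step3 step4).
rewrite AE !lee_fin /q invf_div => H.
have : A - (alpha - 1) / alpha * A <= alpha^-1 * K by lra.
have -> : A - (alpha - 1) / alpha * A = alpha^-1 * A by field; rewrite gt_eqF.
by rewrite ler_pM2l// invr_gt0.
Qed.

(** Truncation made the moment finite, so that the Young inequality could be solved for it; the
    bound does not depend on [n], and monotone convergence removes the truncation. *)
Lemma moment_le : (\int[nu]_s (h s `^ alpha)%:E <= K%:E)%E.
Proof.
have a0 : 0 < alpha by exact: lt_trans alpha1.
have cv : (\int[nu]_s (u n s `^ alpha)%:E)%E @[n --> \oo] --> (\int[nu]_s (h s `^ alpha)%:E)%E.
  have -> : (\int[nu]_s (h s `^ alpha)%:E)%E =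
      (\int[nu]_s (limn (fun n => (u n s `^ alpha)%:E)))%E.
    apply: eq_integral => s _; apply/esym/cvg_lim => //; apply: cvg_near_cst.
    near=> n; congr (_ `^ _)%:E; apply/min_idPl; apply: ltW; near: n.
    exact: nbhs_infty_gtr.
  apply: cvg_monotone_convergence => //.
  - by move=> n; apply/measurable_EFinP; exact: (bu n (ltW a0)).1.
  - by move=> n s _; rewrite lee_fin powR_ge0.
  - move=> s _ m n mn; rewrite lee_fin; apply: ge0_ler_powR; rewrite ?nnegrE ?(ltW a0)//.
    exact: min_nd.
rewrite -(cvg_lim _ cv)//; apply: lime_le; first by apply/cvg_ex; eexists; exact: cv.
by near=> n; exact: truncated_moment.
Unshelve. all: by end_near. Qed.

Lemma renyi_le : 1 <= K -> (renyi_div alpha mu nu <= ((alpha - 1)^-1 * ln K)%:E)%E.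
Proof.
move=> K1; rewrite /renyi_div asboolT; last exact: dom.
have -> : (\int[nu]_s (fine (Radon_Nikodym (charge_of_finite_measure mu) nu s) `^ alpha)%:E =
    \int[nu]_s (h s `^ alpha)%:E)%E.
  apply: ae_eq_integral => //.
  - apply/measurable_EFinP; apply: (measurableT_comp (measurable_powR _)).
    exact: measurableT_comp.
  - by apply/measurable_EFinP; exact: (measurableT_comp (measurable_powR _)).
  have := ae_eq_Radon_Nikodym_SigmaFinite dom measurableT.
  by apply: filterS => s /= E /E <-.
have mle := moment_le.
have m0 : (0 <= \int[nu]_s (h s `^ alpha)%:E)%E.
  by apply: integral_ge0 => s _; rewrite lee_fin powR_ge0.
case: (\int[nu]_s _)%E mle m0 => [r| |] //=; rewrite !lee_fin => rK r0.
apply: ler_wpM2l; first by rewrite invr_ge0 subr_ge0 ltW.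
(* A moment at most 1, including 0 where [ln] takes a default value, has [ln] at most 0; this is
   where [1 <= K] is used. *)
have [r1|/ltW r1] := leP r 1; last by rewrite ler_ln ?posrE ?(lt_le_trans ltr01).
by apply: le_trans (ln_ge0 K1); rewrite ln_le0.
Qed.

End renyi_divergence_bound.

Section weighted_law.
Context (R : realType) dS (S : measurableType dS) dT (T : measurableType dT).
Variables (P : probability T R) (Y : T -> S) (W : T -> R).
Hypotheses (mY : measurable_fun [set: T] Y) (mW : measurable_fun [set: T] W).
Hypothesis W0 : forall t, 0 <= W t.

(** The law of [Y] under the weight [W], a measure whose mass is not assumed to be 1. The proofs are
    arguments so that the measure structure can be attached to the constant. *)
Definition wlaw of measurable_fun [set: T] Y & measurable_fun [set: T] W &
    (forall t, 0 <= W t) := fun B : set S => (\int[P]_(t in Y @^-1` B) (W t)%:E)%E.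

Local Notation wl := (wlaw mY mW W0).

Let wlaw0 : wl set0 = 0%E.
Proof. by rewrite /wlaw preimage_set0 integral_set0. Qed.

Let wlaw_ge0 A : (0 <= wl A)%E.
Proof. by apply: integral_ge0 => t _; rewrite lee_fin. Qed.

Let mpre A : measurable A -> measurable (Y @^-1` A).
Proof. by move=> mA; rewrite -[_ @^-1` _]setTI; exact: mY. Qed.

Let wlaw_sigma_additive : semi_sigma_additive wl.
Proof.
move=> /= F mF tF mUF; rewrite /wlaw preimage_bigcup ge0_integral_bigcup//.
- by apply: is_cvg_ereal_nneg_natsum_cond => n _ _; exact: wlaw_ge0.
- by move=> k; exact: mpre.
- by apply/measurable_EFinP; exact: measurable_funTS.
- by move=> t _; rewrite lee_fin.
- apply/trivIsetP => i j _ _ ij; rewrite -preimage_setI.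
  by move/trivIsetP : tF => /(_ i j I I ij) ->; rewrite preimage_set0.
Qed.

HB.instance Definition _ := isMeasure.Build _ _ _ wl wlaw0 wlaw_ge0 wlaw_sigma_additive.

Lemma wlawE A : measurable A -> wl A = (\int[P]_t ((\1_A (Y t))%:E * (W t)%:E))%E.
Proof.
move=> mA; rewrite /wlaw integral_mkcond; apply: eq_integral => t _; rewrite patchE indicE.
have -> : (t \in Y @^-1` A) = (Y t \in A) by apply/idP/idP; rewrite !inE.
by case: ifP => _; rewrite ?mul1e ?mul0e.
Qed.

End weighted_law.

(** * The Cameron--Martin formula for Gaussian vectors *)

Section boxes.
Context (R : realType) (N : nat).

Definition box (A : 'I_N -> set (measurableTypeR R)) : set (bRV R N) :=
  [set v | forall i, A i ((v : 'rV[R]_N) ord0 i)].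

Definition boxes : set (set (bRV R N)) :=
  [set B | exists2 A, (forall i, measurable (A i)) & B = box A].

Lemma measurable_box A : (forall i, measurable (A i)) -> measurable (box A).
Proof.
move=> mA; have -> : box A = \bigcap_(i in [set: 'I_N])
    ((fun v : bRV R N => (v : 'rV[R]_N) ord0 i) @^-1` A i).
  by apply/seteqP; split => [v Av i _|v Av i]; [exact: Av|exact: (Av i I)].
apply: fin_bigcap_measurable => // i _.
by have := @coord_measurable_bRV R N i measurableT (A i) (mA i); rewrite setTI.
Qed.

(** Coordinates are measurable for the sigma-algebra of boxes, so by [measurable_bRV] the identity
    map into the Borel structure is measurable from it. *)
Lemma measurable_boxes : @measurable _ (bRV R N) = <<s boxes >>.
Proof.
apply/seteqP; split.
  have mid : measurable_fun [set: g_sigma_algebraType boxes]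
      (id : g_sigma_algebraType boxes -> bRV R N).
    apply: measurable_bRV => i _ A mA; rewrite setTI.
    apply: sub_sigma_algebra; exists (fun j => if j == i then A else setT).
      by move=> j; case: eqP.
    apply/seteqP; split => [v Av j /=|v /(_ i)]; last by rewrite /= eqxx.
    by case: eqP => // ->.
  by move=> B mB; have := mid measurableT B mB; rewrite setTI.
apply: smallest_sub; first exact: sigma_algebra_measurable.
by move=> _ [A mA ->]; exact: measurable_box.
Qed.

Lemma boxes_setI : setI_closed boxes.
Proof.
move=> _ _ [A mA ->] [B mB ->]; exists (fun i => A i `&` B i).
  by move=> i; exact: measurableI.
apply/seteqP; split => [v [Av Bv] i|v ABv]; first by split.
by split=> i; case: (ABv i).
Qed.

Lemma boxes_setT : boxes setT.
Proof. by exists (fun=> setT) => //; apply/seteqP; split. Qed.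

End boxes.

Section cameron_martin.
Context (R : realType) dT (T : measurableType dT) (P : probability T R) (N : nat).
Variables (Z : 'I_N -> T -> measurableTypeR R) (dl : 'I_N -> R).
Hypothesis mZ : forall j, measurable_fun [set: T] (Z j).
Hypothesis indZ : indep_family P Z.
Hypothesis lawZ : forall j A, measurable A -> P (Z j @^-1` A) = N01 R A.

Definition zvec (a : 'I_N -> R) t : bRV R N := \row_j ((Z j t : R) + a j).

Lemma measurable_zvec a : measurable_fun [set: T] (zvec a).
Proof.
apply: measurable_bRV => i.
rewrite [X in measurable_fun _ X](_ : _ = fun t => (Z i t : R) + a i).
  by apply: measurable_funD => //; exact: mZ.
by apply/funext => t; rewrite mxE.
Qed.

(** The likelihood ratio of [N(dl j, 1)] with respect to [N(0, 1)]. *)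
Definition cm_factor j (x : R) : R := expR (dl j * x - dl j ^+ 2 / 2).

Definition cm_density t : R := \prod_j cm_factor j (Z j t).

Lemma measurable_cm_factor j : measurable_fun [set: measurableTypeR R] (cm_factor j).
Proof.
by apply: measurableT_comp => //; apply: measurable_funB => //; exact: measurable_funM.
Qed.

Lemma measurable_cm_density : measurable_fun [set: T] cm_density.
Proof.
by apply: measurable_prod => j _; exact: (measurableT_comp (measurable_cm_factor j) (mZ j)).
Qed.

Lemma cm_density_ge0 t : 0 <= cm_density t.
Proof. by apply: prodr_ge0 => j _; exact: expR_ge0. Qed.

Lemma indic_box (A : 'I_N -> set (measurableTypeR R)) a t :
  \1_(box A) (zvec a t) = \prod_j \1_(A j) ((Z j t : R) + a j) :> R.
Proof.
have [H|H] := pselect (box A (zvec a t)).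
  rewrite indicE mem_set// big1// => j _; rewrite indicE mem_set//.
  by have := H j; rewrite mxE.
rewrite indicE memNset//.
have [j Hj] : exists j, ~ A j ((Z j t : R) + a j).
  by apply: contrapT => HA; apply: H => j; rewrite mxE; apply: contrapT => HN; apply: HA; exists j.
by rewrite (bigD1 j)//= indicE memNset ?mul0r.
Qed.

(** Both sides are measures in [B], so agreement on the boxes, a generating family stable under
    intersection, is enough. On a box the integrands factor over coordinates, and independence
    reduces the claim to the one-dimensional translation formula. *)
Lemma cameron_martin B : measurable B ->
  P (zvec dl @^-1` B) =
  (\int[P]_t ((\1_B (zvec (fun=> 0) t))%:E * (cm_density t)%:E))%E.
Proof.
have mz := measurable_zvec (fun=> 0).
move=> mB; rewrite -(wlawE P mz measurable_cm_density cm_density_ge0 mB).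
rewrite -(lawE P (measurable_zvec dl)).
apply: (measure_unique (@boxes R N) (fun=> setT)) => //.
- exact: measurable_boxes.
- exact: boxes_setI.
- by move=> _; exact: boxes_setT.
- by rewrite bigcup_const.
- move=> _ [A mA ->].
  have mbox := measurable_box mA.
  pose sh j (x : measurableTypeR R) : measurableTypeR R := (x : R) + dl j.
  pose h1 j (x : measurableTypeR R) : R := \1_(A j) (sh j x).
  pose h2 j (x : measurableTypeR R) : R := \1_(A j) x * cm_factor j x.
  pose c j := fine (N01 R (sh j @^-1` A j)).
  have msh j : measurable_fun [set: measurableTypeR R] (sh j) by exact: measurable_addr.
  have mpre j : measurable (sh j @^-1` A j) by rewrite -[_ @^-1` _]setTI; exact: msh.
  have cE j : ((c j)%:E = N01 R (sh j @^-1` A j))%E by rewrite fineK// fin_num_measure.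
  have mind j : measurable_fun [set: measurableTypeR R] (\1_(A j) : measurableTypeR R -> R).
    exact: measurable_indic.
  have mh1 j : measurable_fun [set: measurableTypeR R] (h1 j).
    exact: (measurableT_comp (mind j) (msh j)).
  have mh2 j : measurable_fun [set: measurableTypeR R] (h2 j).
    by apply: measurable_funM => //; exact: measurable_cm_factor.
  have h10 j x : 0 <= h1 j x by rewrite /h1 indicE.
  have h20 j x : 0 <= h2 j x by rewrite /h2 indicE mulr_ge0// expR_ge0.
  have c1 j : (\int[N01 R]_x (h1 j x)%:E = (c j)%:E)%E.
    by rewrite cE -[X in N01 R X]setIT -integral_indic.
  have c2 j : (\int[N01 R]_x (h2 j x)%:E = (c j)%:E)%E.
    rewrite -c1 [RHS](@ge0_integral_N01_shift R (dl j) (fun x => (\1_(A j) x)%:E)).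
    - by apply: eq_integral => x _; rewrite -EFinM.
    - exact/measurable_EFinP.
    - by move=> x; rewrite lee_fin indicE.
  have e1 j : (\int[P]_t (h1 j (Z j t))%:E = (c j)%:E)%E.
    rewrite (@ge0_integral_lawZ R _ T P _ _ mZ lawZ j (fun x => (h1 j x)%:E)) ?c1//.
      exact/measurable_EFinP.
    by move=> x; rewrite lee_fin.
  have e2 j : (\int[P]_t (h2 j (Z j t))%:E = (c j)%:E)%E.
    rewrite (@ge0_integral_lawZ R _ T P _ _ mZ lawZ j (fun x => (h2 j x)%:E)) ?c2//.
      exact/measurable_EFinP.
    by move=> x; rewrite lee_fin.
  have p1 := indep_prod_ge0 mZ indZ mh1 h10 e1.
  have p2 := indep_prod_ge0 mZ indZ mh2 h20 e2.
  transitivity (\int[P]_t (\prod_j h1 j (Z j t))%:E)%E.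
    rewrite [LHS]lawE.
    have mb : measurable (zvec dl @^-1` box A).
      by rewrite -[_ @^-1` _]setTI; exact: measurable_zvec.
    rewrite -[X in P X]setIT -integral_indic//; apply: eq_integral => t _.
    by rewrite -indic_box// !indicE; congr (_%:R%:E); apply/idP/idP; rewrite !inE.
  rewrite p1 -p2 [RHS]wlawE//; apply: eq_integral => t _.
  rewrite -EFinM indic_box /cm_density -big_split/=; congr (_%:E).
  by apply: eq_bigr => j _; rewrite addr0.
- by move=> k; rewrite ltey_eq fin_num_measure.
Qed.

(** In each coordinate the Gaussian moment generating function at [alpha * dl j] contributes
    [alpha^2] and the normalisation [- alpha]; independence multiplies the factors. *)
Lemma cm_density_moment (alpha : R) :
  (\int[P]_t (cm_density t `^ alpha)%:E =
   (expR ((alpha ^+ 2 - alpha) * (\sum_j dl j ^+ 2) / 2))%:E)%E.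
Proof.
have E j : (\int[P]_t (cm_factor j (Z j t) `^ alpha)%:E =
    (expR ((alpha ^+ 2 - alpha) * dl j ^+ 2 / 2))%:E)%E.
  have pE x : cm_factor j x `^ alpha =
      expR (- (alpha * dl j ^+ 2 / 2)) * expR (alpha * dl j * x).
    rewrite /cm_factor /powR gt_eqF ?expR_gt0// expRK -expRD; congr expR.
    by ring.
  rewrite (@ge0_integral_lawZ R _ T P _ _ mZ lawZ j (fun x => (cm_factor j x `^ alpha)%:E)).
  - under eq_integral do rewrite pE EFinM.
    rewrite ge0_integralZl// ?lee_fin ?expR_ge0//.
    + by rewrite integral_N01_expR -EFinM -expRD; congr (expR _)%:E; field.
    + by apply/measurable_EFinP; apply: measurableT_comp => //; exact: measurable_funM.
  - apply/measurable_EFinP; apply: (measurableT_comp (measurable_powR _)).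
    exact: measurable_cm_factor.
  - by move=> x; rewrite lee_fin powR_ge0.
under eq_integral => t _.
  rewrite (_ : cm_density t `^ alpha = \prod_j (cm_factor j (Z j t) `^ alpha)); last first.
    suff [] : \prod_j cm_factor j (Z j t) `^ alpha = (\prod_j cm_factor j (Z j t)) `^ alpha /\
      0 <= \prod_j cm_factor j (Z j t) by [].
    elim/big_ind2 : _ => [|x1 x2 y1 y2 [-> x0] [-> y0]|j _]; first by rewrite powR1.
      by rewrite powRM// mulr_ge0.
    by rewrite expR_ge0.
  over.
rewrite (@indep_prod_ge0 R _ T P _ _ _ Z (fun j x => cm_factor j x `^ alpha) _ mZ indZ _ _ E).
- rewrite -expR_sum; congr (expR _)%:E.
  by rewrite mulr_sumr mulr_suml.
- move=> j; apply: (measurableT_comp (measurable_powR _)); exact: measurable_cm_factor.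
- by move=> j x; exact: powR_ge0.
Qed.

End cameron_martin.

(** * Measurability of the released output *)

Section measurable_release.
Context (R : realType).

Section generic.
Context dT (T : measurableType dT).

Lemma measurable_bigmax (K : Type) (r : seq K) (F0 : T -> R) (F : K -> T -> R) :
  measurable_fun [set: T] F0 -> (forall i, measurable_fun [set: T] (F i)) ->
  measurable_fun [set: T] (fun t => \big[Num.max/F0 t]_(i <- r) F i t).
Proof.
move=> mF0 mF; elim: r => [|i r ih]; first by under eq_fun do rewrite big_nil.
by under eq_fun do rewrite big_cons; exact: measurable_maxr.
Qed.

(* the minimiser is a function of the finite table of comparisons *)
Lemma measurable_argmin (K : finType) (i0 m : K) (F : K -> T -> R) :
  (forall i, measurable_fun [set: T] (F i)) ->
  measurable [set t | [arg min_(i < i0) F i t]%O = m].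
Proof.
move=> mF; pose tab t := [ffun p : K * K => F p.1 t <= F p.2 t].
pose G (b : {ffun K * K -> bool}) := odflt i0 [pick i | [forall j, b (i, j)]].
have GE t : [arg min_(i < i0) F i t]%O = G (tab t).
  rewrite /Order.arg_min /extremum /G; congr odflt; apply: eq_pick => i /=.
  by apply: eq_forallb => j; rewrite ffunE.
rewrite (_ : [set t | _] = \bigcup_(b in [set b | G b = m]) [set t | tab t = b]); last first.
  apply/seteqP; split => [t /= tm|t [b /= <- <-]]; last by rewrite GE.
  by exists (tab t) => //=; rewrite -GE.
apply: fin_bigcup_measurable => [|b _]; first exact: finite_finset.
rewrite (_ : [set t | _] = \bigcap_(p in [set: K * K]) [set t | (F p.1 t <= F p.2 t) = b p]).
  apply: fin_bigcap_measurable => [|p _]; first exact: finite_finset.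
  have := measurable_fun_ler (mF p.1) (mF p.2).
  by move=> /(_ measurableT [set b p]); rewrite setTI; apply.
apply/seteqP; split => [t /= <- p _ /=|t tb]; first by rewrite ffunE.
by apply/ffunP => p; rewrite ffunE; exact: (tb p I).
Qed.

Definition cmeas (F : T -> R[i]) :=
  measurable_fun [set: T] (fun t => complex.Re (F t)) /\
  measurable_fun [set: T] (fun t => complex.Im (F t)).

Lemma cmeas_cst a : cmeas (fun=> a). Proof. by split; exact: measurable_cst. Qed.

Lemma cmeasD F G : cmeas F -> cmeas G -> cmeas (fun t => F t + G t).
Proof.
move=> [f1 f2] [g1 g2]; split.
  by under eq_fun do rewrite cReD; exact: measurable_funD.
by under eq_fun do rewrite cImD; exact: measurable_funD.
Qed.

Lemma cmeasZ a F : cmeas F -> cmeas (fun t => a * F t).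
Proof.
move=> [f1 f2]; split.
  by under eq_fun do rewrite cReM; apply: measurable_funB; exact: measurable_funM.
by under eq_fun do rewrite cImM; apply: measurable_funD; exact: measurable_funM.
Qed.

Lemma cmeasN F : cmeas F -> cmeas (fun t => - F t).
Proof. by move=> mF; under eq_fun do rewrite -mulN1r; exact: cmeasZ. Qed.

Lemma measurable_sqmod F : cmeas F -> measurable_fun [set: T] (fun t => sqmod (F t)).
Proof. by move=> [f1 f2]; apply: measurable_funD; exact: measurable_funX. Qed.

End generic.

Context (n d : nat) (rho : R).
Local Notation J := (Jmax R n d).
Local Notation NI := (noise_idx J d * bool)%type.
Local Notation N := #|{: NI}|.
Implicit Types (x : 'I_n -> 'rV[R]_d) (v : bRV R N).

(** Reads the noise off a single real vector, so that the release becomes a Borel function of a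
    Gaussian vector, the form that the Cameron--Martin formula handles. *)
Definition vnoise v : noise_idx J d -> R[i] := fun i =>
  Complex ((v : 'rV[R]_N) ord0 (enum_rank (i, true)))
          ((v : 'rV[R]_N) ord0 (enum_rank (i, false))).

Lemma cmeas_vnoise i : cmeas (fun v => vnoise v i).
Proof. by split; exact: coord_measurable_bRV. Qed.

Lemma cmeas_noise_coef m k : cmeas (fun v => noise_coef rho (vnoise v) m k).
Proof.
rewrite /noise_coef; case: pickP => [l _|_]; last exact: cmeas_cst.
by apply: cmeasZ; exact: cmeas_vnoise.
Qed.

Lemma cmeas_ncoef x m k :
  cmeas (fun v => ncoef (theta_tilde x) (noise_coef rho (vnoise v)) m k).
Proof. by apply: cmeasD; [exact: cmeas_cst|exact: cmeas_noise_coef]. Qed.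

Lemma cmeas_xcoef x m k :
  cmeas (fun v => xcoef (@freq R n d) (theta_tilde x) (noise_coef rho (vnoise v)) m k).
Proof.
by rewrite /xcoef; case: (k \in @freq R n d m); [exact: cmeas_ncoef|exact: cmeas_cst].
Qed.

Lemma measurable_B2 x m : measurable_fun [set: bRV R N] (fun v => B2 rho x (vnoise v) m).
Proof.
have mgap m' : measurable_fun [set: bRV R N] (fun v =>
    gap (@freq R n d) (theta_tilde x) (noise_coef rho (vnoise v)) m m').
  apply: measurable_sum => k; apply: measurable_sqmod; apply: cmeasD.
    exact: cmeas_xcoef.
  by apply: cmeasN; exact: cmeas_ncoef.
rewrite (_ : (fun v => _) = fun v => crit (@freq R n d) (theta_tilde x)
  (noise_coef rho (vnoise v)) (fun m => Lambda1 n d rho J.+1 (expn 2 m)) m); last first.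
  by apply/funext => v; rewrite B2E.
by apply: measurable_bigmax => [|m']; apply: measurable_funB.
Qed.

Lemma measurable_Mhat x m : measurable [set v | Mhat rho x (vnoise v) = m].
Proof.
apply: (measurable_argmin _ _ (F := fun m v => B2 rho x (vnoise v) m +
  Lambda2 n d rho J.+1 (expn 2 m))) => i.
by apply: measurable_funD => //; exact: measurable_B2.
Qed.

(** The selected level takes finitely many values, so each output coordinate is a finite sum of
    indicators of a selected level times coefficients of that fixed level. *)
Lemma measurable_release x :
  measurable_fun [set: bRV R N] (fun v => release rho x (vnoise v) : out_type R n d).
Proof.
apply/measurable_fun_tnthP => i.
pose k := kval (enum_val i).1; pose c := (enum_val i).2.
pose comp (z : R[i]) : R := if c then complex.Re z else complex.Im z.
rewrite (_ : _ \o _ = fun v => \sum_(m : 'I_J.+1)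
   \1_[set v | Mhat rho x (vnoise v) = m] v *
   comp (xcoef (@freq R n d) (theta_tilde x) (noise_coef rho (vnoise v)) m k)); last first.
  apply/funext => v.
  rewrite [LHS](_ : _ = comp (L2inner (fhat_sel rho x (vnoise v)) (phi k))); last first.
    exact: tnth_mktuple.
  rewrite (bigD1 (Mhat rho x (vnoise v)))//= indicE mem_set// mul1r big1 ?addr0; last first.
    by move=> m mM; rewrite indicE memNset ?mul0r// => /esym/eqP; exact/negP.
  by rewrite L2innerE ?coef_fhat//; exact: cbm_fhat.
apply: measurable_sum => m; apply: measurable_funM.
  by apply: measurable_indic; exact: measurable_Mhat.
by rewrite /comp {comp}; case: c; case: (cmeas_xcoef x m k).
Qed.

End measurable_release.

(** * Sensitivity and the privacy guarantee *)

Section privacy.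
Context (R : realType) (n d : nat) (rho : R).
Hypotheses (n0 : (0 < n)%N) (rho0 : 0 < rho).
Local Notation J := (Jmax R n d).
Local Notation NI := (noise_idx J d * bool)%type.
Local Notation N := #|{: NI}|.
Implicit Types (x : 'I_n -> 'rV[R]_d).

(** Selection and output are computed from the family of all [fhat] alone; this is post-processing,
    so it suffices to protect the noisy coefficients. *)
Lemma release_ext x x' (xi xi' : noise_idx J d -> R[i]) :
  fhat rho x xi = fhat rho x' xi' -> release rho x xi = release rho x' xi'.
Proof. by move=> E; rewrite /release /fhat_sel /Mhat /B2 E. Qed.

Lemma sqmod_theta_diff x x' j0 k : (forall j, j != j0 -> x j = x' j) ->
  sqmod (theta_tilde x k - theta_tilde x' k) <= 4 / n%:R ^+ 2.
Proof.
move=> xx'; rewrite /theta_tilde -mulrBr -sumrB (bigD1 j0)//= big1 => [|j /xx' ->];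
  last by rewrite subrr.
rewrite addr0 sqmodM natr_complexV.
have p1 y : sqmod (conjc (phi k y)) = 1 :> R.
  by rewrite /sqmod cReJ cImJ sqrrN; exact: ck2Dsk2.
have := sqmodD_le (conjc (phi k (x j0))) (- conjc (phi k (x' j0))).
rewrite sqmodN !p1 => H.
rewrite {1}/sqmod /= expr0n addr0 exprVn mulrC ler_wpM2r//.
by apply: (le_trans H); lra.
Qed.

(** The translation of the standard Gaussian noise that turns the noisy coefficients of [x'] into
    those of [x]. *)
Definition shift x x' (a : NI) : R :=
  let z := theta_tilde x (kval (tagged a.1)) - theta_tilde x' (kval (tagged a.1)) in
  (if a.2 then complex.Re z else complex.Im z) / sig rho (tag a.1).

Lemma sig_gt0 (m : 'I_J.+1) : 0 < sig rho m.
Proof.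
rewrite /sig /sigmaM divr_gt0// mulr_gt0// ?ltr0n// sqrtr_gt0 ?divr_gt0//.
Qed.

(** The calibration of [sigmaM]: one changed observation moves a coefficient by at most [2 / n], so
    a level with [D] frequencies contributes at most [D * (4 / n^2) / sigma^2 = rho / |M|], and the
    [|M|] levels add up to [rho]. *)
Lemma sum_shift_sqr x x' j0 : (forall j, j != j0 -> x j = x' j) ->
  \sum_a shift x x' a ^+ 2 <= rho.
Proof.
move=> xx'; rewrite -(pair_bigA _ (fun i c => shift x x' (i, c) ^+ 2))/=.
have divX2 (a c s : R) : (a / s) ^+ 2 + (c / s) ^+ 2 = (a ^+ 2 + c ^+ 2) / s ^+ 2.
  by rewrite !expr_div_n mulrDl.
have nR : 0 < n%:R :> R by rewrite ltr0n.
have J0 : 0 < J.+1%:R :> R by [].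
apply: (@le_trans _ _ (\sum_(i : noise_idx J d) 4 / n%:R ^+ 2 / sig2 rho (tag i))).
  apply: ler_sum => i _; rewrite big_bool /shift /= divX2.
  by rewrite sig_sqr// ler_wpM2r ?invr_ge0 ?sig2_ge0//; exact: (sqmod_theta_diff _ xx').
have sigE := @sig_big_dep R 0 +%R _ (fun m : 'I_J.+1 => 'rV['I_(2 * expn 2 m + 1)]_d)
  xpredT (fun _ _ => true) (fun m _ => 4 / n%:R ^+ 2 / sig2 rho m).
rewrite (_ : \sum_(i : noise_idx J d) _ = \sum_(m : 'I_J.+1)
  \sum_(l : 'rV['I_(2 * expn 2 m + 1)]_d) 4 / n%:R ^+ 2 / sig2 rho m); last exact: esym sigE.
rewrite (eq_bigr (fun=> rho / J.+1%:R)) => [|m _].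
  by rewrite sumr_const card_ord -[leLHS]mulr_natr divfK// gt_eqF.
have cardl : #|{: 'rV['I_(2 * expn 2 m + 1)]_d}| = expn (2 * expn 2 m + 1) d.
  by rewrite card_mx mul1n card_ord.
rewrite sumr_const [X in _ *+ X]cardl /sig2 -[LHS]mulr_natl -/(dimS m).
have D0 : 0 < dimS m by rewrite /dimS ltr0n expn_gt0 addn1.
by field; rewrite !gt_eqF.
Qed.

Lemma release_shift x x' (v : bRV R N) :
  release rho x (vnoise v) =
  release rho x' (vnoise (\row_j ((v : 'rV[R]_N) ord0 j + shift x x' (enum_val j)))).
Proof.
apply: release_ext; apply/funext => m; apply/funext => y.
apply: eq_bigr => l _; congr (_ * _).
have s0 : sig rho m != 0 by rewrite gt_eqF// sig_gt0.
have canc (a e v0 : R) : a + sig rho m * v0 = e + sig rho m * (v0 + (a - e) / sig rho m).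
  by rewrite mulrDr mulrCA divff// mulr1; ring.
have shiftE c : shift x x' (existT _ m l, c) = (if c then
  complex.Re (theta_tilde x (kval l) - theta_tilde x' (kval l))
  else complex.Im (theta_tilde x (kval l) - theta_tilde x' (kval l))) / sig rho m by [].
rewrite /vnoise !mxE !enum_rankK !shiftE -/(sig rho m).
move: (theta_tilde x (kval l)) (theta_tilde x' (kval l)) (sig rho m) s0 canc => [a1 a2] [e1 e2] sg _ canc.
apply: complex_ext => /=; rewrite !mul0r ?subr0 ?addr0; exact: canc.
Qed.

Context dT (T : measurableType dT) (P : probability T R).
Variable Z : NI -> T -> R.
Hypothesis mZ : forall i, measurable_fun [set: T] (Z i : T -> measurableTypeR R).
Hypothesis indZ : @indep_family R _ _ P _ (measurableTypeR R) _ Z.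
Hypothesis lawZ : forall i (A : set (measurableTypeR R)), measurable A ->
  P (Z i @^-1` A) = N01 R A.

Theorem release_zCDP (mech : ('I_n -> 'rV[R]_d) -> probability (out_type R n d) R) :
  (forall x (A : set (out_type R n d)), measurable A ->
     mech x A = P ((fun w => release rho x (noise_of Z w)) @^-1` A)) ->
  zCDP rho (@unit_cube R d) mech.
Proof.
move=> mechE x x' _ _ [j0 xx'] alpha alpha1.
pose Z' (j : 'I_N) : T -> measurableTypeR R := Z (enum_val j).
have mZ' j : measurable_fun [set: T] (Z' j) by exact: mZ.
have indZ' : indep_family P Z' by exact: indep_family_inj (@enum_val_inj _ _) indZ.
have lawZ' j A : measurable A -> P (Z' j @^-1` A) = N01 R A by exact: lawZ.
pose dl (j : 'I_N) := shift x x' (enum_val j).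
have noiseE w : noise_of Z w = vnoise (zvec Z' (fun=> 0) w).
  by apply/funext => i; rewrite /noise_of /vnoise !mxE /Z' !enum_rankK !addr0.
pose Y w : out_type R n d := release rho x' (vnoise (zvec Z' (fun=> 0) w)).
have mY : measurable_fun [set: T] Y.
  have h1 := measurable_release rho x'.
  have h2 := measurable_zvec mZ' (fun=> 0).
  have := measurableT_comp h1 h2. exact.
pose K := expR ((alpha ^+ 2 - alpha) * (\sum_j dl j ^+ 2) / 2).
have dl2 : \sum_j dl j ^+ 2 <= rho.
  rewrite -(big_enum_val (fun a : NI => shift x x' a ^+ 2)) (eq_bigl xpredT)//.
  exact: (sum_shift_sqr xx').
have dl0 : 0 <= \sum_j dl j ^+ 2 by apply: sumr_ge0 => j _; exact: sqr_ge0.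
have a0 : 0 < alpha - 1 by rewrite subr_gt0.
have a2 : alpha ^+ 2 - alpha = alpha * (alpha - 1) by ring.
have K1 : 1 <= K.
  rewrite -expR0 ler_expR a2 divr_ge0// !mulr_ge0// ?(ltW a0)//.
  exact: le_trans (ltW alpha1).
apply: (le_trans (@renyi_le R _ _ (mech x) (mech x') _ T P Y (cm_density Z' dl) alpha K
  mY (measurable_cm_density dl mZ') (cm_density_ge0 _ _) _ _ alpha1 _ K1)).
- move=> A mA; rewrite mechE//.
  have mB : measurable ((fun v => release rho x' (vnoise v)) @^-1` A : set (bRV R N)).
    by rewrite -[_ @^-1` _]setTI; exact: measurable_release.
  rewrite (_ : _ @^-1` A = zvec Z' dl @^-1` ((fun v => release rho x' (vnoise v)) @^-1` A)).
    rewrite (cameron_martin dl mZ' indZ' lawZ' mB); apply: eq_integral => t _.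
    by congr (_%:E * _)%E; rewrite !indicE; congr (_%:R); apply/idP/idP; rewrite !inE.
  have relE w : release rho x (noise_of Z w) = release rho x' (vnoise (zvec Z' dl w)).
    rewrite noiseE (release_shift x x'); congr (release _ _ (vnoise _)).
    by apply/rowP => j; rewrite !mxE addr0.
  by apply/seteqP; split => w /=; rewrite relE.
- have YE : (fun w => release rho x' (noise_of Z w)) = Y by apply/funext => w; rewrite /Y noiseE.
  by move=> A mA; rewrite (mechE x' A mA) YE.
- by rewrite (cm_density_moment dl mZ' indZ' lawZ').
(* After division by [alpha - 1] the exponent is [alpha * S / 2] with [S <= rho], half of the
   allowed [rho * alpha]. *)
rewrite lee_fin /K expRK a2; move: dl2 dl0; move: (\sum_j dl j ^+ 2) => S Sr S0.
have -> : (alpha - 1)^-1 * (alpha * (alpha - 1) * S / 2) = alpha * S / 2.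
  by field; rewrite gt_eqF.
have ap : 0 < alpha by exact: lt_trans alpha1.
rewrite -mulrA mulrC ler_wpM2r ?(ltW ap)//.
by rewrite ler_pdivrMr//; lra.
Qed.

End privacy.

Theorem theorem6p3 (R : realType) (beta : nat) : (1 <= beta)%N ->
  exists (C1 : R -> R) (C2 : nat -> R -> R),
    (forall L : R, 0 < L -> 0 < C1 L) /\
    (forall (d : nat) (b : R), 0 < C2 d b) /\
    forall (L : R) (d : nat) (f : 'rV[R]_d -> R),
      0 < L -> (0 < d)%N ->
      sobolev_periodic beta L f -> cube_density f ->
      forall (n : nat) (rho : R), 0 < rho ->
      C2 d (sup_norm f) <= Num.min (n%:R) (n%:R * Num.sqrt (rho / log2 (n%:R))) ->
      forall (dT : measure_display) (T : measurableType dT) (P : probability T R)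
             (X : 'I_n -> T -> 'rV[R]_d)
             (Z : (noise_idx (Jmax R n d) d * bool)%type -> T -> R),
        sample_model P f X Z ->
        (forall mech : ('I_n -> 'rV[R]_d) -> probability (out_type R n d) R,
           (forall x (A : set (out_type R n d)), measurable A ->
              mech x A = P ((fun w => release rho x (noise_of Z w)) @^-1` A)%classic) ->
           zCDP rho (@unit_cube R d) mech) /\
        (\int[P]_w (L2sq (fun y => ((f y)%:C)%C - fhat_sel rho (fun j => X j w) (noise_of Z w) y))%:E
         <= (C1 L * Num.max (n%:R `^ (- (2 * beta%:R) / (2 * beta%:R + d%:R)))
                ((n%:R * Num.sqrt rho / Num.sqrt (log2 (n%:R)))
                   `^ (- (2 * beta%:R) / (beta%:R + d%:R))))%:E)%E.
Proof.
(* The first witness involves [L] alone, the second only [beta], [d] and the supremum of [f]. *)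
move=> beta1; exists (fun L => 18 * L ^+ 2 + 6516), (threshold beta); split; [|split].
- move=> L L0; apply: ltr_wpDl; last by rewrite ltr0n.
  by rewrite mulr_ge0// sqr_ge0.
- by move=> d b; apply: lt_le_trans (threshold_pow3 _ _ _); rewrite exprn_gt0.
move=> L d f L0 d0 [g [cg gf gL pg]] df n rho rho0.
rewrite le_min => /andP[hN hs] dT T P X Z sm.
have n0 : (0 < n)%N.
  by rewrite -(ltr0n R); apply: (@lt_le_trans _ _ (3 : R)) => //; exact: (N_ge3 d0 rho0 hN hs).
split.
  move=> mech; apply: (release_zCDP n0 rho0).
  - exact: (noise_measurable sm).
  - exact: (noise_indep sm).
  - exact: (noise_law sm).
have [m hm] := numeric_bound d0 rho0 hN hs L.
apply: le_trans (risk_bound n0 rho0 beta1 cg gf gL pg df sm m) _.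
by rewrite lee_fin.
Qed.
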